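(* Let $\nu\in\Lambda(S(\mathfrak{n})^N)$ and write $\nu=\sum_{\beta\in\mathcal{B}}b_\beta\,\beta$ with $b_\beta$ nonnegative integers. Then $$\sum_{\beta\in\mathcal{B}}b_\beta=\deg\nu,$$ and as a function $\xi_\nu|_{\mathfrak{r}_-^{\times}}$ does not vanish identically, and up to a scalar $$\xi_\nu|_{\mathfrak{r}_-^{\times}}=\prod_{\beta\in\mathcal{B}}e_\beta^{b_\beta}.$$
   Context: Let $\mathfrak{g}$ be a complex semisimple Lie algebra with triangular decomposition $\mathfrak{g}=\mathfrak{n}_-+\mathfrak{h}+\mathfrak{n}$, where $\mathfrak{h}$ is a Cartan subalgebra and $\mathfrak{b}=\mathfrak{h}+\mathfrak{n}$ is a Borel subalgebra. $\Delta\subset\mathfrak{h}^*$ is the set of roots, $\Delta_+$ the set of roots of $\mathfrak{n}$, and $\Pi\subset\Delta_+$ the simple roots. For each root $\varphi$ let $e_\varphi$ be a root vector, chosen so that $(e_\varphi,e_{-\varphi})=1$ for the Killing form $(\cdot,\cdot)$; the same notation is used for the induced form on $\mathfrak{h}^*$. $G$ is a complex simply connected semisimple Lie group with Lie algebra $\mathfrak{g}$, and $H,N,B$ are the (connected) Lie subgroups corresponding to $\mathfrak{h},\mathfrak{n},\mathfrak{b}$; $B=HN$. The adjoint action of $B$ on $\mathfrak{n}$ makes the symmetric algebra $S(\mathfrak{n})$ a $B$-module, and $S(\mathfrak{n})^N$ denotes the ring of $N$-invariants, which is an $H$-module. Using the Killing form, $\mathfrak{n}_-$ is identified with $\mathfrak{n}^*$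 and $S(\mathfrak{n})$ with the ring of polynomial functions on $\mathfrak{n}_-$; in particular $e_\beta$ is the linear function $v\mapsto(e_\beta,v)$ on $\mathfrak{n}_-$. Weights. $\Lambda\subset\mathfrak{h}^*$ is the $H$-weight lattice, and $\Lambda(S(\mathfrak{n})^N)\subset\Lambda$ is the set of $H$-weights occurring in $S(\mathfrak{n})^N$. Each such weight $\nu$ occurs with multiplicity $1$ in $S(\mathfrak{n})^N$, and $\xi_\nu\in S(\mathfrak{n})^N$ denotes the corresponding nonzero $H$-weight vector of weight $\nu$, unique up to scalar. By multiplicity one, $\xi_\nu$ is a homogeneous polynomial, and $\deg\nu$ is defined so that $\xi_\nu\in S^{\deg\nu}(\mathfrak{n})$. Every $\nu\in\Lambda(S(\mathfrak{n})^N)$ is dominant and lies in $\Lambda_{\mathcal{B}}=\bigoplus_{\beta\in\mathcal{B}}\mathbb{Z}\beta$, so it is uniquely of the form $\sum_{\beta\in\mathcal{B}}b_\beta\beta$ with nonnegative integers $b_\beta$. Cascade. For $\varphi\in\Delta_+$ write $\varphi=\sum_{\alpha\in\Pi}n_\alpha(\varphi)\alpha$ and put $\Pi(\varphi)=\{\alpha\in\Pi\mid n_\alpha(\varphi)>0\}$, a connected set defining a simple Lie subalgebra $\mathfrak{g}(\varphi)$ with simple roots $\Pi(\varphi)$. $\varphi$ is locally high if it is the highest root of $\mathfrak{g}(\varphi)$. If so, put $\Pi(\varphi)^o=\{\alpha\in\Pi(\varphi)\mid(\alpha,\varphi)=0\}$, let $\mathfrak{g}(\varphi)^o$ be the semisimple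 Lie algebra with simple roots $\Pi(\varphi)^o$, and call $\varphi'$ an offspring of $\varphi$ if $\varphi'$ is the highest root of a simple component of $\mathfrak{g}(\varphi)^o$ (it is again locally high). A cascade chain is a sequence $\beta_1',\ldots,\beta_k'$ in which $\beta_1'$ is the highest root of a simple component of $\mathfrak{g}$ and each $\beta_j'$, $j>1$, is an offspring of $\beta_{j-1}'$. The cascade $\mathcal{B}$ is the set of all members of cascade chains; its elements are pairwise strongly orthogonal. $\mathfrak{r}_-^{\times}=\{\sum_{\beta\in\mathcal{B}}a_\beta e_{-\beta}\mid a_\beta\in\mathbb{C},\ a_\beta\ne0\ \text{for all }\beta\in\mathcal{B}\}\subset\mathfrak{n}_-$. *)

(* Defs.v *)
From HB Require Import structures.
From mathcomp Require Import all_boot all_order all_algebra complex.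
From mathcomp Require Import boolp classical_sets reals topology normedtype.
From mathcomp Require Import sequences.
From mathcomp Require Import -(notations) mpoly.

Set Implicit Arguments.
Unset Strict Implicit.
Unset Printing Implicit Defensive.

Import Order.TTheory GRing.Theory Num.Theory.
Import numFieldNormedType.Exports.
Local Open Scope ring_scope.

HB.mixin Record isLieAlgebra (K : fieldType) V of Vector K V := {
  bracket : V -> V -> V;
  bracket_linearl : forall y, linear (bracket^~ y);
  bracket_linearr : forall x, linear (bracket x);
  bracketxx : forall x, bracket x x = 0;
  bracket_jacobi : forall x y z,
    bracket x (bracket y z) + bracket y (bracket z x)
      + bracket z (bracket x y) = 0
}.

#[short(type="lieAlgType")]
HB.structure Definition LieAlgebra (K : fieldType) :=
  { V of isLieAlgebra K V & Vector K V }.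

Section LieTheory.
Variables (K : numClosedFieldType) (g : lieAlgType K).
Implicit Types (x y : g) (U L I J : {vspace g}).

Definition ad x : 'End(g) := linfun (bracket x).

(* Matrices act on row vectors, so that admx is an anti-representation. *)
Definition admx x : 'M[K]_(\dim {:g}) :=
  passmx.mxof (vbasis {:g}) (vbasis {:g}) (ad x).

Definition killing x y : K := \tr (admx x *m admx y).

Definition lie_prod U L : {vspace g} :=
  <<[seq bracket x y | x <- vbasis U, y <- vbasis L]>>%VS.

Definition lie_ideal L I : Prop := (I <= L)%VS /\ (lie_prod L I <= I)%VS.

Definition solvable_lie U : Prop :=
  exists k, iter k (fun W => lie_prod W W) U = 0%VS.

Definition semisimple_lie : Prop :=
  forall I, lie_ideal {:g} I -> solvable_lie I -> I = 0%VS.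

Definition simple_lie I : Prop :=
  lie_prod I I <> 0%VS /\ forall J, lie_ideal I J -> J = 0%VS \/ J = I.

Definition simple_component L I : Prop := lie_ideal L I /\ simple_lie I.

(* The chain U, U + [U, U], ... is increasing, so it is stationary after at
   most \dim g steps, and it stops at the subalgebra generated by U. *)
Definition lie_gen U : {vspace g} :=
  iter (\dim {:g}) (fun W => W + lie_prod W W)%VS U.

(* Maximal abelian, with semisimple adjoint action; for a complex semisimple
   Lie algebra this is the usual definition of a Cartan subalgebra. *)
Definition cartan (h : {vspace g}) : Prop :=
  [/\ lie_prod h h = 0%VS,
      forall U, (h <= U)%VS -> lie_prod U U = 0%VS -> U = h
    & forall x, x \in h -> diagonalizable (admx x)].

Definition hdual (h : {vspace g}) := 'Hom(subvs_of h, K^o).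

(* The limit of a sequence of vectors, taken coordinatewise. *)
Definition vlim (u : nat -> g) : g :=
  \sum_(i < \dim {:g})
     limn (fun k => coord (vbasis {:g}) i (u k)) *: (vbasis {:g})`_i.

(* Ad (exp x) = exp (ad x). *)
Definition Ad_exp x y : g :=
  vlim (fun k => \sum_(j < k) (j`!%:R)^-1 *: iter j (ad x) y).

(* The image under Ad of the connected Lie subgroup with Lie algebra U: a
   connected Lie group is generated by the exponentials. *)
Inductive Ad_group U : (g -> g) -> Prop :=
| Ad_group1 : Ad_group U id
| Ad_groupM x t : x \in U -> Ad_group U t -> Ad_group U (Ad_exp x \o t).

Definition cexp (z : K) : K :=
  limn (fun k => \sum_(j < k) (j`!%:R)^-1 * z ^+ j).

(* S(U): the polynomial ring on a basis of U. *)
Definition Sym U := mpoly (\dim U) K.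

Definition Sym_inj U x : Sym U :=
  \sum_(i < \dim U) coord (vbasis U) i x *: mpolyX K (mnm1 i).

(* The homogeneous component S^d(U). *)
Definition in_Sym_deg U d (f : Sym U) : bool := f \is ishomog1 d mdeg.

(* The algebra endomorphism of S(U) extending an endomorphism of U. *)
Definition Sym_act U (t : g -> g) (f : Sym U) : Sym U :=
  comp_mpoly [tuple Sym_inj U (t (vbasis U)`_i) | i < \dim U] f.

(* The Killing form turns an element of S(U) into a polynomial function: the
   vector x of U is the linear function killing x. *)
Definition Sym_eval U (f : Sym U) (v : g) : K :=
  meval (fun i : 'I_(\dim U) => killing (vbasis U)`_i v) f.

End LieTheory.

Section Cascade.
Variables (K : numClosedFieldType) (g : lieAlgType K) (h : {vspace g}).
Implicit Types (phi psi nu : hdual h) (L : {vspace g}) (P S : seq (hdual h)).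

Definition rootspace phi : {vspace g} :=
  (\bigcap_(x <- vbasis {: subvs_of h})
     passmx.leigenspace (ad (vsval x)) (phi x))%VS.

Definition is_root phi : Prop := phi != 0 /\ rootspace phi != 0%VS.

(* The form induced on the dual of h: the Killing form, restricted to h, is
   nondegenerate, and dual_vec is the inverse of x |-> (x, -). *)
Definition dual_vec : hdual h -> subvs_of h :=
  (linfun (fun x : subvs_of h =>
     linfun (fun y : subvs_of h => killing (vsval x) (vsval y) : K^o)
       : hdual h))^-1%VF.

Definition dual_form phi psi : K :=
  killing (vsval (dual_vec phi)) (vsval (dual_vec psi)).

(* P enumerates the roots of the nilradical n of a Borel subalgebra h + n. *)
Definition positive_system P : Prop :=
  [/\ uniq P,
      forall phi, phi \in P -> is_root phi,
      forall phi, is_root phi -> (phi \in P) = (- phi \notin P)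
    & forall phi psi,
        phi \in P -> psi \in P -> is_root (phi + psi) -> phi + psi \in P].

Variable P : seq (hdual h).

Definition nplus : {vspace g} := (\sum_(phi <- P) rootspace phi)%VS.

Definition simple_roots : seq (hdual h) :=
  [seq alpha <- P | ~~ has (fun phi => alpha - phi \in P) P].

Definition in_root_cone phi : Prop :=
  exists c : hdual h -> nat,
    phi = \sum_(alpha <- simple_roots) alpha *+ c alpha.

(* \Pi(phi); the simple roots are a basis of the dual of h. *)
Definition root_support phi : seq (hdual h) :=
  [seq nth 0 simple_roots (nat_of_ord i)
     | i <- enum 'I_(size simple_roots)
     & 0 < coord (in_tuple simple_roots) i phi].

(* The subalgebra generated by the root spaces of S and - S. *)
Definition sub_lie S : {vspace g} :=
  lie_gen (\sum_(alpha <- S) (rootspace alpha + rootspace (- alpha)))%VS.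

Definition highest_root L phi : Prop :=
  [/\ phi \in P, (rootspace phi <= L)%VS
    & forall psi, is_root psi -> (rootspace psi <= L)%VS ->
        in_root_cone (phi - psi)].

Definition locally_high phi : Prop :=
  highest_root (sub_lie (root_support phi)) phi.

Definition root_support_orth phi : seq (hdual h) :=
  [seq alpha <- root_support phi | dual_form alpha phi == 0].

Definition offspring phi phi' : Prop :=
  locally_high phi /\
  exists I, simple_component (sub_lie (root_support_orth phi)) I /\
            highest_root I phi'.

Inductive in_cascade : hdual h -> Prop :=
| cascade_head I beta :
    simple_component {:g} I -> highest_root I beta -> in_cascade beta
| cascade_step beta beta' :
    in_cascade beta -> offspring beta beta' -> in_cascade beta'.

Definition cascade : seq (hdual h) := [seq beta <- P | `[< in_cascade beta >]].

Definition root_vectors (e : hdual h -> g) : Prop :=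
  forall phi, is_root phi ->
    e phi \in rootspace phi /\ killing (e phi) (e (- phi)) = 1.

Definition N_invariant (f : Sym nplus) : Prop :=
  forall t, Ad_group nplus t -> Sym_act t f = f.

(* A weight of H is identified with its differential. *)
Definition weight_vector nu (f : Sym nplus) : Prop :=
  f != 0 /\
  forall x : subvs_of h, Sym_act (Ad_exp (vsval x)) f = cexp (nu x) *: f.

Definition r_minus_times (e : hdual h -> g) (v : g) : Prop :=
  exists a : hdual h -> K,
    (forall beta, beta \in cascade -> a beta != 0) /\
    v = \sum_(beta <- cascade) a beta *: e (- beta).

End Cascade.

(* Main.v *)
(* Every positive root phi is either in the cascade or of the form beta - phi' for exactly one
   cascade root beta and some positive root phi'. Pairing phi with phi' shows that, at each point
   of r_-^x, the tangent space of the coadjoint N-orbit and r_- together span n_-. Hence all first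
   derivatives of an N-invariant vanishing on r_-^x vanish there, and so do, by induction on the
   order, all higher derivatives: an N-invariant is determined by its restriction to r_-^x. The
   exponential of a real combination x of the coroots of the cascade multiplies the coordinate
   e_beta by exp (beta x). As the cascade is orthogonal, hence linearly independent, comparing
   weights shows that the restriction of a weight vector is a monomial, with exponents b_beta. The
   homogeneous components of the other degrees have zero restriction, so they are zero.

   The structure theory of the roots relies on the given root vectors: their normalisation
   (e_phi, e_-phi) = 1 provides the nondegeneracy of the Killing form that usually comes from
   Cartan's criterion. *)

Require Import Defs.
From HB Require Import structures.
From mathcomp Require Import all_boot all_order all_algebra complex.
From mathcomp Require Import boolp classical_sets reals topology normedtype.
From mathcomp Require Import sequences exp.
From mathcomp Require Import -(notations) mpoly.

Set Implicit Arguments.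
Unset Strict Implicit.
Unset Printing Implicit Defensive.

Import passmx Order.TTheory GRing.Theory Num.Theory.
Local Open Scope ring_scope.

(** * Brackets, traces and the Killing form *)

(** Traces take the place of sl_2 representations. The commutator of [e phi] and [e (- phi)] has
    trace zero on every subspace stable under both. Applied to root strings, possibly cut where a
    bracket vanishes, this yields that the form is real and positive on roots, the criteria for sums
    and differences of roots to be roots, and one-dimensional root spaces.

    A positive system is given by closure axioms, without a linear functional behind it. That sums
    of positive roots are nonzero, that simple roots are independent and that heights exist is
    therefore derived from the positivity of the form.

    The group acts through limits of exponential series. For a root vector the series is finite, so
    N-invariance is a polynomial identity in the parameter of the one-parameter group and can be
    differentiated formally. For the torus, elements on which the roots take real values suffice:
    there the complex exponential is the real one, whose injectivity separates the exponents. *)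

Section Bracket.
Variables (K : fieldType) (g : lieAlgType K).
Implicit Types (x y z : g).

HB.instance Definition _ x := GRing.isSemilinear.Build K g g _ (bracket x)
  (GRing.semilinear_linear (bracket_linearr x)).

Lemma bracketDr x y z : bracket x (y + z) = bracket x y + bracket x z.
Proof. exact: linearD. Qed.
Lemma bracketZr x a y : bracket x (a *: y) = a *: bracket x y.
Proof. by rewrite linearZ. Qed.
Lemma bracketDl x y z : bracket (x + y) z = bracket x z + bracket y z.
Proof. by have := bracket_linearl z 1 x y; rewrite !scale1r. Qed.

Lemma bracket0r x : bracket 0 x = 0.
Proof.
by apply: (addrI (bracket 0 x)); rewrite -bracketDl !addr0.
Qed.
Lemma bracketZl a x y : bracket (a *: x) y = a *: bracket x y.
Proof. by have := bracket_linearl y a x 0; rewrite bracket0r !addr0. Qed.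

Lemma bracketC x y : bracket y x = - bracket x y.
Proof.
have := bracketxx (x + y); rewrite bracketDl !bracketDr !bracketxx add0r addr0.
by move/eqP; rewrite addrC addr_eq0 => /eqP.
Qed.

Lemma bracket_suml I r (P : pred I) (F : I -> g) y :
  bracket (\sum_(i <- r | P i) F i) y = \sum_(i <- r | P i) bracket (F i) y.
Proof.
elim/big_rec2: _ => [|i u v _ <-]; first exact: bracket0r.
by rewrite bracketDl.
Qed.

Lemma bracket_sumr I r (P : pred I) (F : I -> g) y :
  bracket y (\sum_(i <- r | P i) F i) = \sum_(i <- r | P i) bracket y (F i).
Proof. exact: linear_sum. Qed.

Lemma bracketA x y z :
  bracket x (bracket y z) = bracket (bracket x y) z + bracket y (bracket x z).
Proof.
have := bracket_jacobi x y z.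
rewrite [bracket z (bracket x y)]bracketC [bracket z x]bracketC linearN /=.
move/eqP; rewrite -addrA addr_eq0 => /eqP ->.
by rewrite opprD !opprK addrC.
Qed.
End Bracket.

Section Trace.
Variables (K : fieldType) (V : vectType K).
Local Notation vb := (vbasis {:V}).
Implicit Types (T U : 'End(V)).

Definition lftr T : K := \tr (mxof vb vb T).

Let vbP : basis_of {:V} vb := vbasisP _.

Lemma lftrB T U : lftr (T - U) = lftr T - lftr U.
Proof. by rewrite /lftr !linearB. Qed.

Lemma lftrC T U : lftr (T \o U)%VF = lftr (U \o T)%VF.
Proof. by rewrite /lftr !(mxof_comp _ _ vbP) mxtrace_mulC. Qed.

(** The Killing form is defined through the canonical basis, whereas the traces below are computed
    in a basis of weight vectors; the two matrices of the identity between the bases are mutually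
    inverse. *)
Lemma lftrE (b : (\dim {:V}).-tuple V) : basis_of {:V} b ->
  forall T, lftr T = \sum_i coord b i (T b`_i).
Proof.
move=> bP T.
have id1 : (mxof b vb \1%VF *m mxof vb b \1%VF) = 1%:M.
  rewrite -(mxof_comp _ _ vbP) comp_lfun1l mxof1 //.
  exact: basis_free bP.
have -> : lftr T = \tr (mxof b b T).
  rewrite /lftr -[T in LHS]comp_lfun1r -[T in LHS]comp_lfun1l.
  rewrite (mxof_comp _ _ bP) (mxof_comp _ _ bP).
  by rewrite mxtrace_mulC -mulmxA id1 mulmx1.
apply: eq_bigr => i _; rewrite !mxE /=.
by rewrite vecof_delta.
Qed.
End Trace.

Section Killing.
Variables (K : numClosedFieldType) (g : lieAlgType K).
Implicit Types (x y z : g).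

Lemma adE x y : ad x y = bracket x y.
Proof. by rewrite lfunE. Qed.

Lemma adB x y : ad (bracket x y) = ((ad x \o ad y) - (ad y \o ad x))%VF.
Proof.
apply/lfunP => z; rewrite adE add_lfunE opp_lfunE !comp_lfunE !adE.
by rewrite bracketA addrK.
Qed.

Lemma killingE x y : killing x y = lftr (ad y \o ad x)%VF.
Proof.
by rewrite /lftr (mxof_comp _ _ (vbasisP _)).
Qed.

Lemma killingC x y : killing x y = killing y x.
Proof. by rewrite !killingE lftrC. Qed.

Lemma ad_linear : linear (@ad K g).
Proof.
move=> a x y; apply/lfunP => z.
by rewrite add_lfunE scale_lfunE !adE bracketDl bracketZl.
Qed.

Lemma killing_linear x : linear (killing x : g -> K^o).
Proof.
move=> a y z; rewrite /killing /admx ad_linear linearP /=.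
by rewrite mulmxDr -scalemxAr linearP.
Qed.

HB.instance Definition _ x := GRing.isSemilinear.Build K g K^o _ (killing x)
  (GRing.semilinear_linear (killing_linear x)).

Lemma killingDr x y z : killing x (y + z) = killing x y + killing x z.
Proof. exact: linearD. Qed.
Lemma killingZr x a y : killing x (a *: y) = a * killing x y.
Proof. by rewrite linearZ. Qed.
Lemma killingDl x y z : killing (y + z) x = killing y x + killing z x.
Proof. by rewrite !(killingC _ x) killingDr. Qed.
Lemma killingZl x a y : killing (a *: y) x = a * killing y x.
Proof. by rewrite !(killingC _ x) killingZr. Qed.
Lemma killing0r x : killing x 0 = 0.
Proof. exact: linear0. Qed.
Lemma killing0l x : killing 0 x = 0.
Proof. by rewrite killingC killing0r. Qed.
Lemma killing_sumr I r (P : pred I) (F : I -> g) x :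
  killing x (\sum_(i <- r | P i) F i) = \sum_(i <- r | P i) killing x (F i).
Proof. exact: linear_sum. Qed.
Lemma killing_suml I r (P : pred I) (F : I -> g) x :
  killing (\sum_(i <- r | P i) F i) x = \sum_(i <- r | P i) killing (F i) x.
Proof. by rewrite killingC killing_sumr; under eq_bigr do rewrite killingC. Qed.

Lemma killing_inv x y z : killing (bracket x y) z = killing x (bracket y z).
Proof.
rewrite !killingE !adB !(comp_lfunDl, comp_lfunDr, comp_lfunNl, comp_lfunNr).
rewrite !lftrB !comp_lfunA; congr (_ - _).
by rewrite lftrC comp_lfunA.
Qed.
End Killing.

(** * Weight bases *)

Section Subspaces.
Variables (K : numClosedFieldType) (g : lieAlgType K).
Implicit Types (x y : g) (U L W : {vspace g}).

Lemma mem_lie_prod U L x y : x \in U -> y \in L -> bracket x y \in lie_prod U L.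
Proof.
move=> /coord_vbasis -> /coord_vbasis ->.
rewrite bracket_suml memv_suml // => i _.
rewrite bracket_sumr memv_suml // => j _.
rewrite bracketZl bracketZr !memvZ // memv_span //.
by apply: allpairs_f; rewrite mem_nth ?size_tuple.
Qed.

Lemma lie_prod_sub U L W :
  (forall x y, x \in U -> y \in L -> bracket x y \in W) -> (lie_prod U L <= W)%VS.
Proof.
move=> UL; apply/span_subvP => _ /allpairsP[[x y] [/= xU yL ->]].
by apply: UL; rewrite vbasis_mem.
Qed.

Lemma lie_prod0P U L : lie_prod U L = 0%VS ->
  forall x y, x \in U -> y \in L -> bracket x y = 0.
Proof.
by move=> UL0 x y xU yL; apply/eqP; rewrite -memv0 -UL0 mem_lie_prod.
Qed.
End Subspaces.

Section WeightBasis.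
Variables (K : numClosedFieldType) (g : lieAlgType K) (h : {vspace g}).
Hypothesis hC : cartan h.
Local Notation n := (\dim {:g}).

Lemma cartan_comm (x y : g) : x \in h -> y \in h -> bracket x y = 0.
Proof. by case: hC => /lie_prod0P h0 _ _; apply: h0. Qed.

(** The space [h + <[v]>] is abelian, so it equals [h] by maximality. *)
Lemma cartan_max (v : g) : (forall x, x \in h -> bracket x v = 0) -> v \in h.
Proof.
move=> hv; case: hC => _ hmax _.
rewrite -(hmax (h + <[v]>)%VS) ?addvSl //; last first.
  apply/eqP; rewrite -subv0; apply: lie_prod_sub => x y.
  move=> /memv_addP[x1 x1h [_ /vlineP[a ->] ->]].
  move=> /memv_addP[y1 y1h [_ /vlineP[c ->] ->]].
  rewrite bracketDl !bracketDr !bracketZl !bracketZr bracketxx cartan_comm //.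
  by rewrite hv // [bracket v y1]bracketC hv // oppr0 !scaler0 !addr0 mem0v.
by apply: subvP (addvSr _ _) _ _; rewrite memv_line.
Qed.

(** The matrices [admx x], for [x] in a basis of [h], commute and are diagonalizable, hence
    simultaneously so; the rows of the diagonalizing matrix are the weight vectors. The weights
    [w i] may be zero or repeated. *)
Lemma weight_basis : exists (b : n.-tuple g) (w : 'I_n -> hdual h),
  basis_of {:g} b /\
  forall (i : 'I_n) (x : subvs_of h), bracket (vsval x) b`_i = w i x *: b`_i.
Proof.
have vbP := vbasisP {:g}.
pose As := [seq admx (vsval x) | x <- vbasis {:subvs_of h}].
have [Q Qu /allP QD] : codiagonalizable As.
  apply/codiagonalizableP; split; last first.
    by move=> _ /mapP[x _ ->]; case: hC => _ _; apply; apply: subvsP.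
  move=> _ _ /mapP[x _ ->] /mapP[y _ ->].
  rewrite /comm_mx /admx -!(mxof_comp _ _ vbP).
  congr mxof; apply/lfunP => v; rewrite !comp_lfunE !adE.
  by rewrite bracketA [bracket (vsval y) (vsval x)]cartan_comm ?subvsP // bracket0r add0r.
pose b := [tuple vecof (vbasis {:g}) (row i Q) | i < n].
have bE (i : 'I_n) : b`_i = vecof (vbasis {:g}) (row i Q).
  by rewrite -tnth_nth tnth_mktuple.
have bfree : free b.
  apply/freeP => k; under eq_bigr do rewrite bE -linearZ.
  rewrite -linear_sum => /eqP; rewrite vecof_eq0 // => /eqP k0 i.
  have : (\row_i k i) *m Q = 0.
    by rewrite mulmx_sum_row -[RHS]k0; apply: eq_bigr => j _; rewrite mxE.
  move/(congr1 (mulmx^~ (invmx Q))); rewrite mulmxK // mul0mx => /rowP/(_ i).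
  by rewrite !mxE.
have bP : basis_of {:g} b.
  by rewrite basisEfree bfree subvf size_tuple leqnn.
clearbody b.
have line (i : 'I_n) (x : subvs_of h) : bracket (vsval x) b`_i \in <[b`_i]>%VS.
  rewrite (coord_vbasis (memvf x)) linear_sum /= bracket_suml memv_suml // => j _.
  rewrite bracketZl memvZ //.
  set y := (vbasis _)`_j.
  have /QD /diagonalizable_forPex[D] : admx (vsval y) \in As.
    by apply: map_f; rewrite mem_nth ?size_tuple.
  move=> /(simmxP Qu) QE.
  have := rVof_app (vbasis {:g}) vbP (ad (vsval y)) b`_i.
  rewrite adE bE vecofK // -row_mul -[mxof _ _ _]/(admx _) QE row_mul row_diag_mx.
  rewrite -scalemxAl -rowE => E; rewrite -[bracket _ _](rVofK vbP) E linearZ /=.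
  by rewrite memvZ ?memv_line.
pose w i : hdual h :=
  linfun (fun x : subvs_of h => coord b i (bracket (vsval x) b`_i) : K^o).
exists b, w; split => // i x.
(* [linfun] accepts any function but computes only on linear ones, so the linear structure is packed
   before [lfunE] is used. *)
have wlin : linear (fun x : subvs_of h => coord b i (bracket (vsval x) b`_i) : K^o).
  by move=> a u v; rewrite linearP bracketDl bracketZl linearP.
pose wL := GRing.isSemilinear.Build K (subvs_of h) K^o _ _ (GRing.semilinear_linear wlin).
pose wM : {linear subvs_of h -> K^o} :=
    HB.pack (fun x : subvs_of h => coord b i (bracket (vsval x) b`_i) : K^o) wL.
rewrite /w -[linfun _]/(linfun wM) lfunE /=.
have /vlineP[k ->] := line i x.
by rewrite linearZ /= coord_free // eqxx mulr1.
Qed.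
End WeightBasis.

Section RootSpaces.
Variables (K : numClosedFieldType) (g : lieAlgType K) (h : {vspace g}).
Hypothesis hC : cartan h.
Implicit Types (phi psi : hdual h) (u v : g) (x y : subvs_of h).

Lemma rootspaceP phi v :
  reflect (forall x, bracket (vsval x) v = phi x *: v) (v \in rootspace phi).
Proof.
have eigE x : (v \in leigenspace (ad (vsval x)) (phi x))
    = (bracket (vsval x) v == phi x *: v).
  rewrite /leigenspace memv_ker add_lfunE opp_lfunE scale_lfunE id_lfunE adE.
  by rewrite subr_eq0.
have mem_capP (s : seq (subvs_of h)) :
    (v \in (\bigcap_(x <- s) leigenspace (ad (vsval x)) (phi x))%VS)
    = all (fun x => bracket (vsval x) v == phi x *: v) s.
  elim: s => [|x s IH]; first by rewrite big_nil memvf.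
  by rewrite big_cons memv_cap IH eigE.
rewrite /rootspace mem_capP; apply: (iffP allP) => [hv x|hv x _]; last exact/eqP.
rewrite (coord_vbasis (memvf x)) !linear_sum /= bracket_suml scaler_suml.
apply: eq_bigr => i _.
rewrite [phi _]linearZ bracketZl (eqP (hv _ _)) ?scalerA //.
by rewrite mem_nth ?size_tuple.
Qed.

Lemma rootspace_bracket phi psi u v : u \in rootspace phi -> v \in rootspace psi ->
  bracket u v \in rootspace (phi + psi).
Proof.
move=> /rootspaceP uP /rootspaceP vP; apply/rootspaceP => x.
by rewrite bracketA uP vP bracketZl bracketZr add_lfunE scalerDl.
Qed.

Lemma rootspace0 v : (v \in rootspace (0 : hdual h)) = (v \in h).
Proof.
apply/rootspaceP/idP => [v0|vh x].
  apply: (cartan_max hC) => x xh.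
  by have := v0 (vsproj h x); rewrite vsprojK // lfunE scale0r.
by rewrite lfunE /= scale0r (cartan_comm hC) ?subvsP.
Qed.

Lemma hdual_neqP phi psi : phi != psi -> exists x, phi x != psi x.
Proof.
move=> ne; apply: contrapT => nex; case/eqP: ne; apply/lfunP => x.
by apply/eqP/negPn/negP => ?; apply: nex; exists x.
Qed.

Lemma killing_rootspace phi psi u v : u \in rootspace phi -> v \in rootspace psi ->
  phi + psi != 0 -> killing u v = 0.
Proof.
move=> /rootspaceP uP /rootspaceP vP /hdual_neqP[x].
rewrite add_lfunE zero_lfunE => nz.
have : killing (bracket (vsval x) u) v + killing u (bracket (vsval x) v) = 0.
  by rewrite [bracket _ u]bracketC -scaleN1r killingZl killing_inv mulN1r addNr.
rewrite uP vP killingZl killingZr -mulrDl => /eqP.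
by rewrite mulf_eq0 (negPf nz) => /eqP.
Qed.

Section WithBasis.
Local Notation n := (\dim {:g}).
Variables (b : n.-tuple g) (w : 'I_n -> hdual h).
Hypothesis bP : basis_of {:g} b.
Hypothesis wP :
  forall (i : 'I_n) (x : subvs_of h), bracket (vsval x) b`_i = w i x *: b`_i.

Lemma weight_vec (i : 'I_n) : b`_i \in rootspace (w i).
Proof. by apply/rootspaceP => x; rewrite wP. Qed.

Lemma basis_neq0 (i : 'I_n) : b`_i != 0.
Proof.
apply: contraTneq (basis_free bP) => b0.
apply/negP => /freeP/(_ (fun j => (j == i)%:R)) => F.
have : (i == i)%:R = 0 :> K; last by move/eqP; rewrite eqxx oner_eq0.
apply: F; rewrite (bigD1 i) //= eqxx b0 scaler0 add0r big1 // => j /negPf ->.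
by rewrite scale0r.
Qed.

Lemma coordE v : v = \sum_(i < n) coord b i v *: b`_i.
Proof. by rewrite -(coord_basis bP) ?memvf. Qed.

Lemma coord_sum (k : 'I_n -> K) i : coord b i (\sum_(j < n) k j *: b`_j) = k i.
Proof. by rewrite coord_sum_free // (basis_free bP). Qed.

Lemma coord_bracket (i : 'I_n) x v :
  coord b i (bracket (vsval x) v) = w i x * coord b i v.
Proof.
rewrite {1}[v]coordE bracket_sumr.
under eq_bigr do rewrite bracketZr wP scalerA mulrC.
by rewrite coord_sum.
Qed.

Lemma coord_rootspace phi v (i : 'I_n) :
  v \in rootspace phi -> w i != phi -> coord b i v = 0.
Proof.
move=> /rootspaceP vP /hdual_neqP[x nz].
have := coord_bracket i x v; rewrite vP linearZ /= => /eqP.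
by rewrite -subr_eq0 -mulrBl mulf_eq0 subr_eq0 eq_sym (negPf nz) => /eqP.
Qed.

Lemma is_rootP phi : is_root phi <-> phi != 0 /\ exists i, w i = phi.
Proof.
split=> -[nz]; last first.
  case=> i wi; split=> //; apply: contraNneq (basis_neq0 i) => r0.
  by rewrite -memv0 -r0 -wi weight_vec.
move=> r0; split => //; apply: contrapT => nex.
case/eqP: r0; apply/eqP; rewrite -subv0; apply/subvP => v vr.
rewrite memv0 [v]coordE big1 // => i _.
rewrite (coord_rootspace vr) ?scale0r //; apply/negP => /eqP wi.
by apply: nex; exists i.
Qed.

(** Composition with this projection expresses the trace over a span of weight vectors as a trace
    over [g]. *)
Definition wproj (S : pred 'I_n) v : g := \sum_(i < n | S i) coord b i v *: b`_i.

Lemma wproj_linear S : linear (wproj S).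
Proof.
move=> a u v; rewrite scaler_sumr -big_split /=; apply: eq_bigr => i _.
by rewrite linearP scalerDl scalerA.
Qed.

HB.instance Definition _ S := GRing.isSemilinear.Build K g g _ (wproj S)
  (GRing.semilinear_linear (wproj_linear S)).

Lemma coord_wproj S v i : coord b i (wproj S v) = if S i then coord b i v else 0.
Proof.
rewrite /wproj big_mkcond /=.
rewrite (eq_bigr (fun j => (if S j then coord b j v else 0) *: b`_j)).
  by rewrite coord_sum.
by move=> j _; case: ifP; rewrite ?scale0r.
Qed.

Lemma wproj_id S v :
  (forall i, ~~ S i -> coord b i v = 0) -> wproj S v = v.
Proof.
move=> Sv; rewrite [RHS]coordE /wproj big_mkcond; apply: eq_bigr => i _.
by case: ifPn => // /Sv ->; rewrite scale0r.
Qed.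

Lemma lftr_ad_wproj S x :
  lftr (ad (vsval x) \o linfun (wproj S))%VF = \sum_(i | S i) w i x.
Proof.
rewrite (lftrE bP) [RHS]big_mkcond; apply: eq_bigr => i _.
rewrite comp_lfunE adE lfunE /= coord_bracket coord_wproj.
by rewrite coord_free ?(basis_free bP) // eqxx; case: (S i); rewrite ?mulr1 ?mulr0.
Qed.

(* Only the images of E and F under p matter, so p need not be a projection. *)
Lemma lftr_bracket_stable (E F : g) (p : 'End(g)) :
  (forall v, p (bracket E (p v)) = bracket E (p v)) ->
  (forall v, p (bracket F (p v)) = bracket F (p v)) ->
  lftr (ad (bracket E F) \o p)%VF = 0.
Proof.
move=> Ep Fp; rewrite adB comp_lfunDl comp_lfunNl lftrB; apply/eqP.
have stab X (Xp : forall v, p (bracket X (p v)) = bracket X (p v)) :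
    (ad X \o p = p \o (ad X \o p))%VF.
  by apply/lfunP => v; rewrite !comp_lfunE !adE Xp.
rewrite subr_eq0 -comp_lfunA (stab F Fp) comp_lfunA lftrC.
by rewrite (lftrC (ad E \o p)%VF) -(comp_lfunA (ad F) p) -(stab E Ep) comp_lfunA (lftrC p).
Qed.

(** Closure of [S] is required only where the bracket has a nonzero coordinate, so that a string may
    be cut at a vector that [u] kills. *)
Lemma wproj_stable phi u (S : pred 'I_n) : u \in rootspace phi ->
  (forall i j, S i -> coord b j (bracket u b`_i) != 0 -> w j = phi + w i -> S j) ->
  forall v, linfun (wproj S) (bracket u (linfun (wproj S) v))
            = bracket u (linfun (wproj S) v).
Proof.
move=> uphi Sst v; rewrite !lfunE /=; apply: wproj_id => j nSj.
rewrite /wproj bracket_sumr linear_sum big1 // => i Si.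
rewrite bracketZr linearZ /=; case: (eqVneq (w j) (phi + w i)) => [wj|ne]; last first.
  rewrite (coord_rootspace _ ne) ?mulr0 //.
  by rewrite rootspace_bracket ?weight_vec.
apply/eqP; rewrite mulf_eq0; apply/orP; right; apply: contraNT nSj => nz.
exact: Sst nz wj.
Qed.

End WithBasis.
End RootSpaces.

(** * Polynomial vector fields and substitutions *)

Section PolyInduction.
Variables (n : nat) (R : comNzRingType).

Lemma mpoly_gen_ind (Q : mpoly n R -> Prop) :
  (forall c, Q (mpolyC n c)) -> (forall i, Q (mpolyX R (mnm1 i))) ->
  (forall p q, Q p -> Q q -> Q (p + q)) -> (forall p q, Q p -> Q q -> Q (p * q)) ->
  forall p, Q p.
Proof.
move=> QC QX QD QM p; rewrite [p]mpolyE.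
elim/big_ind: _ => [||m _]; first by rewrite -mpolyC0.
  exact: QD.
rewrite -mul_mpolyC; apply: (QM _ _ (QC _)); rewrite mpolyXE_id.
elim/big_ind: _ => [||i _]; first by rewrite -mpolyC1.
  exact: QM.
by elim: (m i) => [|k IH]; [rewrite expr0 -mpolyC1|rewrite exprS; apply: QM].
Qed.

(** The chain rule for derivations along [ev]: with [ev] the identity it describes vector fields,
    with [ev] an evaluation it describes directional derivatives at a point. *)
Lemma derivation_mpoly (A : comNzRingType) (ev : {rmorphism mpoly n R -> A})
    (D : mpoly n R -> A) :
  {morph D : p q / p + q} ->
  (forall p q, D (p * q) = D p * ev q + ev p * D q) ->
  (forall c, D (mpolyC n c) = 0) ->
  forall p, D p = \sum_i ev (mderiv i p) * D (mpolyX R (mnm1 i)).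
Proof.
move=> DD DM DC; apply: mpoly_gen_ind => [c|i|p q IHp IHq|p q IHp IHq].
- by rewrite DC big1 // => i _; rewrite mderivC rmorph0 mul0r.
- rewrite (bigD1 i) //= big1 => [|j ne].
    rewrite mderivX mnm1E eqxx scale1r.
    have -> : mnm_sub (mnm1 i) (mnm1 i) = mnm0 by apply/mnmP => k; rewrite mnmBE subnn mnmE.
    by rewrite mpolyX0 rmorph1 mul1r addr0.
  by rewrite mderivX mnm1E eq_sym (negPf ne) scale0r rmorph0 mul0r.
- rewrite DD IHp IHq -big_split; apply: eq_bigr => i _ /=.
  by rewrite mderivD rmorphD mulrDl.
rewrite DM IHp IHq mulr_suml mulr_sumr -big_split; apply: eq_bigr => i _ /=.
by rewrite mderivM rmorphD !rmorphM /= mulrDl mulrAC mulrA.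
Qed.
End PolyInduction.

Lemma comp_mpolyM (n k : nat) (R : comNzRingType) (lp : n.-tuple (mpoly k R)) (p q : mpoly n R) :
  comp_mpoly lp (p * q) = comp_mpoly lp p * comp_mpoly lp q.
Proof. by case: (comp_mpoly_is_multiplicative lp) => ->. Qed.

Lemma comp_mpolyA (n k l : nat) (R : comNzRingType) (lp : n.-tuple (mpoly k R))
    (lq : k.-tuple (mpoly l R)) (p : mpoly n R) :
  comp_mpoly lq (comp_mpoly lp p)
  = comp_mpoly [tuple comp_mpoly lq (tnth lp i) | i < n] p.
Proof.
elim/mpoly_gen_ind: p => [c|i|p q IHp IHq|p q IHp IHq].
- by rewrite !comp_mpolyC.
- by rewrite !comp_mpolyXU -!tnth_nth tnth_mktuple.
- by rewrite !comp_mpolyD IHp IHq.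
by rewrite !comp_mpolyM IHp IHq.
Qed.

Section VectorField.
Variables (n : nat) (K : numFieldType).
Implicit Types (f p q : mpoly n K) (l : 'I_n -> mpoly n K).

Definition vfield l f := \sum_i mderiv i f * l i.

Lemma vfieldD l p q : vfield l (p + q) = vfield l p + vfield l q.
Proof. by rewrite -big_split; apply: eq_bigr => i _; rewrite mderivD mulrDl. Qed.

Lemma vfieldZ l c p : vfield l (c *: p) = c *: vfield l p.
Proof.
by rewrite scaler_sumr; apply: eq_bigr => i _; rewrite mderivZ -scalerAl.
Qed.

Lemma vfield_sum l (I : Type) (r : seq I) (F : I -> mpoly n K) :
  vfield l (\sum_(i <- r) F i) = \sum_(i <- r) vfield l (F i).
Proof.
elim/big_rec2: _ => [|i x y _ <-]; last exact: vfieldD.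
by have := vfieldZ l 0 0; rewrite !scale0r.
Qed.

Lemma vfield_mderiv l (a : 'I_n -> 'I_n -> K) j f :
  (forall i, mderiv j (l i) = mpolyC n (a j i)) ->
  vfield l (mderiv j f) = mderiv j (vfield l f) - \sum_i a j i *: mderiv i f.
Proof.
move=> la; rewrite /vfield raddf_sum -sumrB /=; apply: eq_bigr => i _.
by rewrite mderivM la -mul_mpolyC [mderiv i f * _]mulrC addrK mderiv_comm.
Qed.

(** The first hypothesis expresses characteristic zero in a form that also makes sense for a ring of
    polynomials, which is one of the two uses. *)
Lemma poly_const_on_nat (A : idomainType) (p : {poly A}) (c : A) :
  (forall k, k%:R != 0 :> A \/ k = 0%N) -> (forall k, p.[k%:R] = c) -> p = c%:P.
Proof.
move=> char0 pc; apply/eqP; rewrite -subr_eq0; apply/negPn/negP => nz.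
pose s := [seq k%:R : A | k <- iota 0 (size (p - c%:P))].
have := max_poly_roots nz (rs := s); rewrite size_map size_iota ltnn => /(_ _ _)/negP.
apply=> //.
  by apply/allP => _ /mapP[k _ ->]; rewrite /root !hornerE pc subrr.
rewrite map_inj_in_uniq ?iota_uniq // => k m _ _.
wlog le : k m / (k <= m)%N => [WL E|].
  by case/orP: (leq_total k m) => le; [apply: WL|apply/esym; apply: WL].
move/eqP; rewrite eq_sym -subr_eq0 -natrB // => /eqP E.
have [/eqP //|/eqP] := char0 (m - k)%N; rewrite subn_eq0 => le'.
by apply/eqP; rewrite eqn_leq le le'.
Qed.

(* The invariance of f under a polynomial one-parameter family of substitutions, differentiated at
   the parameter value 0, where the family is the identity. *)
Lemma vfield_of_family (N : nat) (A : nat -> 'I_n -> mpoly n K) f :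
  (forall i, A 0%N i = mpolyX K (mnm1 i)) ->
  (forall c : K, comp_mpoly [tuple \sum_(j < N.+2) c ^+ j *: A j i | i < n] f = f) ->
  vfield (A 1%N) f = 0.
Proof.
move=> A0 fam; pose R := mpoly n K.
(* [Phi] performs the substitution with the parameter kept as an indeterminate. The bound [N.+2]
   ensures that a coefficient of degree 1 is present. *)
have [Phi PhiX PhiC] : exists2 Phi : {rmorphism R -> {poly R}},
    forall i, Phi (mpolyX K (mnm1 i)) = \poly_(j < N.+2) A j i
    & forall c, Phi (mpolyC n c) = (mpolyC n c)%:P.
  exists (mmap (polyC \o @mpolyC n K) (fun i => \poly_(j < N.+2) A j i)) => [i|c] /=.
    by rewrite mmapX mmap1U.
  by rewrite mmapC.
have ev c p : (Phi p).[mpolyC n c] = comp_mpoly [tuple \sum_(j < N.+2) c ^+ j *: A j i | i < n] p.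
  elim/mpoly_gen_ind: p => [d|i|p q IHp IHq|p q IHp IHq].
  - by rewrite PhiC hornerC comp_mpolyC.
  - rewrite PhiX horner_poly comp_mpolyXU -tnth_nth tnth_mktuple; apply: eq_bigr => j _.
    by rewrite -mul_mpolyC mulrC rmorphXn.
  - by rewrite rmorphD hornerD IHp IHq comp_mpolyD.
  by rewrite rmorphM hornerM IHp IHq comp_mpolyM.
have Phif : Phi f = f%:P.
  apply: poly_const_on_nat => k; last by rewrite -mpolyC_nat ev fam.
  by case: k => [|k]; [right|left; rewrite -mpolyC_nat mpolyC_eq0 pnatr_eq0].
have ev0 p : (Phi p).[0] = p.
  rewrite -mpolyC0 ev; rewrite -[RHS]comp_mpoly_id; congr comp_mpoly.
  apply: eq_from_tnth => i; rewrite !tnth_mktuple big_ord_recl expr0 scale1r A0.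
  by rewrite big1 ?addr0 // => j _; rewrite exprS mul0r scale0r.
pose D p := (Phi p)^`().[0].
have -> : vfield (A 1%N) f = D f.
  rewrite (@derivation_mpoly _ _ _ idfun D) => [|p q|p q|c].
  - apply: eq_bigr => i _; rewrite /D PhiX /= -{1}[A 1%N i]mulr1n.
    by rewrite horner_coef0 coef_deriv coef_poly.
  - by rewrite /D rmorphD derivD hornerD.
  - by rewrite /D rmorphM derivM hornerD !hornerM !ev0.
  - by rewrite /D PhiC derivC horner0.
by rewrite /D Phif derivC horner0.
Qed.

(** A line parallel to a coordinate axis of r_- leaves r_-^x at one parameter, where that coordinate
    vanishes; [bad] stands for this parameter. *)
Lemma mderiv_line (z u : 'I_n -> K) (bad : K) f :
  (forall c, c != bad -> meval (fun i => z i + c * u i) f = 0) ->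
  \sum_i meval z (mderiv i f) * u i = 0.
Proof.
move=> line0.
have [Phi PhiX PhiC] : exists2 Phi : {rmorphism mpoly n K -> {poly K}},
    forall i, Phi (mpolyX K (mnm1 i)) = (z i)%:P + u i *: 'X
    & forall c, Phi (mpolyC n c) = c%:P.
  exists (mmap (@polyC K) (fun i => (z i)%:P + u i *: 'X)) => [i|c] /=.
    by rewrite mmapX mmap1U.
  by rewrite mmapC.
have ev c p : (Phi p).[c] = meval (fun i => z i + c * u i) p.
  elim/mpoly_gen_ind: p => [d|i|p q IHp IHq|p q IHp IHq].
  - by rewrite PhiC hornerC mevalC.
  - by rewrite PhiX mevalXU !hornerE mulrC.
  - by rewrite rmorphD hornerD IHp IHq mevalD.
  by rewrite rmorphM hornerM IHp IHq mevalM.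
have ev0 p : (Phi p).[0] = meval z p.
  by rewrite ev; apply: meval_eq => i; rewrite mul0r addr0.
have Phif : Phi f = 0.
  (* The factor vanishes at [bad], so that the product is zero at every natural number without
     exception. *)
  apply: (@mulfI _ ('X - bad%:P)); first by rewrite polyXsubC_eq0.
  rewrite mulr0 -polyC0; apply: poly_const_on_nat => k.
    by case: k => [|k]; [right|left; rewrite pnatr_eq0].
  rewrite hornerM !hornerE ev; have [->|ne] := eqVneq k%:R bad; first by rewrite subrr mul0r.
  by rewrite line0 // mulr0.
pose D p := (Phi p)^`().[0].
transitivity (D f); last by rewrite /D Phif deriv0 horner0.
rewrite (@derivation_mpoly _ _ _ (meval z) D) => [|p q|p q|c].
- apply: eq_bigr => i _; rewrite /D PhiX derivD derivC derivZ derivX add0r.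
  by rewrite alg_polyC hornerC.
- by rewrite /D rmorphD derivD hornerD.
- by rewrite /D rmorphM derivM hornerD !hornerM !ev0.
- by rewrite /D PhiC derivC horner0.
Qed.

(** [Z] stands for r_-^x and the [l x] for the fields of the N-action. The second hypothesis is the
    analytic form of transversality: derivatives along [Z] and along the fields control the whole
    gradient on [Z]. It is applied to all higher derivatives of [f], and one point of [Z] then
    determines [f]. *)
Lemma vfield_vanish (X : Type) (l : X -> 'I_n -> mpoly n K)
    (a : X -> 'I_n -> 'I_n -> K) (Z : ('I_n -> K) -> Prop) f :
  (forall x i j, mderiv j (l x i) = mpolyC n (a x j i)) ->
  (forall g, (forall z, Z z -> meval z g = 0) ->
     (forall x z, Z z -> meval z (vfield (l x) g) = 0) ->
     forall j z, Z z -> meval z (mderiv j g) = 0) ->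
  (forall x, vfield (l x) f = 0) -> (forall z, Z z -> meval z f = 0) ->
  (exists z, Z z) -> f = 0.
Proof.
move=> la dir lf0 f0 [z0 Zz0].
(* M k consists of the combinations of derivatives of f of order k; it is stable under the linear
   fields l_x, because their brackets with the d/dX_j are constant fields. *)
pose M := fix M k g := if k is k'.+1 then exists2 G : 'I_n -> mpoly n K,
  forall j, M k' (G j) & g = \sum_j mderiv j (G j) else exists c : K, g = c *: f.
have MD k p q : M k p -> M k q -> M k (p + q).
  elim: k p q => [|k IH] p q /= [c pE].
    by move=> [d ->]; rewrite pE; exists (c + d); rewrite scalerDl.
  move=> pE' [d dM ->]; rewrite pE'; exists (fun j => c j + d j) => [j|]; first exact: IH.
  by rewrite -big_split; apply: eq_bigr => j _; rewrite mderivD.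
have MZ k c p : M k p -> M k (c *: p).
  elim: k p => [|k IH] p /= [d pE]; first by exists (c * d); rewrite pE scalerA.
  move=> ->; exists (fun j => c *: d j) => [j|]; first exact: IH.
  by rewrite scaler_sumr; apply: eq_bigr => j _; rewrite mderivZ.
have M0 k : M k 0.
  have -> : 0 = 0 *: 0 :> mpoly n K by rewrite scale0r.
  elim: k => [|k IH] /=; first by exists 0; rewrite !scale0r.
  exists (fun=> 0 *: 0) => //; rewrite scale0r big1 // => j _.
  by rewrite ?scale0r mderiv0.
have Msum k (I : finType) (F : I -> mpoly n K) : (forall i, M k (F i)) -> M k (\sum_i F i).
  by move=> MF; elim/big_ind: _ => // p q; apply: MD.
have Mfield k g x : M k g -> M k (vfield (l x) g).
  elim: k g => [|k IH] g /= [c gE]; first by exists 0; rewrite gE vfieldZ lf0 scale0r scaler0.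
  move=> ->; exists (fun i => vfield (l x) (c i) - \sum_j a x j i *: c j).
    move=> i; apply: MD; first exact/IH/gE.
    by rewrite -scaleN1r; apply/MZ/Msum => j; apply/MZ/gE.
  rewrite vfield_sum.
  transitivity (\sum_j (mderiv j (vfield (l x) (c j)) - \sum_i a x j i *: mderiv i (c j))).
    by apply: eq_bigr => j _; apply: vfield_mderiv.
  transitivity (\sum_j (mderiv j (vfield (l x) (c j))
                        - mderiv j (\sum_i a x i j *: c i))); last first.
    by apply: eq_bigr => j _; rewrite mderivB.
  rewrite !sumrB; congr (_ - _); rewrite exchange_big; apply: eq_bigr => i _ /=.
  by rewrite raddf_sum; apply: eq_bigr => j _ /=; rewrite mderivZ.
have Mvan k g : M k g -> forall z, Z z -> meval z g = 0.
  elim: k g => [|k IH] g /= [c gE]; first by move=> z Zz; rewrite gE mevalZ f0 // mulr0.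
  move=> -> z Zz; rewrite raddf_sum big1 // => j _ /=.
  apply: dir Zz; first exact: IH (gE j).
  by move=> x z' Zz'; apply: IH Zz'; apply/Mfield/gE.
have Mder m : M (mdeg m) (mderivm m f).
  have [k] := ubnP (mdeg m); elim: k m => // k IH m ltk.
  have [->|nz] := eqVneq m mnm0; first by rewrite mdeg0 mderivm0m; exists 1; rewrite scale1r.
  have [i mi] : exists i, m i != 0%N.
    apply: contrapT => nex; case/eqP: nz; apply/mnmP => i; rewrite mnmE.
    by apply/eqP/negPn/negP => mi; apply: nex; exists i.
  have mE : m = mnm_add (mnm_sub m (mnm1 i)) (mnm1 i).
    rewrite submK //; apply/mnm_lepP => j; rewrite mnm1E.
    by case: eqP => // <-; rewrite lt0n.
  rewrite mE mdegD mdeg1 addn1 mderivmDm mderivmU1m.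
  exists (fun j => if j == i then mderivm (mnm_sub m (mnm1 i)) f else 0) => [j|].
    case: eqP => _; last exact: M0.
    by apply: IH; move: ltk; rewrite {1}mE mdegD mdeg1 addn1.
  rewrite (bigD1 i) //= eqxx big1 ?addr0 // => j /negPf ->.
  by rewrite mderiv0.
(* Differentiating [f] along its leading monomial leaves a constant, the leading coefficient times a
   product of factorials; this nonzero constant would vanish at [z0]. *)
apply/eqP/negPn/negP => nz; have := Mvan _ _ (Mder (mlead f)) z0 Zz0.
have cst : mderivm (mlead f) f = mpolyC n (mcoeff (mlead f) f *+ \prod_(i < n) (mlead f i)`!).
  apply/mpolyP => m; rewrite mcoeff_mderivm mcoeffC.
  have [->|m0] := eqVneq m mnm0; rewrite ?mulr1 ?mulr0.
    rewrite addm0; congr (_ *+ _); apply: eq_bigr => i _.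
    exact: ffactnn.
  rewrite (memN_msupp_eq0 (p := f)) ?mul0rn //; apply/negP => /msize_mdeg_lt.
  rewrite -mlead_deg // mdegD ltnS -[X in (_ <= X)%N]addn0 leq_add2l leqn0 mdeg_eq0.
  by rewrite (negPf m0).
rewrite cst mevalC => /eqP; rewrite mulrn_eq0 mleadc_eq0 (negPf nz) orbF.
by rewrite -leqn0 leqNgt prodn_gt0 // => i; apply: fact_gt0.
Qed.
End VectorField.

Section LinearSubstitution.
Variables (n k : nat) (R : comNzRingType).
Implicit Types (p : mpoly n R) (L : n.-tuple (mpoly k R)).

Lemma dhomog_comp_monom L (m : multinom n) :
  (forall i, tnth L i \is ishomog1 1 mdeg) ->
  comp_mpoly L (mpolyX R m) \is ishomog1 (mdeg m) mdeg.
Proof.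
move=> L1; rewrite comp_mpolyX mdegE; elim/big_rec2: _ => [|i d q _ qd].
  exact: dhomog1.
apply: dhomogM => //; rewrite -[X in ishomog1 X](mul1n (m i)).
exact: dhomogMn.
Qed.

Lemma pihomog_comp L d p : (forall i, tnth L i \is ishomog1 1 mdeg) ->
  pihomog mdeg d (comp_mpoly L p) = comp_mpoly L (pihomog mdeg d p).
Proof.
move=> L1; elim/mpolyind: p => [|c m p _ _ IH].
  by rewrite !(pihomog0, comp_mpoly0).
rewrite comp_mpolyD comp_mpolyZ !pihomogD !linearZ /= IH comp_mpolyD comp_mpolyZ.
congr (_ *: _ + _); rewrite pihomogX; have [E|ne] := eqVneq (mdeg m) d.
  by rewrite pihomog_dE // -E dhomog_comp_monom.
by rewrite (pihomog_ne0 ne) ?comp_mpoly0 // dhomog_comp_monom.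
Qed.

Lemma mcoeff_comp_scale (c : 'I_n -> R) p m :
  mcoeff m (comp_mpoly [tuple c i *: mpolyX R (mnm1 i) | i < n] p)
  = mcoeff m p * \prod_i c i ^+ m i.
Proof.
elim/mpolyind: p => [|a m' p _ _ IH]; first by rewrite comp_mpoly0 mcoeff0 mul0r.
rewrite comp_mpolyD comp_mpolyZ !mcoeffD !mcoeffZ IH mulrDl; congr (_ + _).
rewrite comp_mpolyX.
have -> : \prod_(i < n) tnth [tuple c i *: mpolyX R (mnm1 i) | i < n] i ^+ m' i
    = (\prod_i c i ^+ m' i) *: mpolyX R m'.
  rewrite mpolyXE_id -scaler_prod; apply: eq_bigr => i _.
  by rewrite tnth_mktuple exprZn.
rewrite mcoeffZ mcoeffX; have [->|ne] := eqVneq m' m; last by rewrite !(mulr0, mul0r).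
by rewrite !mulr1.
Qed.
End LinearSubstitution.

(** * Roots and root strings *)

Section RootTheory.
Variables (K : numClosedFieldType) (g : lieAlgType K) (h : {vspace g}).
Variables (P : seq (hdual h)) (e : hdual h -> g).
Hypotheses (gS : semisimple_lie g) (hC : cartan h) (PP : positive_system P).
Hypothesis eP : root_vectors e.
Implicit Types (phi psi : hdual h) (u v : g) (x y : subvs_of h).

(** A central element spans an abelian, hence solvable, ideal. *)
Lemma center0 u : (forall v, bracket u v = 0) -> u = 0.
Proof.
move=> u0; have u0' v : bracket v u = 0 by rewrite bracketC u0 oppr0.
suff u0v : <[u]>%VS = 0%VS by apply/eqP; rewrite -memv0 -u0v memv_line.
apply: gS.
  split; first exact: subvf.
  apply: lie_prod_sub => x _ _ /vlineP[a ->].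
  by rewrite bracketZr u0' scaler0 mem0v.
exists 1%N; apply/eqP; rewrite -subv0; apply: lie_prod_sub => x y /vlineP[a ->] _.
by rewrite bracketZl u0 scaler0 mem0v.
Qed.

Lemma scaler_root_inj phi : phi != 0 -> injective (fun a : K => a *: phi).
Proof.
move=> nz a c /eqP; rewrite -subr_eq0 -scalerBl scaler_eq0 (negPf nz) orbF.
by rewrite subr_eq0 => /eqP.
Qed.

Lemma mulrz_root_inj phi : phi != 0 -> injective (fun k : int => phi *~ k).
Proof.
move=> nz k m /=; rewrite -!scaler_int => /(scaler_root_inj nz) /eqP.
by rewrite eqr_int => /eqP.
Qed.

Section WithBasis.
Local Notation n := (\dim {:g}).
Variables (b : n.-tuple g) (w : 'I_n -> hdual h).
Hypothesis bP : basis_of {:g} b.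
Hypothesis wP :
  forall (i : 'I_n) (x : subvs_of h), bracket (vsval x) b`_i = w i x *: b`_i.

Lemma weights_sep x : (forall i, w i x = 0) -> x = 0.
Proof.
move=> x0; apply: val_inj => /=; rewrite ?linear0; apply: center0 => v.
rewrite [v](coordE bP) bracket_sumr big1 // => i _.
by rewrite bracketZr wP x0 scale0r scaler0.
Qed.

(** Nothing is known yet about the weight of [e (- phi)], but pairing with [e phi] sees only its
    components of weight [- phi]; since the pairing is 1, such a weight occurs. *)
Lemma is_rootN_basis phi : is_root phi -> is_root (- phi).
Proof.
move=> rphi; have [ephi k1] := eP rphi; case: rphi => nz _.
apply/(is_rootP bP wP); rewrite oppr_eq0; split => //.
apply: contrapT => nex; move/eqP: k1; rewrite eq_sym; apply/negP.
rewrite [e (- phi)](coordE bP) killing_sumr big1 ?oner_eq0 // => i _.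
rewrite killingZr (killing_rootspace ephi (weight_vec wP i)) ?mulr0 //.
apply/negP; rewrite addrC addr_eq0 => /eqP wi.
by apply: nex; exists i.
Qed.
End WithBasis.

Lemma is_rootN phi : is_root phi -> is_root (- phi).
Proof. by have [b [w [bP wP]]] := weight_basis hC; apply: is_rootN_basis bP wP _. Qed.

Lemma root_vec phi : is_root phi -> e phi \in rootspace phi.
Proof. by case/eP. Qed.

Lemma root_vecN phi : is_root phi -> e (- phi) \in rootspace (- phi).
Proof. by move/is_rootN/eP => []. Qed.

Lemma killing_bracket_cartan phi u v x : u \in rootspace phi ->
  killing (bracket u v) (vsval x) = phi x * killing u v.
Proof.
by move=> /rootspaceP uP; rewrite killingC -killing_inv uP killingZl.
Qed.

Lemma rootspace_bracketN phi u v : u \in rootspace phi -> v \in rootspace (- phi) ->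
  bracket u v \in h.
Proof. by move=> uP vP; rewrite -(rootspace0 hC) -(subrr phi) rootspace_bracket. Qed.

(** By invariance and the normalisation of the root vectors, [phi x] is the pairing of [x] with the
    bracket of [e phi] and [e (- phi)], which lies in [h]. Hence all roots vanish at [x], and [x] is
    central. *)
Lemma killing_cartan_nondeg x :
  (forall y, killing (vsval x) (vsval y) = 0) -> x = 0.
Proof.
move=> x0; have [b [w [bP wP]]] := weight_basis hC.
apply: (weights_sep bP wP) => i; have [->|nz] := eqVneq (w i) 0.
  by rewrite lfunE.
have ri : is_root (w i) by apply/(is_rootP bP wP); split=> //; exists i.
have [_ k1] := eP ri.
rewrite -[LHS]mulr1 -k1 -killing_bracket_cartan ?root_vec // killingC.
have hh := rootspace_bracketN (root_vec ri) (root_vecN ri).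
by rewrite -(vsprojK hh) x0.
Qed.

(** [dual_vec] is a formal inverse, a right inverse only if the map from [h] to its dual is onto.
    That map is injective by nondegeneracy, and the dimensions agree. *)
Lemma dual_vecE phi y : killing (vsval (dual_vec phi)) (vsval y) = phi y.
Proof.
pose F x : hdual h :=
  linfun (fun y : subvs_of h => killing (vsval x) (vsval y) : K^o).
have FE x z : F x z = killing (vsval x) (vsval z).
  have Flin : linear (fun y : subvs_of h => killing (vsval x) (vsval y) : K^o).
    by move=> a u v; rewrite !linearP.
  pose FL := GRing.isSemilinear.Build K (subvs_of h) K^o _ _
    (GRing.semilinear_linear Flin).
  pose FM : {linear subvs_of h -> K^o} :=
    HB.pack (fun y : subvs_of h => killing (vsval x) (vsval y) : K^o) FL.
  by rewrite /F -[linfun _]/(linfun FM) lfunE.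
have Flin : linear F.
  move=> a u v; apply/lfunP => z; rewrite add_lfunE scale_lfunE !FE linearP.
  by rewrite killingDl killingZl.
pose FL := GRing.isSemilinear.Build K (subvs_of h) (hdual h) _ _
  (GRing.semilinear_linear Flin).
pose FM : {linear subvs_of h -> hdual h} := HB.pack F FL.
have -> : dual_vec phi = (linfun FM)^-1%VF phi by [].
rewrite -FE -[F _]/(FM _) -[FM _]lfunE limg_lfunVK //.
suff -> : limg (linfun FM) = {:hdual h}%VS by apply: memvf.
apply/eqP; rewrite eqEdim subvf /= limg_dim_eq.
  by rewrite !dimvf /dim /= muln1.
apply/eqP; rewrite -subv0; apply/subvP => x /memv_capP[_].
rewrite memv_ker -[linfun F]/(linfun FM) lfunE /= => /eqP Fx0; rewrite memv0; apply/eqP.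
by apply: killing_cartan_nondeg => z; rewrite -FE Fx0 lfunE.
Qed.

Lemma dual_formE phi psi : dual_form phi psi = phi (dual_vec psi).
Proof. by rewrite /dual_form dual_vecE. Qed.

Lemma dual_formC phi psi : dual_form phi psi = dual_form psi phi.
Proof. by rewrite /dual_form killingC. Qed.

Lemma dual_formDl phi psi chi :
  dual_form (phi + psi) chi = dual_form phi chi + dual_form psi chi.
Proof. by rewrite !dual_formE add_lfunE. Qed.

Lemma dual_formZl a phi chi : dual_form (a *: phi) chi = a * dual_form phi chi.
Proof. by rewrite !dual_formE scale_lfunE. Qed.

Lemma dual_formNl phi chi : dual_form (- phi) chi = - dual_form phi chi.
Proof. by rewrite -scaleN1r dual_formZl mulN1r. Qed.

Lemma dual_formNr phi chi : dual_form chi (- phi) = - dual_form chi phi.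
Proof. by rewrite dual_formC dual_formNl dual_formC. Qed.

Lemma dual_form0l psi : dual_form 0 psi = 0.
Proof. by rewrite -(scale0r psi) dual_formZl mul0r. Qed.

Lemma bracket_rootN phi u v : u \in rootspace phi -> v \in rootspace (- phi) ->
  bracket u v = killing u v *: vsval (dual_vec phi).
Proof.
move=> uP vP; have hh := rootspace_bracketN uP vP.
apply/eqP; rewrite -subr_eq0 -[bracket u v](vsprojK hh) -linearZ -linearB.
suff -> : vsproj h (bracket u v) - killing u v *: dual_vec phi = 0.
  by rewrite linear0.
apply: killing_cartan_nondeg => y; rewrite linearB linearZ /= vsprojK //.
rewrite -scaleN1r killingDl !killingZl dual_vecE (killing_bracket_cartan _ _ uP).
by rewrite mulN1r mulrN [phi y * _]mulrC subrr.
Qed.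

Lemma bracket_root_vec phi : is_root phi ->
  bracket (e phi) (e (- phi)) = vsval (dual_vec phi).
Proof.
move=> rphi; rewrite (bracket_rootN (root_vec rphi) (root_vecN rphi)).
by have [_ ->] := eP rphi; rewrite scale1r.
Qed.

(** * Root strings by traces *)

Section Strings.
Local Notation n := (\dim {:g}).
Variables (b : n.-tuple g) (w : 'I_n -> hdual h).
Hypothesis bP : basis_of {:g} b.
Hypothesis wP :
  forall (i : 'I_n) (x : subvs_of h), bracket (vsval x) b`_i = w i x *: b`_i.

(** The sum is the trace of [ad (dual_vec phi)] on the span of [S], and [dual_vec phi] is the
    bracket of [e phi] and [e (- phi)], which both preserve that span. *)
Lemma string_stable_sum phi (S : pred 'I_n) : is_root phi ->
  (forall i j, S i -> bracket (e phi) b`_i != 0 -> w j = w i + phi -> S j) ->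
  (forall i j, S i -> bracket (e (- phi)) b`_i != 0 -> w j = w i - phi -> S j) ->
  \sum_(i | S i) dual_form (w i) phi = 0.
Proof.
move=> rphi SE SF; under eq_bigr do rewrite dual_formE.
rewrite -(lftr_ad_wproj bP wP) -bracket_root_vec //.
have st psi u : u \in rootspace psi ->
    (forall i j, S i -> bracket u b`_i != 0 -> w j = w i + psi -> S j) ->
  forall v, linfun (wproj b S) (bracket u (linfun (wproj b S) v))
            = bracket u (linfun (wproj b S) v).
  move=> upsi Sst; apply: (wproj_stable bP wP upsi) => i j Si nz wj.
  apply: Sst Si _ _; last by rewrite wj addrC.
  by apply: contraNneq nz => ->; rewrite linear0.
apply: lftr_bracket_stable; first exact: st (root_vec rphi) SE.
exact: st (root_vecN rphi) SF.
Qed.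

(** [Q] cuts a piece out of the [phi]-string through [psi]; [S] collects the basis vectors with
    weight in this piece and [k] records their positions. Indices are summed instead of weights
    because multiplicities are still unknown. *)
Lemma string_sum phi psi (Q : pred int) : is_root phi ->
  (forall k j, Q k -> w j = psi + phi *~ k ->
     bracket (e phi) b`_j != 0 -> Q (k + 1)) ->
  (forall k j, Q k -> w j = psi + phi *~ k ->
     bracket (e (- phi)) b`_j != 0 -> Q (k - 1)) ->
  exists (S : pred 'I_n) (k : 'I_n -> int),
    [/\ forall j, S j -> Q (k j) /\ w j = psi + phi *~ k j,
        forall j m, Q m -> w j = psi + phi *~ m -> S j /\ k j = m
      & \sum_(j | S j) (dual_form psi phi + (k j)%:~R * dual_form phi phi) = 0].
Proof.
move=> rphi QE QF; have nz : phi != 0 by case: rphi.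
pose R j (m : int) := Q m && (w j == psi + phi *~ m).
have Runiq j m m' : R j m -> R j m' -> m = m'.
  move=> /andP[_ /eqP wm] /andP[_ /eqP]; rewrite wm => /addrI.
  by move/(mulrz_root_inj nz).
pose S : pred 'I_n := fun j => `[< exists m, R j m >].
have /choice[k kP] : forall j, exists m, S j -> R j m.
  move=> j; have [/asboolP[m jm]|nS] := boolP (S j); first by exists m.
  by exists 0.
exists S, k; have Sk j m : Q m -> w j = psi + phi *~ m -> S j /\ k j = m.
  move=> Qm wj; have jm : R j m by rewrite /R Qm wj /=.
  have Sj : S j by apply/asboolP; exists m.
  by split=> //; apply: Runiq jm; apply: kP.
split=> //; first by move=> j /kP/andP[-> /eqP].
rewrite -[RHS](@string_stable_sum phi S) //.
- apply: eq_bigr => j /kP/andP[_ /eqP ->].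
  by rewrite dual_formDl -scaler_int dual_formZl.
- move=> i j /kP/andP[Qi /eqP wi] bnz wj; apply: (Sk j (k i + 1) _ _).1.
    exact: QE bnz.
  by rewrite wj wi mulrzDr mulr1z addrA.
- move=> i j /kP/andP[Qi /eqP wi] bnz wj; apply: (Sk j (k i - 1) _ _).1.
    exact: QF bnz.
  by rewrite wj wi mulrzBr mulr1z addrA.
Qed.

Lemma killing_cartan x y :
  killing (vsval x) (vsval y) = \sum_i w i x * w i y.
Proof.
rewrite killingE (lftrE bP); apply: eq_bigr => i _.
rewrite comp_lfunE !adE wP bracketZr wP !linearZ /= coord_free ?(basis_free bP) //.
by rewrite eqxx mulr1.
Qed.

Lemma dual_form_sum phi psi :
  dual_form phi psi = \sum_i dual_form (w i) phi * dual_form (w i) psi.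
Proof.
by rewrite /dual_form killing_cartan; apply: eq_bigr => i _; rewrite -!dual_formE.
Qed.

(** If (phi, phi) = 0, the pairing with [phi] is constant along each [phi]-string, and the vanishing
    trace makes it zero. Then [phi] is orthogonal to all weights. *)
Lemma dual_form_neq0_basis phi : is_root phi -> dual_form phi phi != 0.
Proof.
move=> rphi; apply/eqP => f0; have nz : phi != 0 by case: rphi.
suff dv0 : dual_vec phi = 0.
  case/eqP: nz; apply/lfunP => x; by rewrite zero_lfunE -dual_vecE dv0 linear0 killing0l.
apply: (weights_sep bP wP) => i; rewrite -dual_formE.
have [//|//|S [k [SP Sk]]] := @string_sum phi (w i) predT rphi.
under eq_bigr do rewrite f0 mulr0 addr0.
rewrite big_const iter_addr_0 => /eqP; rewrite mulrn_eq0 => /orP[|/eqP //].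
have [Si _] : S i /\ k i = 0 by apply: Sk => //; rewrite mulr0z addr0.
by rewrite (cardD1 i) unfold_in Si.
Qed.
(** The vanishing trace over the whole string shows that the ratio is minus the average position, a
    rational number. *)
Lemma dual_form_ratio_real phi i : is_root phi ->
  dual_form (w i) phi / dual_form phi phi \is Num.real.
Proof.
move=> rphi; have f0 := dual_form_neq0_basis rphi.
have [//|//|S [k [SP Sk]]] := @string_sum phi (w i) predT rphi.
have [Si _] : S i /\ k i = 0 by apply: Sk => //; rewrite mulr0z addr0.
rewrite big_split /= sumr_const -mulr_suml => /eqP.
rewrite addr_eq0 -mulr_natr => /eqP E.
have nz : #|S|%:R != 0 :> K by rewrite pnatr_eq0 (cardD1 i) unfold_in Si.
have -> : dual_form (w i) phi = - (\sum_(j | S j) (k j)%:~R) / #|S|%:R * dual_form phi phi.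
  by apply: (mulIf nz); rewrite E -!mulNr mulrAC divfK.
rewrite mulfK // rpred_div ?rpredN ?rpred_sum ?realn // => j _.
exact: realz.
Qed.

(** (phi, phi) is the sum of the squares of the (w i, phi). Division by its square presents its
    inverse as a sum of squares of real ratios. *)
Lemma dual_form_gt0_basis phi : is_root phi -> 0 < dual_form phi phi.
Proof.
move=> rphi; have f0 := dual_form_neq0_basis rphi.
pose s := \sum_i (dual_form (w i) phi / dual_form phi phi) ^+ 2.
have s_ge0 : 0 <= s.
  by apply: sumr_ge0 => i _; rewrite real_exprn_even_ge0 // dual_form_ratio_real.
have E : s * dual_form phi phi = 1.
  apply: (mulIf f0); rewrite mul1r [RHS]dual_form_sum -mulrA mulr_suml.
  by apply: eq_bigr => i _; rewrite expr2 mulrACA !divfK.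
have : s != 0 by apply: contra_eq_neq E => ->; rewrite mul0r eq_sym oner_eq0.
move=> s0; have sgt0 : 0 < s by rewrite lt_neqAle eq_sym s0.
by rewrite -(pmulr_rgt0 _ sgt0) E ltr01.
Qed.

(** As [e phi] kills the weight space of [psi], the positions m <= 0 already form a stable piece,
    and its vanishing trace gives (psi, phi) >= 0. Positions m > 0 would then add a strictly
    positive amount to the trace of the whole string, which vanishes too. *)
Lemma string_top phi psi i : is_root phi -> w i = psi ->
  (forall j, w j = psi -> bracket (e phi) b`_j = 0) ->
  0 <= dual_form psi phi /\ forall j (m : int), w j = psi + phi *~ m -> m <= 0.
Proof.
move=> rphi wi top.
have fgt0 := dual_form_gt0_basis rphi.
have [//|//|S [k [SP Sk Ssum]]] := @string_sum phi psi predT rphi.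
have [||S' [k' [SP' Sk' Ssum']]] := @string_sum phi psi (fun m => m <= 0) rphi.
- move=> m j; rewrite le_eqVlt => /orP[/eqP ->|m0 wj _].
    by rewrite mulr0z addr0 => /top ->; rewrite eqxx.
  by rewrite lezD1.
- by move=> m j m0 _ _; rewrite (le_trans _ m0) // gerBl.
have [Si ki0] : S i /\ k i = 0 by apply: Sk => //; rewrite mulr0z addr0.
have [S'i _] : S' i /\ k' i = 0 by apply: Sk' => //; rewrite mulr0z addr0.
have SS' j : S' j = S j && (k j <= 0).
  apply/idP/andP => [/SP'[k0 wj]|[/SP[_ wj] kj0]].
    by have [-> ->] := Sk j _ isT wj.
  by have [] := Sk' j _ kj0 wj.
have kk' j : S' j -> k' j = k j.
  by move=> /[dup] /SP'[_ wj]; rewrite SS' => /andP[_ _]; have [] := Sk j _ isT wj.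
have c0 : 0 <= dual_form psi phi.
  have : 0 <= dual_form psi phi *+ #|S'|.
    have -> : dual_form psi phi *+ #|S'|
        = \sum_(j | S' j) - ((k' j)%:~R * dual_form phi phi).
      by apply/eqP; rewrite sumrN -addr_eq0 -sumr_const -big_split /= Ssum'.
    by apply: sumr_ge0 => j /SP'[kj _]; rewrite oppr_ge0 pmulr_lle0 // lerz0.
  by rewrite pmulrn_lge0 // (cardD1 i) unfold_in S'i.
split=> // j m wj; rewrite leNgt; apply/negP => m0.
have [Sj kj] := Sk j _ isT wj.
move: Ssum; rewrite (bigID (fun j => k j <= 0)) /=.
rewrite (eq_bigl S') => [|l]; last by rewrite SS'.
rewrite (eq_bigr (fun j => dual_form psi phi + (k' j)%:~R * dual_form phi phi)); last first.
  by move=> l /kk' ->.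
rewrite Ssum' add0r => /eqP; apply/negP.
rewrite gt_eqF // (bigD1 j) /=; last by rewrite Sj kj -ltNge.
have pos l : ~~ (k l <= 0) -> 0 < dual_form psi phi + (k l)%:~R * dual_form phi phi.
  by rewrite -ltNge => kl; rewrite ltr_wpDl // mulr_gt0 // ltr0z.
rewrite ltr_pwDl ?pos ?kj -?ltNge //; apply: sumr_ge0 => l /andP[/andP[_ kl] _].
exact: ltW (pos _ kl).
Qed.
(* The trace of t_phi on K e_{-phi} + h + \sum_(k > 0) g_{k phi} is zero. *)
Lemma root_mult1 phi i j : is_root phi -> w i = phi -> w j = phi -> i = j.
Proof.
move=> rphi wi wj; have nz : phi != 0 by case: rphi.
have rN := is_rootN rphi.
have [ephi k1] := eP rphi; have fphi := root_vecN rphi.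
pose S : pred 'I_n := fun l => `[< exists m : nat, w l = phi *+ m >].
have /choice[k kP] : forall l, exists m, S l -> w l = phi *+ m.
  by move=> l; have [/asboolP[m ?]|nS] := boolP (S l); [exists m|exists 0%N].
have S0 l : w l = 0 -> S l by move=> wl; apply/asboolP; exists 0%N; rewrite mulr0n.
have S1 l m : w l = phi *+ m -> S l by move=> wl; apply/asboolP; exists m.
have mul_inj m m' : phi *+ m = phi *+ m' -> m = m'.
  rewrite -!scaler_nat => /(scaler_root_inj nz) /eqP.
  by rewrite eqr_nat => /eqP.
have kE l m : w l = phi *+ m -> k l = m.
  by move=> wl; apply: mul_inj; rewrite -wl -kP //; apply: S1 wl.
have NS l : S l -> w l != - phi.
  move/kP => ->; apply/negP => /eqP wl; have /eqP := subrr (phi *+ k l).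
  rewrite {1}wl -opprD oppr_eq0 -mulrS => /eqP E.
  by have := mul_inj (k l).+1 0%N; rewrite E => /(_ erefl).
(* The pairing with [e phi] serves as the coordinate along [e (- phi)]: it is 1 there and vanishes
   on the weight vectors of [S]. *)
pose p v := wproj b S v + killing (e phi) v *: e (- phi).
have plin : linear p.
  move=> a u v; rewrite /p linearP killingDr killingZr scalerDl scalerDr scalerA.
  by rewrite addrACA.
pose pL := GRing.isSemilinear.Build K g g _ _ (GRing.semilinear_linear plin).
pose pM : {linear g -> g} := HB.pack p pL.
have pE v : linfun pM v = p v by rewrite lfunE.
have pZ a v : p (a *: v) = a *: p v by rewrite -!pE linearZ.
have fix_weight psi v : v \in rootspace psi ->
    (forall l, w l = psi -> S l) -> psi != - phi -> p v = v.
  move=> vpsi Sl npsi; rewrite /p (killing_rootspace ephi vpsi).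
    rewrite scale0r addr0; apply: (wproj_id bP) => l.
    by have [/Sl ->|ne _] := eqVneq (w l) psi; first by []; apply: (coord_rootspace bP wP vpsi).
  by rewrite addrC addr_eq0.
have fixf : p (e (- phi)) = e (- phi).
  rewrite /p k1 scale1r /wproj big1 ?add0r // => l /NS ne.
  by rewrite (coord_rootspace bP wP fphi ne) scale0r.
have stab u : p (bracket u (e (- phi))) = bracket u (e (- phi)) ->
    (forall l, S l -> p (bracket u b`_l) = bracket u b`_l) ->
    forall v, linfun pM (bracket u (linfun pM v)) = bracket u (linfun pM v).
  move=> uf ub v; rewrite !pE {2 3}/p /wproj.
  rewrite bracketDr bracketZr bracket_sumr [p _](linearD pM) /=.
  rewrite [p _](linear_sum pM) /= pZ uf; congr (_ + _).
  apply: eq_bigr => l Sl; rewrite bracketZr.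
  by rewrite pZ ub.
have Estab := stab (e phi) _ _.
have {Estab} Estab : forall v,
    linfun pM (bracket (e phi) (linfun pM v)) = bracket (e phi) (linfun pM v).
  apply: Estab => [|l Sl].
    apply: (fix_weight 0); last by rewrite eq_sym oppr_eq0.
      by rewrite -(subrr phi) rootspace_bracket.
    by move=> l /S0.
  apply: (fix_weight (phi *+ (k l).+1)).
  - by rewrite mulrS -kP // rootspace_bracket // (weight_vec wP).
  - by move=> m /S1.
  rewrite -addr_eq0 -mulrSr; apply/negP => /eqP E.
  by have := mul_inj (k l).+2 0%N; rewrite E => /(_ erefl).
have Fstab : forall v,
    linfun pM (bracket (e (- phi)) (linfun pM v)) = bracket (e (- phi)) (linfun pM v).
  apply: stab => [|l Sl]; first by rewrite bracketxx [p 0](linear0 pM).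
  case kl: (k l) => [|m].
    have wl0 : w l = 0 by rewrite kP // kl.
    have bh : b`_l \in h by rewrite -(rootspace0 hC) -wl0 (weight_vec wP).
    rewrite bracketC -(vsprojK bh); have /rootspaceP -> := fphi.
    rewrite -scaleNr.
    by rewrite pZ fixf.
  have wl : - phi + w l = phi *+ m by rewrite kP // kl mulrS addKr.
  apply: (fix_weight (phi *+ m)).
  - by rewrite -wl rootspace_bracket // (weight_vec wP).
  - by move=> q /S1.
  rewrite -addr_eq0 -mulrSr; apply/negP => /eqP E.
  by have := mul_inj m.+1 0%N; rewrite E => /(_ erefl).
have := lftr_bracket_stable Estab Fstab.
rewrite bracket_root_vec //.
(* A vector of weight k phi contributes k (phi, phi), and [e (- phi)] contributes - (phi, phi). So
   the positions in [S] add up to 1, which leaves room for only one vector of weight [phi]. *)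
have -> : lftr (ad (vsval (dual_vec phi)) \o linfun pM)%VF
    = (\sum_(l | S l) k l)%:R * dual_form phi phi - dual_form phi phi.
  rewrite (lftrE bP).
  transitivity (\sum_l (coord b l (bracket (vsval (dual_vec phi)) (wproj b S b`_l))
      + killing (e phi) b`_l * (- dual_form phi phi * coord b l (e (- phi))))).
    apply: eq_bigr => l _.
    rewrite comp_lfunE adE pE /p bracketDr linearD /= bracketZr linearZ /=.
    by have /rootspaceP -> := fphi; rewrite linearZ /= opp_lfunE -dual_formE.
  rewrite big_split /=; congr (_ + _).
    rewrite natr_sum mulr_suml [RHS]big_mkcond; apply: eq_bigr => l _.
    rewrite (coord_bracket bP wP) (coord_wproj bP) coord_free ?(basis_free bP) // eqxx.
    case: ifP => Sl; rewrite ?mulr1 ?mulr0 // kP // -dual_formE -scaler_nat.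
    by rewrite dual_formZl.
  rewrite -[RHS]mulr1 -k1 {2}[e (- phi)](coordE bP) killing_sumr mulr_sumr.
  by apply: eq_bigr => l _; rewrite killingZr mulrCA [coord _ _ _ * _]mulrC.
rewrite -{2}[dual_form phi phi]mul1r -mulrBl => /eqP.
rewrite mulf_eq0 (negPf (dual_form_neq0_basis rphi)) orbF subr_eq0 pnatr_eq1.
have Si : S i by apply: (S1 _ 1%N); rewrite mulr1n.
have Sj : S j by apply: (S1 _ 1%N); rewrite mulr1n.
have ki : k i = 1%N by apply: kE; rewrite mulr1n.
have kj : k j = 1%N by apply: kE; rewrite mulr1n.
apply: contraTeq => ne; rewrite (bigD1 i) //= (bigD1 j) /=; last by rewrite Sj eq_sym.
by rewrite ki kj.
Qed.
(** All positions are nonpositive, and the vanishing trace makes their sum zero. *)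
Lemma string_top0 phi psi i : is_root phi -> w i = psi ->
  (forall j, w j = psi -> bracket (e phi) b`_j = 0) ->
  dual_form psi phi = 0 -> forall j (m : int), w j = psi + phi *~ m -> m = 0.
Proof.
move=> rphi wi top c0 j m wj; have [_ le0] := string_top rphi wi top.
have fgt0 := dual_form_gt0_basis rphi.
have [//|//|S [k [SP Sk /eqP]]] := @string_sum phi psi predT rphi.
have [Sj kj] := Sk j m isT wj.
rewrite -oppr_eq0 -sumrN psumr_eq0 => [/allP/(_ j)|l Sl].
  rewrite mem_index_enum Sj kj c0 add0r oppr_eq0 mulf_eq0 (gt_eqF fgt0) orbF.
  by rewrite intr_eq0 implyTb => /(_ isT)/eqP.
have [_ /le0] := SP _ Sl.
by rewrite c0 add0r oppr_ge0 pmulr_lle0 // lerz0.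
Qed.

Lemma no_weight_bracket0 phi psi u v : u \in rootspace phi -> v \in rootspace psi ->
  phi + psi != 0 -> ~ is_root (phi + psi) -> bracket u v = 0.
Proof.
move=> uP vP nz nr; rewrite [LHS](coordE bP) big1 // => i _.
rewrite (coord_rootspace bP wP (rootspace_bracket uP vP)) ?scale0r //.
by apply/negP => /eqP wi; apply: nr; apply/(is_rootP bP wP); split=> //; exists i.
Qed.

(** Otherwise [psi] would be the top of its [phi]-string, with (psi, phi) >= 0. *)
Lemma root_add_basis phi psi : is_root phi -> is_root psi ->
  dual_form psi phi < 0 -> phi + psi != 0 -> is_root (phi + psi).
Proof.
move=> rphi /(is_rootP bP wP)[_ [i wi]] lt0 nz; apply: contrapT => nr.
have [j wj|] := string_top rphi wi _; last by rewrite lt_geF.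
apply: no_weight_bracket0 nz nr; first exact: root_vec.
by rewrite -wj (weight_vec wP).
Qed.

(** If [psi - phi] were not a root, [psi] would be the top of a string in direction [- phi]; being
    orthogonal to [phi] it would be the whole string, while [psi + phi] sits at position -1. *)
Lemma root_sub_basis phi psi : is_root phi -> is_root psi ->
  dual_form psi phi = 0 -> is_root (psi + phi) -> is_root (psi - phi).
Proof.
move=> rphi /(is_rootP bP wP)[_ [i wi]] f0 /(is_rootP bP wP)[_ [j wj]].
apply: contrapT => nr.
have nz : - phi + psi != 0.
  rewrite addrC subr_eq0; apply: contraTneq (dual_form_gt0_basis rphi) => E.
  by rewrite -{1}E f0 ltxx.
have : -1 = 0 :> int; last by [].
apply: (string_top0 (is_rootN rphi) wi _ _ (j := j)).
- move=> l wl; apply: no_weight_bracket0 nz _; first exact: root_vecN.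
    by rewrite -wl (weight_vec wP).
  by rewrite addrC.
- by rewrite dual_formC -scaleN1r dual_formZl dual_formC f0 mulr0.
by rewrite wj mulrN1z opprK.
Qed.

Lemma dual_form_real_basis phi i : is_root phi -> dual_form (w i) phi \is Num.real.
Proof.
move=> rphi; have fgt0 := dual_form_gt0_basis rphi.
by rewrite -(divfK (lt0r_neq0 fgt0) (dual_form _ _)) rpredM ?dual_form_ratio_real ?gtr0_real.
Qed.

Lemma dual_form_sep phi : (forall i, dual_form (w i) phi = 0) -> phi = 0.
Proof.
move=> f0; have dv0 : dual_vec phi = 0.
  by apply: (weights_sep bP wP) => i; rewrite -dual_formE.
by apply/lfunP => x; rewrite zero_lfunE -dual_vecE dv0 linear0 killing0l.
Qed.

Lemma root_space_line_basis phi u : is_root phi -> u \in rootspace phi ->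
  exists a, u = a *: e phi.
Proof.
move=> /[dup] rphi /(is_rootP bP wP)[_ [i wi]].
have coordi v : v \in rootspace phi -> v = coord b i v *: b`_i.
  move=> vP; rewrite [LHS](coordE bP) (bigD1 i) //= big1 ?addr0 // => j ne.
  rewrite (coord_rootspace bP wP vP) ?scale0r //.
  by apply: contra ne => /eqP wj; apply/eqP; apply: root_mult1 wj wi.
move=> /coordi ->; have ephi := root_vec rphi.
have nz : coord b i (e phi) != 0.
  apply/eqP => c0; have [_ /eqP] := eP rphi.
  by rewrite (coordi _ ephi) c0 scale0r killing0l eq_sym oner_eq0.
exists (coord b i u / coord b i (e phi)).
by rewrite [X in _ = _ *: X](coordi _ ephi) scalerA divfK.
Qed.
End Strings.

Lemma dual_form_neq0 phi : is_root phi -> dual_form phi phi != 0.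
Proof.
by have [b [w [bP wP]]] := weight_basis hC; apply: dual_form_neq0_basis bP wP _.
Qed.
Lemma root_space_line phi u : is_root phi -> u \in rootspace phi ->
  exists a, u = a *: e phi.
Proof.
by have [b [w [bP wP]]] := weight_basis hC; apply: root_space_line_basis bP wP _ _.
Qed.

Lemma dual_form_gt0 phi : is_root phi -> 0 < dual_form phi phi.
Proof.
by have [b [w [bP wP]]] := weight_basis hC; apply: dual_form_gt0_basis bP wP _.
Qed.

Lemma dual_form_real phi psi : is_root phi -> is_root psi ->
  dual_form phi psi \is Num.real.
Proof.
have [b [w [bP wP]]] := weight_basis hC.
by move=> /(is_rootP bP wP)[_ [i <-]]; apply: dual_form_real_basis bP wP _ _.
Qed.

Lemma bracket_rootspace0 phi psi u v : u \in rootspace phi -> v \in rootspace psi ->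
  phi + psi != 0 -> ~ is_root (phi + psi) -> bracket u v = 0.
Proof.
have [b [w [bP wP]]] := weight_basis hC => uP vP nz nr.
exact: (no_weight_bracket0 bP wP uP vP nz nr).
Qed.

Lemma root_add phi psi : is_root phi -> is_root psi ->
  dual_form phi psi < 0 -> phi + psi != 0 -> is_root (phi + psi).
Proof.
have [b [w [bP wP]]] := weight_basis hC.
by rewrite dual_formC; apply: root_add_basis bP wP _ _.
Qed.

Lemma root_sub phi psi : is_root phi -> is_root psi ->
  dual_form phi psi = 0 -> is_root (phi + psi) -> is_root (phi - psi).
Proof.
have [b [w [bP wP]]] := weight_basis hC => rphi rpsi.
exact: root_sub_basis bP wP _ _ rpsi rphi.
Qed.

(** Root spaces are lines, so a zero bracket would make [psi] the top of its [phi]-string, although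
    [phi + psi] lies above it. *)
Lemma bracket_root_neq0 phi psi : is_root phi -> is_root psi ->
  is_root (phi + psi) -> bracket (e phi) (e psi) != 0.
Proof.
have [b [w [bP wP]]] := weight_basis hC => rphi rpsi.
move=> /(is_rootP bP wP)[_ [j wj]]; apply/eqP => br0.
have /(is_rootP bP wP)[_ [i wi]] := rpsi.
have [l wl|_ /(_ j 1)] := string_top bP wP rphi wi _.
  have [a ->] : exists a, b`_l = a *: e psi.
    by apply: root_space_line rpsi _; rewrite -wl (weight_vec wP).
  by rewrite bracketZr br0 scaler0.
by rewrite mulr1z wj addrC => /(_ erefl).
Qed.

Lemma dual_form_ge0 chi : (forall phi, is_root phi -> dual_form chi phi \is Num.real) ->
  0 <= dual_form chi chi.
Proof.
move=> xR; have [b [w [bP wP]]] := weight_basis hC.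
rewrite (dual_form_sum bP wP) sumr_ge0 // => i _.
rewrite -expr2 real_exprn_even_ge0 // dual_formC.
have [->|nz] := eqVneq (w i) 0.
  by rewrite dual_formC -(scale0r (w i)) dual_formZl mul0r real0.
by apply: xR; apply/(is_rootP bP wP); split=> //; exists i.
Qed.

Lemma dual_form_eq0 chi : (forall phi, is_root phi -> dual_form chi phi \is Num.real) ->
  dual_form chi chi = 0 -> chi = 0.
Proof.
move=> xR; have [b [w [bP wP]]] := weight_basis hC.
have xwR i : dual_form (w i) chi \is Num.real.
  rewrite dual_formC; have [->|nz] := eqVneq (w i) 0.
    by rewrite dual_formC -(scale0r (w i)) dual_formZl mul0r real0.
  by apply: xR; apply/(is_rootP bP wP); split=> //; exists i.
rewrite (dual_form_sum bP wP) => /eqP.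
rewrite psumr_eq0 => [/allP x0|i _]; last first.
  by rewrite -expr2 real_exprn_even_ge0.
apply: (dual_form_sep bP wP) => i; apply/eqP.
by have := x0 i (mem_index_enum _); rewrite mulf_eq0 orbb.
Qed.

Lemma dual_form_suml I r (Q : pred I) (F : I -> hdual h) chi :
  dual_form (\sum_(i <- r | Q i) F i) chi = \sum_(i <- r | Q i) dual_form (F i) chi.
Proof.
rewrite dual_formE sum_lfunE; apply: eq_bigr => i _.
by rewrite dual_formE.
Qed.

Lemma dual_form_sumr I r (Q : pred I) (F : I -> hdual h) chi :
  dual_form chi (\sum_(i <- r | Q i) F i) = \sum_(i <- r | Q i) dual_form chi (F i).
Proof. by rewrite dual_formC dual_form_suml; apply: eq_bigr => i _; rewrite dual_formC. Qed.

(* The hermitian extension of the form from the real span of the roots is definite. *)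
Lemma dual_form_span0 (I : finType) (c : I -> K) (F : I -> hdual h) :
  (forall i, F i = 0 \/ is_root (F i)) ->
  (forall i, dual_form (\sum_j c j *: F j) (F i) = 0) ->
  \sum_j c j *: F j = 0.
Proof.
set x := \sum_j _ => FR x0; have [b [w [bP wP]]] := weight_basis hC.
have xx : dual_form x (\sum_j (c j)^* *: F j) = 0.
  rewrite dual_form_sumr big1 // => j _.
  by rewrite dual_formC dual_formZl dual_formC x0 mulr0.
have conjE i : dual_form (w i) (\sum_j (c j)^* *: F j) = (dual_form (w i) x)^*.
  rewrite !dual_form_sumr rmorph_sum /=; apply: eq_bigr => j _.
  rewrite ![dual_form (w i) _]dual_formC !dual_formZl rmorphM /= [dual_form (F j) _]dual_formC.
  congr (_ * _); apply/esym/CrealP; have [->|rj] := FR j.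
    by rewrite dual_formC dual_form0l real0.
  exact: (dual_form_real_basis bP wP i rj).
move/eqP: xx; rewrite (dual_form_sum bP wP).
under eq_bigr do rewrite conjE -normCK.
rewrite psumr_eq0 => [/allP xi0|i _]; last by rewrite exprn_ge0.
apply: (dual_form_sep bP wP) => i; apply/eqP.
by have := xi0 i (mem_index_enum _); rewrite expf_eq0 /= normr_eq0.
Qed.

(** * Simple roots and supports *)

Section Positive.
Local Notation sr := (simple_roots P).

Lemma pos_root phi : phi \in P -> is_root phi.
Proof. by case: PP => _ + _ _; apply. Qed.

Lemma pos_neg phi : is_root phi -> phi \notin P -> - phi \in P.
Proof. by case: PP => _ _ + _ rphi; move=> /(_ _ rphi) ->; rewrite negbK. Qed.

Lemma pos_negF phi : phi \in P -> - phi \in P -> False.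
Proof.
by move=> /[dup] /pos_root rphi; case: PP => _ _ /(_ _ rphi) -> _ /negP.
Qed.

Lemma pos_addr_neq0 phi psi : phi \in P -> psi \in P -> phi + psi != 0.
Proof.
move=> phiP psiP; rewrite addr_eq0; apply/eqP => E.
by apply: (pos_negF psiP); rewrite -E.
Qed.

Lemma pos_add phi psi : phi \in P -> psi \in P -> dual_form phi psi < 0 ->
  phi + psi \in P.
Proof.
move=> phiP psiP lt0; case: PP => _ _ _; apply => //.
by apply: root_add => //; [exact: pos_root|exact: pos_root|exact: pos_addr_neq0].
Qed.

Lemma pos_form_real phi psi : phi \in P -> psi \in P ->
  dual_form phi psi \is Num.real.
Proof. by move=> /pos_root rphi /pos_root rpsi; apply: dual_form_real. Qed.

(** If the sum is zero, its first term [phi] has negative pairing with another term, as (phi, phi) >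
    0. Replacing the two by their sum, again a positive root, shortens the list. *)
Lemma pos_sum_neq0 (s : seq (hdual h)) : s != [::] -> {subset s <= P} ->
  \sum_(phi <- s) phi != 0.
Proof.
have [m] := ubnP (size s); elim: m s => // m IH [|phi s] // ltm _ sP.
rewrite big_cons; apply/eqP => s0.
have phiP : phi \in P by apply: sP; rewrite mem_head.
have sP' chi : chi \in s -> chi \in P by move=> chis; apply: sP; rewrite inE chis orbT.
have /hasP[chi chis lt0] : has (fun chi => dual_form phi chi < 0) s.
  apply: contraT => /hasPn ge0.
  have := dual_form_gt0 (pos_root phiP).
  rewrite (_ : dual_form phi phi = - \sum_(chi <- s) dual_form phi chi).
    rewrite oppr_gt0 => /lt_geF <-; rewrite big_seq; apply: sumr_ge0 => chi chis.
    have := ge0 _ chis; rewrite -real_leNgt ?real0 //.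
    by apply: pos_form_real => //; apply: sP'.
  rewrite -dual_form_sumr.
  have -> : \sum_(chi <- s) chi = - phi by apply/eqP; rewrite -addr_eq0 addrC s0.
  by rewrite dual_formNr opprK.
have sE : \sum_(chi <- (phi + chi) :: rem chi s) chi = 0.
  by rewrite -[RHS]s0 [in RHS](perm_big _ (perm_to_rem chis)) /= !big_cons addrA.
have: \sum_(chi <- (phi + chi) :: rem chi s) chi != 0; last by rewrite sE eqxx.
apply: IH => //.
  by rewrite /= size_rem // prednK //; case: (s) chis.
move=> psi; rewrite inE => /orP[/eqP ->|/mem_rem /sP' //].
by rewrite pos_add // sP'.
Qed.

Lemma simpleP alpha : reflect
  (alpha \in P /\ forall phi, phi \in P -> alpha - phi \in P -> False)
  (alpha \in sr).
Proof.
rewrite mem_filter; apply: (iffP andP) => -[] => [/hasPn nP aP|aP nP].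
  by split=> // phi /nP /negP.
by split=> //; apply/hasPn => phi phiP; apply/negP => /(nP _ phiP).
Qed.

Lemma simple_pos alpha : alpha \in sr -> alpha \in P.
Proof. by case/simpleP. Qed.

Lemma simple_uniq : uniq sr.
Proof. by rewrite filter_uniq //; case: PP. Qed.

Lemma in_root_cone0 : in_root_cone P 0.
Proof. by exists (fun=> 0%N); rewrite big1 // => alpha; rewrite mulr0n. Qed.

Lemma in_root_coneD phi psi :
  in_root_cone P phi -> in_root_cone P psi -> in_root_cone P (phi + psi).
Proof.
move=> [c ->] [c' ->]; exists (fun alpha => c alpha + c' alpha)%N.
by rewrite -big_split; apply: eq_bigr => alpha _; rewrite mulrnDr.
Qed.

Lemma in_root_cone_simple alpha : alpha \in sr -> in_root_cone P alpha.
Proof.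
move=> asr; exists (fun gamma => (gamma == alpha) : nat).
rewrite (bigD1_seq alpha) ?simple_uniq //= eqxx mulr1n big1 ?addr0 // => gamma /negPf ->.
by rewrite mulr0n.
Qed.

(** The order generated by adding positive roots, which is irreflexive by [pos_sum_neq0]. The number
    of positive roots below a given one is the induction measure until heights are available. *)
Let below phi psi := `[< exists s, [/\ s != [::], {subset s <= P} &
                               phi = psi + \sum_(chi <- s) chi] >].
Let rank phi := size [seq psi <- P | below phi psi].

Lemma rank_lt phi psi : psi \in P -> below phi psi -> (rank psi < rank phi)%N.
Proof.
move=> psiP bl; rewrite /rank.
rewrite -[X in (X < _)%N]/(size [seq chi <- P | below psi chi]).
have : uniq (psi :: [seq chi <- P | below psi chi]).
  rewrite /= filter_uniq ?andbT; last by case: PP.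
  rewrite mem_filter; apply/negP => /andP[/asboolP[s [s0 sP E]] _].
  have := pos_sum_neq0 s0 sP.
  by rewrite -(inj_eq (addrI psi)) -E addr0 eqxx.
move/uniq_leq_size => /(_ [seq chi <- P | below phi chi]); apply => chi.
rewrite inE mem_filter => /orP[/eqP ->|]; first by rewrite mem_filter bl.
rewrite mem_filter => /andP[/asboolP[s [s0 sP psiE]] ->]; rewrite andbT.
move/asboolP: bl => [s' [s'0 s'P phiE]]; apply/asboolP.
exists (s ++ s'); split; last by rewrite big_cat /= addrA -psiE.
  by case: (s) s0.
by move=> x; rewrite mem_cat => /orP[/sP|/s'P].
Qed.

Lemma pos_cone phi : phi \in P -> in_root_cone P phi.
Proof.
have [m] := ubnP (rank phi); elim: m phi => // m IH phi ltm phiP.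
have [/in_root_cone_simple //|] := boolP (phi \in sr).
rewrite mem_filter phiP andbT negbK => /hasP[psi psiP dP].
rewrite -(subrK psi phi); apply: in_root_coneD; apply: IH => //.
  rewrite -ltnS; apply: leq_trans ltm; rewrite ltnS; apply: rank_lt => //; apply/asboolP.
  exists [:: psi]; rewrite big_seq1 subrK; split=> // x.
  by rewrite inE => /eqP ->.
rewrite -ltnS; apply: leq_trans ltm; rewrite ltnS; apply: rank_lt => //; apply/asboolP.
exists [:: phi - psi]; rewrite big_seq1 [psi + _]addrC subrK; split=> // x.
by rewrite inE => /eqP ->.
Qed.

Lemma simple_obtuse alpha gamma : alpha \in sr -> gamma \in sr -> alpha != gamma ->
  dual_form alpha gamma <= 0.
Proof.
move=> /simpleP[aP na] /simpleP[cP nc] ne.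
rewrite real_leNgt ?real0 ?pos_form_real //; apply/negP => gt0.
have : is_root (alpha - gamma).
  apply: root_add; rewrite ?subr_eq0 //; first exact: pos_root.
    exact/is_rootN/pos_root.
  by rewrite dual_formNr oppr_lt0.
move=> r; have [/(na _ cP) //|/(pos_neg r)] := boolP (alpha - gamma \in P).
by rewrite opprB => /(nc _ aP).
Qed.

Lemma pos_max (Q : hdual h -> Prop) phi : phi \in P -> Q phi ->
  exists beta, [/\ beta \in P, Q beta &
    forall alpha, alpha \in P -> beta + alpha \in P -> ~ Q (beta + alpha)].
Proof.
have [m] := ubnP (size P - rank phi); elim: m phi => // m IH phi ltm phiP Qphi.
have [mx|] := pselect (forall alpha, alpha \in P -> phi + alpha \in P -> ~ Q (phi + alpha)).
  by exists phi.
move=> /existsNP[alpha /not_implyP[aP /not_implyP[sP /contrapT Qs]]].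
apply: (IH (phi + alpha)) => //; rewrite -ltnS; apply: leq_trans ltm; rewrite ltnS.
have lt : (rank phi < rank (phi + alpha)%R)%N.
  apply: rank_lt => //; apply/asboolP; exists [:: alpha].
  by rewrite big_seq1; split=> // x; rewrite inE => /eqP ->.
by rewrite ltn_sub2l // (leq_trans lt) // /rank size_filter count_size.
Qed.

(** Among the positive roots in the cone of [A], a maximal one [beta] has nonnegative pairing with
    all of [A]. If the combination were zero, all these pairings would vanish, and with them (beta,
    beta). *)
Lemma pos_comb_neq0 (A : pred (hdual h)) (a : hdual h -> K) :
  (exists2 alpha, alpha \in sr & A alpha) ->
  (forall alpha, alpha \in sr -> A alpha -> 0 < a alpha) ->
  \sum_(alpha <- sr | A alpha) a alpha *: alpha != 0.
Proof.
move=> [alpha asr Aa] a0; apply/eqP => s0.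
pose Q phi := exists c : hdual h -> nat, phi = \sum_(gamma <- sr | A gamma) gamma *+ c gamma.
have [|beta [betaP [c bE] mx]] := @pos_max Q alpha (simple_pos asr).
  exists (fun gamma => (gamma == alpha) : nat).
  rewrite big_mkcond (bigD1_seq alpha) ?simple_uniq //= Aa eqxx mulr1n.
  rewrite big1 ?addr0 // => gamma /negPf ->.
  by rewrite mulr0n if_same.
have ge0 gamma : gamma \in sr -> A gamma -> 0 <= dual_form gamma beta.
  move=> csr Ac; have cP := simple_pos csr.
  rewrite real_leNgt ?real0 ?pos_form_real //; apply/negP => lt0.
  rewrite dual_formC in lt0.
  apply: (mx gamma cP); first exact: pos_add.
  exists (fun chi => c chi + (chi == gamma))%N.
  rewrite (eq_bigr (fun chi => chi *+ c chi + chi *+ (chi == gamma))); last first.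
    by move=> chi _; rewrite mulrnDr.
  rewrite big_split /= -bE; congr (_ + _).
  rewrite big_mkcond (bigD1_seq gamma) ?simple_uniq //= Ac eqxx mulr1n.
  rewrite big1 ?addr0 // => chi /negPf ->.
  by rewrite mulr0n if_same.
have : dual_form (\sum_(alpha <- sr | A alpha) a alpha *: alpha) beta == 0.
  by rewrite s0 -(scale0r beta) dual_formZl mul0r.
rewrite dual_form_suml big_seq_cond psumr_eq0 => [/allP b0|chi /andP[csr Ac]]; last first.
  by rewrite dual_formZl mulr_ge0 ?ge0 // ltW // a0.
have := dual_form_gt0 (pos_root betaP); rewrite {1}bE dual_form_suml big_seq_cond big1 ?ltxx //.
move=> gamma /andP[csr Ac]; have := b0 _ csr; rewrite csr Ac dual_formZl mulf_eq0.
rewrite gt_eqF ?a0 //= => /eqP g0.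
by rewrite -scaler_nat dual_formZl g0 mulr0.
Qed.

(** The part [u] with positive coefficients also equals the negated rest. Distinct simple roots form
    obtuse angles, so (u, u) <= 0 and [u] is zero, against [pos_comb_neq0]. *)
Lemma simple_comb_real_pos (a : hdual h -> K) :
  (forall alpha, alpha \in sr -> a alpha \is Num.real) ->
  \sum_(alpha <- sr) a alpha *: alpha = 0 ->
  forall alpha, alpha \in sr -> a alpha <= 0.
Proof.
move=> aR a0 alpha asr; rewrite real_leNgt ?real0 ?aR //; apply/negP => alt0.
pose u := \sum_(gamma <- sr | 0 < a gamma) a gamma *: gamma.
have : u != 0.
  apply: (@pos_comb_neq0 (fun gamma => 0 < a gamma)) => //.
  by exists alpha.
suff -> : u = 0 by rewrite eqxx.
have uE : u = \sum_(gamma <- sr | ~~ (0 < a gamma)) (- a gamma) *: gamma.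
  apply/eqP; rewrite -subr_eq0 -sumrN.
  under [X in _ + X]eq_bigr do rewrite scaleNr opprK.
  by rewrite -[X in X == _](bigID (fun gamma => 0 < a gamma) xpredT) a0.
have uR phi : is_root phi -> dual_form u phi \is Num.real.
  move=> rphi; rewrite dual_form_suml big_seq_cond rpred_sum // => gamma /andP[csr _].
  rewrite dual_formZl rpredM ?aR // dual_form_real //.
  exact/pos_root/simple_pos.
apply: dual_form_eq0 => //; apply: le_anti; rewrite dual_form_ge0 // andbT.
rewrite {2}uE /u dual_form_sumr big_seq_cond sumr_le0 // => gamma /andP[csr ngt0].
rewrite dual_formC dual_formZl mulr_ge0_le0 //.
  by rewrite oppr_ge0 real_leNgt ?real0 ?aR.
rewrite dual_form_sumr big_seq_cond sumr_le0 // => chi /andP[xsr gt0].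
rewrite dual_formC dual_formZl mulr_ge0_le0 //; first exact: ltW.
apply: simple_obtuse => //; apply: contraNneq ngt0 => <-.
exact: gt0.
Qed.

Lemma simple_comb_real (a : hdual h -> K) :
  (forall alpha, alpha \in sr -> a alpha \is Num.real) ->
  \sum_(alpha <- sr) a alpha *: alpha = 0 ->
  forall alpha, alpha \in sr -> a alpha = 0.
Proof.
move=> aR a0 alpha asr; apply: le_anti; rewrite (simple_comb_real_pos aR a0 asr) /=.
rewrite -oppr_le0; apply: (@simple_comb_real_pos (fun gamma => - a gamma)) asr.
  by move=> gamma csr; rewrite rpredN aR.
by under eq_bigr do rewrite scaleNr; rewrite sumrN a0 oppr0.
Qed.

(** The form is real on roots, so the real and the imaginary parts of the coefficients satisfy the
    relation separately. *)
Lemma simple_free (a : hdual h -> K) :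
  \sum_(alpha <- sr) a alpha *: alpha = 0 ->
  forall alpha, alpha \in sr -> a alpha = 0.
Proof.
move=> a0.
have part (f : {additive K -> K}) : (forall z, f z \is Num.real) ->
    (forall z t, t \is Num.real -> f (z * t) = f z * t) ->
    forall alpha, alpha \in sr -> f (a alpha) = 0.
  move=> fR fM; apply: simple_comb_real => [gamma _|]; first exact: fR.
  set x := \sum_(_ <- _) _.
  have x0 phi : is_root phi -> dual_form x phi = 0.
    move=> rphi; have : f (dual_form (\sum_(alpha <- sr) a alpha *: alpha) phi) = 0.
      by rewrite a0 -(scale0r phi) dual_formZl mul0r raddf0.
    rewrite dual_form_suml raddf_sum /= => fa; rewrite dual_form_suml -[RHS]fa.
    rewrite !big_seq; apply: eq_bigr => gamma csr; rewrite !dual_formZl fM //.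
    by rewrite dual_form_real //; apply/pos_root/simple_pos.
  apply: dual_form_eq0 => [phi /x0 ->|]; first exact: real0.
  rewrite {2}/x dual_form_sumr big_seq big1 // => gamma csr.
  by rewrite dual_formC dual_formZl dual_formC x0 ?mulr0 //; apply/pos_root/simple_pos.
move=> alpha asr; rewrite [a alpha]Crect.
rewrite (part (@Re K) _ _ alpha asr) => [|z|z t tR].
- rewrite (part (@Im K) _ _ alpha asr) => [|z|z t tR]; rewrite ?mulr0 ?addr0 //.
    exact: Creal_Im.
  exact: (ImMr tR z).
- exact: Creal_Re.
exact: (ReMr tR z).
Qed.

Lemma free_simple_roots : free sr.
Proof.
rewrite -[sr]in_tupleE; apply/freeP => k k0 i.
pose a alpha := \sum_(j < size sr | sr`_j == alpha) k j.
have aE (j : 'I_(size sr)) : a sr`_j = k j.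
  rewrite /a (bigD1 j) //= big1 ?addr0 // => l /andP[/eqP E ne].
  case/negP: ne; apply/eqP/val_inj/eqP.
  by rewrite -(nth_uniq 0 (ltn_ord l) (ltn_ord j) simple_uniq) E.
rewrite -aE; apply: simple_free; last by rewrite mem_nth.
rewrite (big_nth 0) big_mkord -[RHS]k0; apply: eq_bigr => j _.
by rewrite aE.
Qed.

(** Inside the cone the coefficients are chosen by [cid]; their values off the simple roots are
    arbitrary, so equalities between them are stated on [simple_roots P] only. *)
Definition coef phi : hdual h -> nat :=
  if pselect (in_root_cone P phi) is left phiC then projT1 (cid phiC) else fun=> 0%N.

Lemma coefP phi : in_root_cone P phi -> phi = \sum_(alpha <- sr) alpha *+ coef phi alpha.
Proof.
by rewrite /coef => phiC; case: pselect => // ?; case: cid.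
Qed.

Lemma simple_comb_uniq (c c' : hdual h -> nat) :
  \sum_(alpha <- sr) alpha *+ c alpha = \sum_(alpha <- sr) alpha *+ c' alpha ->
  forall alpha, alpha \in sr -> c alpha = c' alpha.
Proof.
move/eqP; rewrite -subr_eq0 -sumrB => /eqP E alpha asr.
apply/eqP; rewrite -(eqr_nat K) -subr_eq0; apply/eqP.
apply: (@simple_free (fun alpha => (c alpha)%:R - (c' alpha)%:R)) => //.
by rewrite -[RHS]E; apply: eq_bigr => gamma _; rewrite scalerBl !scaler_nat.
Qed.

Lemma coef_uniq phi (c : hdual h -> nat) : phi = \sum_(alpha <- sr) alpha *+ c alpha ->
  forall alpha, alpha \in sr -> coef phi alpha = c alpha.
Proof.
move=> E; apply: simple_comb_uniq; rewrite -E -coefP //.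
by exists c.
Qed.

Lemma coefD phi psi : in_root_cone P phi -> in_root_cone P psi ->
  forall alpha, alpha \in sr -> coef (phi + psi) alpha = (coef phi alpha + coef psi alpha)%N.
Proof.
move=> phiC psiC; apply: coef_uniq; rewrite {1}(coefP phiC) {1}(coefP psiC) -big_split.
by apply: eq_bigr => alpha _; rewrite mulrnDr.
Qed.

Lemma coef_simple gamma : gamma \in sr ->
  forall alpha, alpha \in sr -> coef gamma alpha = (alpha == gamma).
Proof.
move=> csr; apply: coef_uniq; rewrite (bigD1_seq gamma) ?simple_uniq //= eqxx mulr1n.
by rewrite big1 ?addr0 // => alpha /negPf ->; rewrite mulr0n.
Qed.

Lemma coef_sum phi psi : in_root_cone P phi ->
  dual_form phi psi = \sum_(alpha <- sr) (coef phi alpha)%:R * dual_form alpha psi.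
Proof.
move=> phiC; rewrite {1}(coefP phiC) dual_form_suml.
by apply: eq_bigr => alpha _; rewrite -scaler_nat dual_formZl.
Qed.

Lemma coef0_eq0 phi : in_root_cone P phi ->
  (forall alpha, alpha \in sr -> coef phi alpha = 0%N) -> phi = 0.
Proof.
move=> phiC c0; rewrite (coefP phiC) big_seq big1 // => alpha asr.
by rewrite c0.
Qed.

Lemma in_root_cone_anti phi : in_root_cone P phi -> in_root_cone P (- phi) -> phi = 0.
Proof.
move=> phiC nphiC; apply: (coef0_eq0 phiC) => alpha asr.
have := coefD phiC nphiC asr; rewrite subrr.
rewrite (@coef_uniq 0 (fun=> 0%N)) //; last by rewrite big1 // => gamma _; rewrite mulr0n.
by move/esym/eqP; rewrite addn_eq0 => /andP[/eqP].
Qed.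

Definition height phi := (\sum_(alpha <- sr) coef phi alpha)%N.

Lemma heightD phi psi : in_root_cone P phi -> in_root_cone P psi ->
  height (phi + psi) = (height phi + height psi)%N.
Proof.
move=> phiC psiC; rewrite /height !big_seq -big_split; apply: eq_bigr => alpha asr.
exact: coefD.
Qed.

Lemma height_gt0 phi : in_root_cone P phi -> phi != 0 -> (0 < height phi)%N.
Proof.
move=> phiC; apply: contra_neqT; rewrite -leqNgt leqn0 sum_nat_seq_eq0 => /allP c0.
by apply: coef0_eq0 => // alpha /c0/eqP.
Qed.

Lemma mem_root_support phi alpha : in_root_cone P phi ->
  (alpha \in root_support P phi) = (alpha \in sr) && (0 < coef phi alpha)%N.
Proof.
move=> phiC.
have cE (i : 'I_(size sr)) : coord (in_tuple sr) i phi = (coef phi sr`_i)%:R.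
  rewrite {1}(coefP phiC) (big_nth 0) big_mkord.
  under eq_bigr do rewrite -scaler_nat.
  exact: (@coord_sum_free _ _ _ (in_tuple sr) (fun i : 'I_(size sr) => (coef phi sr`_i)%:R)
    i free_simple_roots).
apply/mapP/andP => [ix|[asr c0]].
  case: ix => i; rewrite mem_filter cE ltr0n => /andP[c0 _] ->.
  by rewrite mem_nth.
move: (asr) => asr'; rewrite -index_mem in asr'.
exists (Ordinal asr'); last by rewrite nth_index.
by rewrite mem_filter cE /= nth_index // ltr0n c0 mem_enum.
Qed.

Lemma pos_simple_sub phi alpha : phi \in P -> alpha \in sr -> is_root (phi - alpha) ->
  phi - alpha \in P.
Proof.
move=> phiP /simpleP[aP na] r; apply: contraT => /(pos_neg r).
by rewrite opprB => /(na _ phiP).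
Qed.

Lemma root_sub_pos phi psi : is_root phi -> is_root psi -> 0 < dual_form phi psi ->
  phi != psi -> is_root (phi - psi).
Proof.
move=> rphi rpsi gt0 ne; apply: root_add => //; first exact: is_rootN.
  by rewrite dual_formNr oppr_lt0.
by rewrite subr_eq0.
Qed.

Lemma pos_simple_form_gt0 phi : phi \in P -> exists alpha,
  [/\ alpha \in sr, (0 < coef phi alpha)%N & 0 < dual_form alpha phi].
Proof.
move=> phiP; apply: contrapT => nex.
have := dual_form_gt0 (pos_root phiP); rewrite {1}(coef_sum _ (pos_cone phiP)).
rewrite big_seq => /lt_geF/negP; apply; apply: sumr_le0 => alpha asr.
have [->|c0] := posnP (coef phi alpha); first by rewrite mul0r.
rewrite mulr_ge0_le0 ?ler0n // real_leNgt ?real0 ?pos_form_real // ?simple_pos //.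
by apply/negP => gt0; apply: nex; exists alpha.
Qed.

(** Remove a simple root [alpha] with (alpha, phi) > 0; by induction the rest has its support on one
    side. If [alpha] were on the other side, it would be orthogonal to [phi - alpha]. Then
    [phi - alpha - alpha] is a root as well, which puts [alpha] in the support of [phi - alpha]. *)
Lemma support_connected (A : pred (hdual h)) phi : phi \in P ->
  (forall alpha gamma, alpha \in root_support P phi -> gamma \in root_support P phi ->
     A alpha -> ~~ A gamma -> dual_form alpha gamma = 0) ->
  {in root_support P phi, forall alpha, A alpha} \/
  {in root_support P phi, forall alpha, ~~ A alpha}.
Proof.
have [m] := ubnP (height phi); elim: m A phi => // m IH A phi ltm phiP orth.
have [alpha [asr ca fa]] := pos_simple_form_gt0 phiP.
have phiC := pos_cone phiP.
have [E|ne] := eqVneq phi alpha.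
  have supp1 gamma : gamma \in root_support P phi -> gamma = alpha.
    rewrite mem_root_support // => /andP[csr]; rewrite E coef_simple //.
    by case: eqP.
  have [Aa|nAa] := boolP (A alpha); [left|right] => gamma /supp1 -> //.
have r : is_root (phi - alpha).
  apply: root_sub_pos => //; [exact: pos_root|exact/pos_root/simple_pos|].
  by rewrite dual_formC.
have psiP := pos_simple_sub phiP asr r.
have psiC := pos_cone psiP; have aC := in_root_cone_simple asr.
have phiE : phi = (phi - alpha) + alpha by rewrite subrK.
have supp gamma : gamma \in root_support P phi =
    ((gamma \in root_support P (phi - alpha)) || (gamma == alpha)).
  rewrite !mem_root_support //; have [csr|nsr] /= := boolP (gamma \in sr); last first.
    by apply/esym; apply: contraNF nsr => /eqP ->.
  rewrite [coef phi gamma](_ : _ = coef (phi - alpha)%R gamma + coef alpha gamma)%N.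
    by rewrite [coef alpha _]coef_simple // addn_gt0 lt0b.
  by rewrite -coefD // subrK.
wlog: A orth / {in root_support P (phi - alpha), forall gamma, A gamma} => [WL|].
  have := IH A _ _ psiP; rewrite -ltnS (leq_trans _ ltm) ?ltnS; last first.
    have -> : height phi = (height (phi - alpha)%R + height alpha)%N.
      by rewrite -heightD // subrK.
    rewrite -[X in (X < _)%N]addn0 ltn_add2l height_gt0 //.
    by case: (pos_root (simple_pos asr)).
  case=> // [x y xs ys|inA|outA]; first by apply: orth; rewrite supp ?xs ?ys.
    exact: WL.
  have [||] := WL (predC A) _ outA; [|by right|].
    move=> x y xs ys /= nAx; rewrite negbK => Ay.
    by rewrite dual_formC orth.
  by move=> nn; left => x /nn /=; rewrite negbK.
move=> inA; have [Aa|nAa] := boolP (A alpha).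
  by left=> gamma; rewrite supp => /orP[/inA|/eqP ->].
have psia0 : dual_form (phi - alpha) alpha = 0.
  rewrite (coef_sum _ psiC) big_seq big1 // => gamma csr.
  have [->|c0] := posnP (coef (phi - alpha) gamma); first by rewrite mul0r.
  have cs : gamma \in root_support P (phi - alpha) by rewrite mem_root_support // csr.
  by rewrite orth ?mulr0 // ?supp ?cs ?eqxx ?orbT // inA.
have rr : is_root (phi - alpha - alpha).
  apply: root_sub => //; first exact/pos_root/simple_pos.
  by rewrite subrK; apply: pos_root.
have rrP := pos_simple_sub psiP asr rr.
have : alpha \in root_support P (phi - alpha).
  have rrC := pos_cone rrP.
  rewrite mem_root_support // asr -[X in coef X](subrK alpha) coefD //.
  by rewrite [coef alpha alpha]coef_simple // eqxx addn1.
by move/inA; rewrite (negPf nAa).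
Qed.

Definition pos_in (T : seq (hdual h)) phi := (phi \in P) && all (mem T) (root_support P phi).

Lemma pos_inP T phi : reflect (phi \in P /\ {subset root_support P phi <= T}) (pos_in T phi).
Proof. by apply: (iffP andP) => -[phiP /allP sT]. Qed.

Lemma root_support_simple phi : phi \in P -> {subset root_support P phi <= sr}.
Proof. by move=> /pos_cone phiC alpha; rewrite mem_root_support // => /andP[]. Qed.

Lemma root_support_neq0 phi : phi \in P -> exists alpha, alpha \in root_support P phi.
Proof.
move=> phiP; have [alpha [asr ca _]] := pos_simple_form_gt0 phiP.
by exists alpha; rewrite mem_root_support ?asr //; apply: pos_cone.
Qed.

Lemma root_support_sub phi psi : in_root_cone P psi -> in_root_cone P (phi - psi) ->
  {subset root_support P psi <= root_support P phi}.
Proof.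
move=> psiC dC; have phiC : in_root_cone P phi by rewrite -(subrK psi phi); apply: in_root_coneD.
move=> alpha; rewrite !mem_root_support // => /andP[asr c0].
by rewrite asr -(subrK psi phi) coefD // addn_gt0 c0 orbT.
Qed.

Lemma root_supportD phi psi alpha : in_root_cone P phi -> in_root_cone P psi ->
  (alpha \in root_support P (phi + psi)) =
  (alpha \in root_support P phi) || (alpha \in root_support P psi).
Proof.
move=> phiC psiC; have sC := in_root_coneD phiC psiC.
rewrite !mem_root_support //; by have [asr|//] := boolP (alpha \in sr); rewrite coefD // addn_gt0.
Qed.

Lemma root_support_simple1 alpha : alpha \in sr -> root_support P alpha =i [:: alpha].
Proof.
move=> asr gamma; have aC := in_root_cone_simple asr.
rewrite mem_root_support // inE.
have [csr|nsr] /= := boolP (gamma \in sr); first by rewrite coef_simple // lt0b.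
by apply/esym; apply: contraNF nsr => /eqP ->.
Qed.

Lemma pos_in_simple T alpha : alpha \in sr -> alpha \in T -> pos_in T alpha.
Proof.
move=> asr aT; apply/pos_inP; split; first exact: simple_pos.
by move=> gamma; rewrite root_support_simple1 // inE => /eqP ->.
Qed.

Lemma pos_inD T phi psi : pos_in T phi -> pos_in T psi -> is_root (phi + psi) ->
  pos_in T (phi + psi).
Proof.
move=> /pos_inP[phiP phiT] /pos_inP[psiP psiT] r; apply/pos_inP; split.
  by case: PP => _ _ _; apply.
by move=> alpha; rewrite root_supportD => [/orP[/phiT|/psiT]||]; rewrite ?inE //; apply: pos_cone.
Qed.

Lemma coef_sum_ge0 T phi beta : pos_in T phi ->
  (forall alpha, alpha \in T -> alpha \in sr -> 0 <= dual_form alpha beta) ->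
  0 <= dual_form phi beta /\
  (dual_form phi beta = 0 -> {in root_support P phi, forall alpha, dual_form alpha beta = 0}).
Proof.
move=> /pos_inP[phiP phiT] ge0; have phiC := pos_cone phiP.
have tge0 alpha : alpha \in sr -> 0 <= (coef phi alpha)%:R * dual_form alpha beta.
  move=> asr; have [->|c0] := posnP (coef phi alpha); first by rewrite mul0r.
  by rewrite mulr_ge0 ?ler0n // ge0 // phiT // mem_root_support ?asr.
rewrite (coef_sum _ phiC) big_seq; split; first exact: sumr_ge0.
move/eqP; rewrite psumr_eq0 // => /allP s0 alpha; rewrite mem_root_support // => /andP[asr c0].
have := s0 _ asr; rewrite asr /= mulf_eq0 pnatr_eq0 eqn0Ngt c0 => /eqP //.
Qed.

Lemma pos_in_max T phi : {subset T <= sr} -> pos_in T phi -> exists beta,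
  [/\ pos_in T beta, in_root_cone P (beta - phi),
      forall alpha, alpha \in T -> 0 <= dual_form alpha beta
    & forall psi, pos_in T psi -> in_root_cone P (psi - beta) -> psi = beta].
Proof.
move=> Tsr phiT; pose Q psi := pos_in T psi /\ in_root_cone P (psi - phi).
have Qphi : Q phi by split; rewrite ?subrr //; apply: in_root_cone0.
pose B := (\sum_(psi <- P) height psi)%N.
have bnd psi : Q psi -> (height psi <= B)%N.
  move=> [/pos_inP[psiP _] _]; rewrite /B (bigD1_seq psi) //=; first exact: leq_addr.
  by case: PP.
pose Qh := fun m => `[< exists psi, Q psi /\ height psi = m >].
have exQ : exists m, Qh m by exists (height phi); apply/asboolP; exists phi.
have ubQ m : Qh m -> (m <= B)%N by move=> /asboolP[psi [/bnd + <-]].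
have [m /asboolP[beta [Qbeta <-]] mx] := ex_maxnP exQ ubQ.
have {mx} mx psi : Q psi -> (height psi <= height beta)%N.
  by move=> Qpsi; apply: mx; apply/asboolP; exists psi.
have [betaT betaC] := Qbeta; have /pos_inP[betaP _] := betaT.
have strong psi : pos_in T psi -> in_root_cone P (psi - beta) -> psi = beta.
  move=> psiT dC; apply/eqP; rewrite -subr_eq0; apply: contraT => nz.
  have : (height psi <= height beta)%N.
    apply: mx; split=> //; rewrite -(subrK beta psi) -addrA.
    exact: in_root_coneD.
  rewrite -{1}(subrK beta psi) heightD //; last exact: pos_cone.
  by rewrite -[X in (_ <= X)%N]add0n leq_add2r leqNgt height_gt0.
exists beta; split=> // alpha aT; have asr := Tsr _ aT.
have aP := simple_pos asr.
rewrite real_leNgt ?real0 ?pos_form_real //; apply/negP => lt0.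
have sT : pos_in T (beta + alpha).
  apply: pos_inD => //; first exact: pos_in_simple.
  by apply/pos_root/pos_add; rewrite // dual_formC.
have := strong _ sT; rewrite [beta + alpha]addrC addrK => /(_ (in_root_cone_simple asr)).
move/eqP; rewrite -subr_eq0 addrK => /eqP a0.
by case: (pos_root aP) => /eqP.
Qed.

(** Outside the support, (alpha, beta) is a sum of nonpositive terms and is also nonnegative, so
    every term vanishes. The support of a dominant root is thus a full connected component of
    [T]. *)
Lemma support_orth T beta : {subset T <= sr} -> pos_in T beta ->
  (forall alpha, alpha \in T -> 0 <= dual_form alpha beta) ->
  forall alpha gamma, alpha \in T -> alpha \notin root_support P beta ->
    gamma \in root_support P beta -> dual_form alpha gamma = 0.
Proof.
move=> Tsr /pos_inP[betaP betaT] ge0 alpha gamma aT nas cs.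
have betaC := pos_cone betaP.
have le0 chi : chi \in sr -> (coef beta chi)%:R * dual_form chi alpha <= 0.
  move=> xsr; have [->|c0] := posnP (coef beta chi); first by rewrite mul0r.
  rewrite mulr_ge0_le0 ?ler0n //; apply: simple_obtuse => //; first exact: Tsr.
  by apply: contraNneq nas => <-; rewrite mem_root_support // xsr.
have : dual_form alpha beta = 0.
  apply: le_anti; rewrite ge0 // andbT dual_formC (coef_sum _ betaC) big_seq.
  exact: sumr_le0.
rewrite dual_formC (coef_sum _ betaC) => /eqP; rewrite big_seq -oppr_eq0 -sumrN.
rewrite psumr_eq0 => [/allP s0|chi xsr]; last by rewrite oppr_ge0 le0.
move: cs; rewrite mem_root_support // => /andP[csr c0].
have := s0 _ csr; rewrite csr oppr_eq0 mulf_eq0 pnatr_eq0 eqn0Ngt c0 /=.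
by rewrite dual_formC => /eqP.
Qed.

(** Let [beta] be maximal above [phi] in [T], and [beta'] maximal above [psi] in the support of
    [beta]. By connectedness [beta'] has the same support, hence positive pairing with [beta]. If
    they differed, their difference would be a root, and its sign would contradict the maximality of
    one of them. *)
Lemma highest_exists T phi : {subset T <= sr} -> pos_in T phi -> exists beta,
  [/\ pos_in T beta, in_root_cone P (beta - phi),
      forall alpha, alpha \in T -> 0 <= dual_form alpha beta
    & forall psi, pos_in (root_support P beta) psi -> in_root_cone P (beta - psi)].
Proof.
move=> Tsr /(pos_in_max Tsr)[beta [betaT bphi ge0 mxb]].
exists beta; split=> // psi psiS; have /pos_inP[betaP betaS] := betaT.
have Ssr := root_support_simple betaP.
have [beta' [b'S b'psi ge0' mxb']] := pos_in_max Ssr psiS.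
have /pos_inP[b'P b'sub] := b'S.
suff -> : beta = beta' by [].
have sub : {subset root_support P beta <= root_support P beta'}.
  have [alpha gamma aS cS a' c'|//|nn] :=
      @support_connected (mem (root_support P beta')) beta betaP.
    by rewrite dual_formC; apply: (support_orth Ssr b'S ge0').
  have [alpha aS'] := root_support_neq0 b'P.
  by have /negP := nn _ (b'sub _ aS').
have b'T : pos_in T beta' by apply/pos_inP; split=> // alpha /b'sub/betaS.
have [ge form0] := @coef_sum_ge0 T beta' beta b'T (fun alpha aT _ => ge0 _ aT).
have nz : dual_form beta' beta != 0.
  apply/eqP => /form0 f0; have := dual_form_gt0 (pos_root betaP).
  have betaC := pos_cone betaP; rewrite {1}(coef_sum _ betaC) big_seq big1 ?ltxx // => alpha asr.
  have [->|c0] := posnP (coef beta alpha); first by rewrite mul0r.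
  by rewrite f0 ?mulr0 // sub // mem_root_support ?asr.
have gt0 : 0 < dual_form beta beta' by rewrite dual_formC lt_neqAle eq_sym nz.
have [//|ne] := eqVneq beta beta'.
have r := root_sub_pos (pos_root betaP) (pos_root b'P) gt0 ne.
have [/pos_cone dC|/(pos_neg r)] := boolP (beta - beta' \in P).
  by apply: mxb' => //; apply/pos_inP; split.
by rewrite opprB => /pos_cone dC; apply/esym/mxb.
Qed.

(** * Subalgebras spanned by root spaces *)

Lemma subv_lie_gen (U : {vspace g}) : (U <= lie_gen U)%VS.
Proof.
rewrite /lie_gen; elim: (\dim _) => [|m IH] //=.
exact: subv_trans IH (addvSl _ _).
Qed.

Lemma lie_gen_closed (U : {vspace g}) :
  (lie_prod (lie_gen U) (lie_gen U) <= lie_gen U)%VS.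
Proof.
pose F W : {vspace g} := (W + lie_prod W W)%VS.
have stat m : F (iter m F U) = iter m F U \/ (m < \dim (iter m.+1 F U))%N.
  have step k : F (iter k F U) = iter k F U \/ (\dim (iter k F U) < \dim (iter k.+1 F U))%N.
    rewrite /=; have [|] := eqVneq (F (iter k F U)) (iter k F U); first by left.
    by rewrite eq_sym eqEdim addvSl /= -ltnNge; right.
  elim: m => [|m [E|lt]].
  - by have [|] := step 0%N; [left|move=> lt; right; apply: leq_ltn_trans lt].
  - by left; rewrite /= E.
  have [|lt'] := step m.+1; first by left.
  by right; apply: leq_ltn_trans lt'.
have [E|] := stat (\dim {:g}); first by rewrite -{3}[lie_gen U]E addvSr.
by rewrite ltnNge dimvS ?subvf.
Qed.

Lemma lie_gen_min (U W : {vspace g}) : (U <= W)%VS -> (lie_prod W W <= W)%VS ->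
  (lie_gen U <= W)%VS.
Proof.
move=> UW WW; rewrite /lie_gen; elim: (\dim _) => [|m IH] //=.
rewrite subv_add IH /=; apply: subv_trans WW; apply: lie_prod_sub => x y xm ym.
by apply: mem_lie_prod; apply: (subvP IH).
Qed.

Lemma bracket_span (X Y : seq g) (W : {vspace g}) :
  (forall x y : g, x \in X -> y \in Y -> bracket x y \in W) ->
  forall x y : g, x \in <<X>>%VS -> y \in <<Y>>%VS -> bracket x y \in W.
Proof.
move=> XY x y; rewrite -[X]in_tupleE -[Y]in_tupleE => /coord_span -> /coord_span ->.
rewrite bracket_suml memv_suml // => i _.
rewrite bracket_sumr memv_suml // => j _.
by rewrite bracketZl bracketZr !memvZ // XY // mem_nth.
Qed.

Definition roots_in T := [seq phi <- P | pos_in T phi] ++ [seq - phi | phi <- P & pos_in T phi].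

Lemma mem_roots_in T psi : (psi \in roots_in T) = pos_in T psi || pos_in T (- psi).
Proof.
rewrite mem_cat mem_filter; congr (_ || _).
  by rewrite /pos_in; case: (psi \in P); rewrite ?andbT ?andbF.
apply/mapP/idP => [[phi + ->]|psiT]; first by rewrite mem_filter opprK => /andP[].
by exists (- psi); rewrite ?opprK // mem_filter psiT; case/andP: psiT.
Qed.

Lemma roots_inN T psi : (- psi \in roots_in T) = (psi \in roots_in T).
Proof. by rewrite !mem_roots_in opprK orbC. Qed.

Lemma roots_in_root T psi : psi \in roots_in T -> is_root psi.
Proof.
rewrite mem_roots_in => /orP[/andP[/pos_root //]|/andP[/pos_root + _]].
by move/is_rootN; rewrite opprK.
Qed.

Lemma roots_in_pos T psi : psi \in P -> (psi \in roots_in T) = pos_in T psi.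
Proof.
move=> psiP; rewrite mem_roots_in; case: (pos_in T psi) => //=.
by apply/negP => /andP[/(pos_negF psiP)].
Qed.

Lemma roots_inS T T' : {subset T <= T'} -> {subset roots_in T <= roots_in T'}.
Proof.
move=> TT' psi; rewrite !mem_roots_in => /orP[]/pos_inP[psiP psiT]; apply/orP; [left|right];
  by apply/pos_inP; split=> // alpha /psiT/TT'.
Qed.

(** For summands of opposite sign, the support of the sum lies in the support of the summand that
    has the sign of the sum. *)
Lemma roots_inD T phi psi : phi \in roots_in T -> psi \in roots_in T ->
  is_root (phi + psi) -> phi + psi \in roots_in T.
Proof.
wlog phiP : phi psi / phi \in P => [WL|].
  have [|nP] := boolP (phi \in P); first exact: WL.
  move=> phiT psiT r; have rphi := roots_in_root phiT.
  rewrite -roots_inN opprD; apply: WL; rewrite ?roots_inN //; first exact: pos_neg.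
  by rewrite -opprD; apply: is_rootN.
move=> /[dup] phiT; rewrite roots_in_pos // => phiT' psiT r.
have [psiP|nP] := boolP (psi \in P).
  by rewrite mem_roots_in pos_inD //; move: psiT; rewrite roots_in_pos.
have npsiP := pos_neg (roots_in_root psiT) nP.
move: psiT; rewrite -roots_inN roots_in_pos // => psiT.
have [sP|nsP] := boolP (phi + psi \in P).
  rewrite mem_roots_in; apply/orP; left; apply/pos_inP; split=> // alpha aS.
  have /pos_inP[_] := phiT'; apply; apply: (root_support_sub (pos_cone sP)) aS.
  by rewrite opprD addrA subrr add0r; apply: pos_cone.
have nsP' := pos_neg r nsP.
rewrite mem_roots_in; apply/orP; right; apply/pos_inP; split=> // alpha aS.
have /pos_inP[_] := psiT; apply; apply: (root_support_sub (pos_cone nsP')) aS.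
by rewrite opprK addrCA addNr addr0; apply: pos_cone.
Qed.

(** A description shared by [{:g}] and the subalgebras [sub_lie T]. The Cartan part is only bounded
    by [h], which is enough to decide which root spaces lie in [L]. *)
Definition spans_roots T (L : {vspace g}) :=
  [/\ {subset T <= sr},
      (forall psi, psi \in roots_in T -> e psi \in L),
      (lie_prod L L <= L)%VS
    & (L <= <<vbasis h ++ map e (roots_in T)>>)%VS].

Lemma killing_root_span T psi v : is_root psi -> psi \notin roots_in T ->
  v \in <<vbasis h ++ map e (roots_in T)>>%VS -> killing (e (- psi)) v = 0.
Proof.
move=> rpsi nT; rewrite -[_ ++ _]in_tupleE => /coord_span ->.
rewrite killing_sumr big1 // => i _; rewrite killingZr.
have : (in_tuple (vbasis h ++ map e (roots_in T)))`_i \in vbasis h ++ map e (roots_in T).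
  by rewrite mem_nth.
have nz : - psi != 0 by case: (is_rootN rpsi).
rewrite mem_cat => /orP[/vbasis_mem xh|/mapP[chi xT ->]].
  by rewrite (killing_rootspace (root_vecN rpsi) (psi := 0)) ?mulr0 ?rootspace0 ?addr0.
have rchi := roots_in_root xT.
rewrite (killing_rootspace (root_vecN rpsi) (root_vec rchi)) ?mulr0 //.
by apply: contraNneq nT; rewrite addrC => /eqP; rewrite subr_eq0 => /eqP <-.
Qed.

Lemma rootspace_subE psi (L : {vspace g}) : is_root psi ->
  (rootspace psi <= L)%VS = (e psi \in L).
Proof.
move=> rpsi; apply/idP/idP => [/subvP|eL]; first by apply; apply: root_vec.
by apply/subvP => v /(root_space_line rpsi)[a ->]; apply: memvZ.
Qed.

Lemma spans_rootsP T L psi : spans_roots T L -> is_root psi ->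
  (rootspace psi <= L)%VS = (psi \in roots_in T).
Proof.
move=> [_ TL _ LT] rpsi; rewrite rootspace_subE //; apply/idP/idP; last exact: TL.
move=> eL; apply: contraT => nT; have := killing_root_span rpsi nT (subvP LT _ eL).
rewrite killingC; have [_ ->] := eP rpsi; move/eqP; by rewrite oner_eq0.
Qed.

Lemma e_neq0 psi : is_root psi -> e psi != 0.
Proof.
move=> rpsi; have [_ /eqP] := eP rpsi.
by apply: contraTneq => ->; rewrite killing0l eq_sym oner_eq0.
Qed.

Lemma bracket_dual_vec psi chi : is_root psi ->
  bracket (vsval (dual_vec chi)) (e psi) = dual_form psi chi *: e psi.
Proof. by move=> /root_vec/rootspaceP ->; rewrite dual_formE. Qed.

Lemma full_decomp : ({:g} <= <<vbasis h ++ map e (roots_in sr)>>)%VS.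
Proof.
have [b [w [bP wP]]] := weight_basis hC; apply/subvP => v _.
rewrite [v](coordE bP) memv_suml // => i _; rewrite memvZ // span_cat.
have [wi|nz] := eqVneq (w i) 0.
  apply: (subvP (addvSl <<vbasis h>> _)); rewrite (span_basis (vbasisP h)).
  by rewrite -(rootspace0 hC) -wi (weight_vec wP).
have r : is_root (w i) by apply/(is_rootP bP wP); split=> //; exists i.
apply: (subvP (addvSr _ _)).
have [a ->] := root_space_line r (weight_vec wP i).
rewrite memvZ // memv_span // map_f // mem_roots_in.
have [wP'|/(pos_neg r) wP'] := boolP (w i \in P); apply/orP; [left|right];
  by apply/pos_inP; split=> //; apply: root_support_simple.
Qed.

Lemma spans_full : spans_roots sr {:g}.
Proof. by split=> // [psi _||]; [apply: memvf|apply: subvf|apply: full_decomp]. Qed.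

(** Root vectors are reached by induction on the height: the bracket of two root vectors is a
    nonzero multiple of a third whenever the weights add up to a root. For the upper bound, the span
    of [h] and these root vectors is itself closed under brackets. *)
Lemma spans_sub_lie T : {subset T <= sr} -> spans_roots T (sub_lie T).
Proof.
move=> Tsr; split=> // [psi||].
- have gen alpha : alpha \in T -> e alpha \in sub_lie T /\ e (- alpha) \in sub_lie T.
    move=> aT; have r := pos_root (simple_pos (Tsr _ aT)).
    have sub : (rootspace alpha + rootspace (- alpha) <= sub_lie T)%VS.
      apply: subv_trans (subv_lie_gen _).
      by rewrite (big_rem alpha) //= addvSl.
    by split; apply: (subvP sub); [apply: (subvP (addvSl _ _))|apply: (subvP (addvSr _ _))];
      [apply: root_vec|apply: root_vecN].
  have closed phi psi' : is_root phi -> is_root psi' -> is_root (phi + psi') ->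
      e phi \in sub_lie T -> e psi' \in sub_lie T -> e (phi + psi') \in sub_lie T.
    move=> r1 r2 r3 m1 m2; have nz := bracket_root_neq0 r1 r2 r3.
    have [a E] := root_space_line r3 (rootspace_bracket (root_vec r1) (root_vec r2)).
    have : bracket (e phi) (e psi') \in sub_lie T.
      by apply: (subvP (lie_gen_closed _)); apply: mem_lie_prod.
    have a0 : a != 0 by apply: contraNneq nz => a0; rewrite E a0 scale0r.
    by rewrite E => /(memvZ a^-1); rewrite scalerA mulVf // scale1r.
  have both phi : pos_in T phi -> e phi \in sub_lie T /\ e (- phi) \in sub_lie T.
    have [m] := ubnP (height phi); elim: m phi => // m IH phi ltm /pos_inP[phiP phiT].
    have [alpha [asr ca fa]] := pos_simple_form_gt0 phiP.
    have phiC := pos_cone phiP.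
    have aT : alpha \in T by apply: phiT; rewrite mem_root_support ?asr.
    have [->|ne] := eqVneq phi alpha; first exact: gen.
    have ra := pos_root (simple_pos asr).
    have r : is_root (phi - alpha).
      by apply: root_sub_pos => //; [exact: pos_root|rewrite dual_formC].
    have psiP := pos_simple_sub phiP asr r; have psiC := pos_cone psiP.
    have aC := in_root_cone_simple asr.
    have psiT : pos_in T (phi - alpha).
      apply/pos_inP; split=> // gamma cS; apply: phiT.
      by apply: root_support_sub cS => //; rewrite opprB addrCA subrr addr0.
    have [|IH1 IH2] := IH _ _ psiT.
      rewrite -ltnS (leq_trans _ ltm) // ltnS.
      have -> : height phi = (height (phi - alpha)%R + height alpha)%N.
        by rewrite -heightD // subrK.
      rewrite -[X in (X < _)%N]addn0 ltn_add2l height_gt0 //.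
      by case: ra.
    have [g1 g2] := gen _ aT; split.
      by rewrite -(subrK alpha phi) closed // subrK; apply: pos_root.
    rewrite -(subrK alpha phi) opprD.
    apply: (closed _ _ (is_rootN r) (is_rootN ra)); [|exact: IH2|exact: g2].
    by rewrite -opprD subrK; exact: is_rootN (pos_root phiP).
  rewrite mem_roots_in => /orP[/both[] //|/both[_]].
  by rewrite opprK.
- exact: lie_gen_closed.
- apply: lie_gen_min.
    rewrite big_seq; elim/big_ind: _ => [|U V UW VW|alpha aT]; first exact: sub0v.
      by rewrite subv_add UW.
    have r := pos_root (simple_pos (Tsr _ aT)).
    have aR : alpha \in roots_in T by rewrite mem_roots_in pos_in_simple // Tsr.
    rewrite subv_add !rootspace_subE //; last exact: is_rootN.
    by rewrite !memv_span // mem_cat map_f ?orbT // roots_inN.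
  apply: lie_prod_sub; apply: bracket_span => x y.
  rewrite !mem_cat => /orP[/vbasis_mem xh|/mapP[phi phiT ->]];
    move=> /orP[/vbasis_mem yh|/mapP[psi psiT ->]].
  + by rewrite (cartan_comm hC) // mem0v.
  + have /root_vec/rootspaceP := roots_in_root psiT.
    rewrite -(vsprojK xh) => ->; rewrite memvZ // memv_span // mem_cat.
    by rewrite map_f ?orbT.
  + have /root_vec/rootspaceP := roots_in_root phiT.
    rewrite bracketC -(vsprojK yh) => ->; rewrite memvN memvZ // memv_span // mem_cat.
    by rewrite map_f ?orbT.
  have r1 := roots_in_root phiT; have r2 := roots_in_root psiT.
  have br := rootspace_bracket (root_vec r1) (root_vec r2).
  rewrite span_cat; have [s0|nz] := eqVneq (phi + psi) 0.
    apply: (subvP (addvSl <<vbasis h>> _)); rewrite (span_basis (vbasisP h)).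
    by rewrite -(rootspace0 hC) -s0.
  have [r|nr] := pselect (is_root (phi + psi)); last first.
    by rewrite (bracket_rootspace0 (root_vec r1) (root_vec r2)) ?mem0v.
  have [a ->] := root_space_line r br.
  apply: (subvP (addvSr _ _)); rewrite memvZ // memv_span // map_f //.
  exact: roots_inD.
Qed.

(** If [phi + psi] were a root, its support would split into two orthogonal parts. The difference
    reduces to the sum because [phi] and [psi] are orthogonal. *)
Lemma orth_support_not_root phi psi : phi \in P -> psi \in P ->
  (forall alpha gamma, alpha \in root_support P phi -> gamma \in root_support P psi ->
     dual_form alpha gamma = 0) ->
  [/\ dual_form phi psi = 0, ~ is_root (phi + psi) & ~ is_root (phi - psi)].
Proof.
move=> phiP psiP orth; have phiC := pos_cone phiP; have psiC := pos_cone psiP.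
have rphi := pos_root phiP; have rpsi := pos_root psiP.
have f0 alpha : alpha \in root_support P phi -> dual_form alpha psi = 0.
  move=> aS; rewrite dual_formC (coef_sum _ psiC) big_seq big1 // => gamma csr.
  have [->|c0] := posnP (coef psi gamma); first by rewrite mul0r.
  by rewrite dual_formC orth ?mulr0 // mem_root_support ?csr.
have f00 : dual_form phi psi = 0.
  rewrite (coef_sum _ phiC) big_seq big1 // => alpha asr.
  have [->|c0] := posnP (coef phi alpha); first by rewrite mul0r.
  by rewrite f0 ?mulr0 // mem_root_support ?asr.
have noD : ~ is_root (phi + psi).
  move=> r; have sP : phi + psi \in P by case: PP => _ _ _; apply.
  have [alpha aS] := root_support_neq0 phiP; have [gamma cS] := root_support_neq0 psiP.
  have disj chi : chi \in root_support P phi -> chi \in root_support P psi -> False.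
    move=> x1 x2; have xsr := root_support_simple phiP x1.
    by have := dual_form_gt0 (pos_root (simple_pos xsr)); rewrite orth ?ltxx.
  have [x y xS yS /= xphi yphi|inA|outA] :=
      @support_connected (mem (root_support P phi)) _ sP.
  - apply: orth => //; move: yS; rewrite root_supportD // => /orP[yS|//].
    by rewrite yS in yphi.
  - by apply: (disj gamma) => //; apply: inA; rewrite root_supportD // cS orbT.
  have aS' : alpha \in root_support P (phi + psi) by rewrite root_supportD // aS.
  by have /negP := outA _ aS'.
split; [exact: f00|exact: noD|move=> r; apply: noD].
rewrite -[psi]opprK; apply: root_sub r => //; first exact: is_rootN.
by rewrite dual_formNr f00 oppr0.
Qed.

(** * The simple ideal attached to a highest root *)

Section SimpleIdeal.
Variables (T : seq (hdual h)) (L : {vspace g}).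
Hypothesis LT : spans_roots T L.
Local Notation C := (root_support P).

(** The subalgebra with simple roots [C beta], given by explicit spanning vectors: its root vectors
    and their brackets t_psi in [h]. *)
Definition ideal_of beta : {vspace g} :=
  <<map e (roots_in (C beta)) ++
    map (fun psi => vsval (dual_vec psi)) (roots_in (C beta))>>%VS.

Lemma ideal_of_killing beta psi v : is_root psi -> psi \notin roots_in (C beta) ->
  v \in ideal_of beta -> killing (e (- psi)) v = 0.
Proof.
move=> rpsi nT vI; apply: (killing_root_span rpsi nT).
apply: subvP vI; apply/span_subvP => x; rewrite mem_cat => /orP[/mapP[chi xC ->]|/mapP[chi xC ->]].
  by rewrite memv_span // mem_cat map_f // orbT.
by rewrite span_cat; apply: (subvP (addvSl <<vbasis h>> _));
    rewrite (span_basis (vbasisP h)) subvsP.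
Qed.

Lemma ideal_of_root beta psi : is_root psi ->
  (rootspace psi <= ideal_of beta)%VS = (psi \in roots_in (C beta)).
Proof.
move=> rpsi; rewrite rootspace_subE //; apply/idP/idP => [eI|psiC]; last first.
  by rewrite memv_span // mem_cat map_f.
apply: contraT => nC; have := ideal_of_killing rpsi nC eI.
rewrite killingC; have [_ ->] := eP rpsi; move/eqP; by rewrite oner_eq0.
Qed.

Lemma ideal_of_lie_ideal beta : beta \in P -> {subset C beta <= T} ->
  (forall alpha gamma, alpha \in T -> alpha \notin C beta -> gamma \in C beta ->
     dual_form alpha gamma = 0) ->
  lie_ideal L (ideal_of beta).
Proof.
move=> betaP bT orth; have [Tsr TL Lcl Lspan] := LT.
have sub := roots_inS bT.
(* By connectedness, a root of [T] not supported in [C beta] is supported in its complement, which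
   is orthogonal to [C beta]. *)
have orth_roots chi psi : chi \in roots_in T -> chi \notin roots_in (C beta) ->
    psi \in roots_in (C beta) -> dual_form chi psi = 0 /\ ~ is_root (chi + psi).
  have pp phi' psi' : pos_in T phi' -> ~~ pos_in (C beta) phi' -> pos_in (C beta) psi' ->
      [/\ dual_form phi' psi' = 0, ~ is_root (phi' + psi') & ~ is_root (phi' - psi')].
    move=> /pos_inP[phiP phiT] nphi /pos_inP[psiP psiC].
    apply: orth_support_not_root => // alpha gamma aS /psiC cS.
    have [x y xS yS /= xC yC|inC|outC] := @support_connected (mem (C beta)) _ phiP.
    - by rewrite dual_formC; apply: orth => //; apply: phiT.
    - by case/negP: nphi; apply/pos_inP; split=> // x /inC.
    by apply: orth => //; [exact: phiT|exact: outC].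
  wlog chiP : chi psi / chi \in P => [WL|].
    have [|nP] := boolP (chi \in P); first exact: WL.
    move=> xT xC pC; have r := roots_in_root xT.
    have [||||f0 nr] := WL (- chi) (- psi); rewrite ?roots_inN //; first exact: pos_neg.
    rewrite dual_formNl dual_formNr opprK in f0.
    by split; [exact: f0|move/is_rootN; rewrite opprD].
  rewrite (roots_in_pos T chiP) (roots_in_pos (C beta) chiP) => xT xC.
  rewrite mem_roots_in => /orP[pC|pC].
    by have [? ? _] := pp _ _ xT xC pC.
  have [f0 _] := pp _ _ xT xC pC; rewrite opprK; split=> //.
  by move: f0; rewrite dual_formNr => /eqP; rewrite oppr_eq0 => /eqP.
split.
  apply/span_subvP => x; rewrite mem_cat => /orP[]/mapP[psi pC ->]; first exact/TL/sub.
  have r := roots_in_root pC; rewrite -(bracket_root_vec r); apply: (subvP Lcl).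
  by apply: mem_lie_prod; apply: TL; rewrite ?roots_inN; apply: sub.
have memI psi a : psi \in roots_in (C beta) -> a *: e psi \in ideal_of beta.
  by move=> pC; rewrite memvZ // memv_span // mem_cat map_f.
apply: lie_prod_sub => x y /(subvP Lspan) xL; apply: bracket_span xL => {}x {}y.
rewrite !mem_cat => /orP[/vbasis_mem xh|/mapP[chi xT ->]] /orP[]/mapP[psi pC ->].
- have /root_vec/rootspaceP := roots_in_root pC.
  by rewrite -(vsprojK xh) => ->; apply: memI.
- by rewrite (cartan_comm hC) ?mem0v ?subvsP.
- have r1 := roots_in_root xT; have r2 := roots_in_root pC.
  have br := rootspace_bracket (root_vec r1) (root_vec r2).
  have [s0|nz] := eqVneq (chi + psi) 0.
    have chiE : chi = - psi by apply/eqP; rewrite -addr_eq0 s0.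
    have m : e psi \in rootspace (- chi) by rewrite chiE opprK; apply: root_vec.
    rewrite (bracket_rootN (root_vec r1) m) memvZ // memv_span // mem_cat.
    by rewrite (map_f (fun psi => vsval (dual_vec psi))) ?orbT // chiE roots_inN.
  have [r|nr] := pselect (is_root (chi + psi)); last first.
    by rewrite (bracket_rootspace0 (root_vec r1) (root_vec r2)) ?mem0v.
  have [a ->] := root_space_line r br; apply: memI.
  have [xC|xC] := boolP (chi \in roots_in (C beta)); first exact: roots_inD.
  by have [] := orth_roots _ _ xT xC pC.
rewrite bracketC bracket_dual_vec ?(roots_in_root xT) //; last exact: roots_in_root xT.
rewrite -scaleNr; have [xC|xC] := boolP (chi \in roots_in (C beta)); first exact: memI.
by have [-> _] := orth_roots _ _ xT xC pC; rewrite oppr0 scale0r mem0v.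
Qed.

(** Bracketing [e psi] with [e (- psi)] gives t_psi, which acts on [e chi] by (chi, psi). So
    membership in [J] propagates between nonorthogonal roots. *)
Lemma ideal_root_closed (I J : {vspace g}) psi chi : (lie_prod I J <= J)%VS ->
  is_root psi -> is_root chi -> e (- psi) \in I -> e chi \in I -> e psi \in J ->
  vsval (dual_vec psi) \in J /\ (dual_form chi psi != 0 -> e chi \in J).
Proof.
move=> IJ rpsi rchi npsiI chiI psiJ.
have tJ : vsval (dual_vec psi) \in J.
  rewrite -(bracket_root_vec rpsi) bracketC memvN; apply: (subvP IJ).
  exact: mem_lie_prod.
split=> // nz; have : bracket (e chi) (vsval (dual_vec psi)) \in J.
  by apply: (subvP IJ); apply: mem_lie_prod.
rewrite bracketC bracket_dual_vec // memvN => /(memvZ (dual_form chi psi)^-1).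
by rewrite scalerA mulVf // scale1r.
Qed.

Lemma span_dual_vec (s : seq (hdual h)) v :
  v \in <<map (fun psi => vsval (dual_vec psi)) s>>%VS ->
  exists2 phi, phi \in <<s>>%VS & v = vsval (dual_vec phi).
Proof.
elim: s v => [|psi s IH] v /=; rewrite ?span_nil ?span_cons.
  by rewrite memv0 => /eqP ->; exists 0; rewrite ?mem0v // /dual_vec !linear0.
move=> /memv_addP[_ /vlineP[a ->] [u /IH[phi phis ->] ->]].
exists (a *: psi + phi); last by rewrite /dual_vec !linearP.
by rewrite memv_add // memvZ // memv_line.
Qed.

(** A nonzero [x] in [J] with the fewest weight coordinates has a single weight: otherwise some
    t_psi separates two of its weights, and subtracting a multiple of [x] from its bracket with
    t_psi gives a shorter vector. If the weight is zero, a root not vanishing at [x] supplies the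
    root vector; were there none, [x] would correspond to a [phi] in the span of the roots and
    orthogonal to them, hence to 0. *)
Lemma ideal_has_root beta (J : {vspace g}) : (J <= ideal_of beta)%VS ->
  (lie_prod (ideal_of beta) J <= J)%VS -> J != 0%VS ->
  exists2 psi, psi \in roots_in (C beta) & e psi \in J.
Proof.
move=> JI IJ nzJ; have [b [w [bP wP]]] := weight_basis hC.
have tI psi : psi \in roots_in (C beta) -> vsval (dual_vec psi) \in ideal_of beta.
  by move=> pC; rewrite memv_span // mem_cat (map_f (fun psi => vsval (dual_vec psi))) ?orbT.
pose supp v := [set i | coord b i v != 0].
have /ex_minnP[m /asboolP[x [xJ x0 <-]] mn] :
    exists m, `[< exists v, [/\ v \in J, v != 0 & #|supp v| = m] >].
  by exists #|supp (vpick J)|; apply/asboolP; exists (vpick J); rewrite memv_pick vpick0.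
have xI := subvP JI _ xJ.
have wC i : i \in supp x -> w i = 0 \/ w i \in roots_in (C beta).
  rewrite inE => ci; have [|wn] := eqVneq (w i) 0; [by left|right].
  have r : is_root (w i) by apply/(is_rootP bP wP); split=> //; exists i.
  apply: contraT => nC; case/eqP: ci.
  have [a bE] := root_space_line r (weight_vec wP i).
  have a0 : a != 0 by apply: contraNneq (basis_neq0 bP i) => a0; rewrite bE a0 scale0r.
  have := ideal_of_killing r nC xI; rewrite [x](coordE bP) killing_sumr (bigD1 i) //=.
  rewrite big1 ?addr0 => [|j ne]; last first.
    rewrite killingZr (killing_rootspace (root_vecN r) (weight_vec wP j)) ?mulr0 //.
    rewrite addrC subr_eq0; apply: contra ne => /eqP wj; apply/eqP.
    exact: (root_mult1 bP wP r).
  move/eqP; rewrite killingZr bE killingZr killingC; have [_ ->] := eP r.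
  by rewrite mulr1 mulf_eq0 (negPf a0) orbF (coord_sum bP) => /eqP.
have same i j : i \in supp x -> j \in supp x -> w i = w j.
  move=> si sj; apply: contrapT => ne.
  have [psi pC nz] : exists2 psi, psi \in roots_in (C beta) & dual_form (w i - w j) psi != 0.
    apply: contrapT => nex; apply: ne; apply/eqP; rewrite -subr_eq0; apply/eqP.
    pose F (k : bool) := if k then w i else w j.
    have FC k : F k = 0 \/ F k \in roots_in (C beta) by case: k; apply: wC.
    pose c (k : bool) : K := if k then 1 else - 1.
    have -> : w i - w j = \sum_k c k *: F k by rewrite big_bool /= scale1r scaleN1r.
    apply: dual_form_span0 => k; have [->|kC] := FC k.
    - by left.
    - by right; apply: roots_in_root kC.
    - by rewrite dual_formC dual_form0l.
    rewrite big_bool /= scale1r scaleN1r; apply/eqP/negPn/negP => nz.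
    by apply: nex; exists (F k).
  pose t := dual_vec psi.
  pose y := bracket (vsval t) x - w i t *: x.
  have cy l : coord b l y = (w l t - w i t) * coord b l x.
    by rewrite linearB linearZ /= (coord_bracket bP wP) mulrBl.
  have yJ : y \in J.
    rewrite memvB ?memvZ //; apply: (subvP IJ); apply: mem_lie_prod => //.
    exact: tI.
  have y0 : y != 0.
    apply: contraNneq nz => y0; have := cy j; rewrite y0 linear0 => /esym/eqP.
    move: sj; rewrite inE mulf_eq0 => /negPf ->; rewrite orbF.
    by rewrite dual_formDl dual_formNl !dual_formE -opprB oppr_eq0.
  have /mn : `[< exists v, [/\ v \in J, v != 0 & #|supp v| = #|supp y|] >].
    by apply/asboolP; exists y.
  rewrite leqNgt => /negP; apply; apply: proper_card; apply/properP; split.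
    by apply/fintype.subsetP => l; rewrite !inE cy mulf_eq0 negb_or => /andP[].
  by exists i => //; rewrite inE cy subrr mul0r eqxx.
have [i si] : exists i, i \in supp x.
  apply: contrapT => nex; case/eqP: x0; rewrite [x](coordE bP) big1 // => l _.
  have [->|cl] := eqVneq (coord b l x) 0; first by rewrite scale0r.
  by case: nex; exists l; rewrite inE.
have xw : x \in rootspace (w i).
  rewrite [x](coordE bP) memv_suml // => l _.
  have [->|cl] := eqVneq (coord b l x) 0; first by rewrite scale0r mem0v.
  by rewrite memvZ // (same i l) // ?inE // (weight_vec wP).
have [w0|wiC] := wC i si; last first.
  have r := roots_in_root wiC; exists (w i) => //.
  have [a xE] := root_space_line r xw.
  have a0 : a != 0 by apply: contraNneq x0 => a0; rewrite xE a0 scale0r.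
  by move: xJ; rewrite xE => /(memvZ a^-1); rewrite scalerA mulVf // scale1r.
rewrite w0 (rootspace0 hC) in xw.
apply: contrapT => nex; case/eqP: x0.
have zero psi : psi \in roots_in (C beta) -> psi (vsproj h x) = 0.
  move=> pC; apply/eqP/negPn/negP => nz; apply: nex; exists psi => //.
  have : bracket x (e psi) \in J.
    rewrite bracketC memvN; apply: (subvP IJ); apply: mem_lie_prod => //.
    by rewrite memv_span // mem_cat map_f.
  have /root_vec/rootspaceP := roots_in_root pC; rewrite -{1}(vsprojK xw) => ->.
  by move/(memvZ (psi (vsproj h x))^-1); rewrite scalerA mulVf // scale1r.
move: xI; rewrite /ideal_of span_cat => /memv_addP[u uA [v vB xE]].
have [phi phiC vE] := span_dual_vec vB.
have uh y : killing u (vsval y) = 0.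
  move: uA; rewrite -[map _ _]in_tupleE => /coord_span ->.
  rewrite killing_suml big1 // => k _; rewrite killingZl.
  have : (in_tuple (map e (roots_in (C beta))))`_k \in map e (roots_in (C beta)).
    by rewrite mem_nth.
  move=> /mapP[chi /roots_in_root rchi ->].
  rewrite (killing_rootspace (root_vec rchi) (psi := 0)) ?mulr0 ?rootspace0 ?subvsP //.
  by rewrite addr0; case: rchi.
have xphi : vsproj h x = dual_vec phi.
  apply/eqP; rewrite -subr_eq0; apply/eqP/killing_cartan_nondeg => y.
  by rewrite linearB /= vsprojK // -vE xE -addrA subrr addr0 uh.
have phi0 : phi = 0.
  move: phiC; rewrite -[roots_in _]in_tupleE => /coord_span phiE.
  rewrite phiE; apply: dual_form_span0 => k.
    by right; apply/(@roots_in_root (C beta))/mem_nth.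
  rewrite -phiE dual_formC dual_formE -xphi; apply: zero.
  by apply: mem_nth.
by rewrite -(vsprojK xw) xphi phi0 /dual_vec !linear0.
Qed.

(** A nonzero ideal contains a root vector, hence the vector of a nonorthogonal simple root. By
    connectedness of [C beta] it contains those of all simple roots, and from them it reaches every
    root. *)
Lemma ideal_of_simple beta : pos_in T beta ->
  (forall psi, pos_in (C beta) psi -> in_root_cone P (beta - psi)) ->
  simple_lie (ideal_of beta).
Proof.
move=> /pos_inP[betaP bT] high; have rb := pos_root betaP.
have bC : beta \in roots_in (C beta) by rewrite roots_in_pos //; apply/pos_inP; split.
have eI psi : psi \in roots_in (C beta) -> e psi \in ideal_of beta.
  by move=> pC; rewrite memv_span // mem_cat map_f.
split=> [I0|J [JI IJ]].
  have : bracket (e beta) (e (- beta)) \in 0%VS.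
    by rewrite -I0; apply: mem_lie_prod; apply: eI; rewrite ?roots_inN.
  rewrite memv0 bracket_root_vec // => /eqP d0.
  by have := dual_form_gt0 rb; rewrite /dual_form d0 killing0l ltxx.
have [->|nz] := eqVneq J 0%VS; [by left|right].
have [psi0 pC0 pJ0] := ideal_has_root JI IJ nz.
have step psi chi : psi \in roots_in (C beta) -> chi \in roots_in (C beta) ->
    e psi \in J -> dual_form chi psi != 0 -> e chi \in J.
  move=> pC xC pJ; have nI : e (- psi) \in ideal_of beta by apply: eI; rewrite roots_inN.
  by case: (ideal_root_closed IJ (roots_in_root pC) (roots_in_root xC) nI (eI _ xC) pJ).
have stepN psi : psi \in roots_in (C beta) -> e psi \in J -> e (- psi) \in J.
  move=> pC pJ; apply: (step _ _ pC _ pJ); rewrite ?roots_inN // dual_formNl oppr_eq0.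
  exact/dual_form_neq0/roots_in_root/pC.
have simple_in alpha : alpha \in C beta -> alpha \in roots_in (C beta).
  move=> aC; have asr := root_support_simple betaP aC.
  by rewrite roots_in_pos ?simple_pos // pos_in_simple.
have [alpha aC aJ] : exists2 alpha, alpha \in C beta & e alpha \in J.
  wlog psiP : psi0 pC0 pJ0 / psi0 \in P => [WL|].
    have [|nP] := boolP (psi0 \in P); first exact: WL.
    apply: (WL (- psi0)); rewrite ?roots_inN //; first exact: stepN.
    exact: pos_neg (roots_in_root pC0) nP.
  have [alpha [asr ca fa]] := pos_simple_form_gt0 psiP.
  have psiS : pos_in (C beta) psi0 by rewrite -roots_in_pos.
  have aC : alpha \in C beta.
    by have /pos_inP[_] := psiS; apply; rewrite mem_root_support ?asr //; apply: pos_cone.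
  exists alpha => //; apply: step pC0 (simple_in _ aC) pJ0 _.
  exact: lt0r_neq0.
have allC gamma : gamma \in C beta -> e gamma \in J.
  have [x y xC yC xJ yJ|all|none] := @support_connected (fun gamma => e gamma \in J) beta betaP.
  - apply/eqP; apply: contraNT yJ => nf; apply: (step x) => //; try exact: simple_in.
    by rewrite dual_formC.
  - exact: all.
  by have := none _ aC; rewrite aJ.
have posJ psi : pos_in (C beta) psi -> e psi \in J.
  move=> /[dup] psiS /pos_inP[psiP psiC].
  have [gamma [csr cc fc]] := pos_simple_form_gt0 psiP.
  have cC : gamma \in C beta by apply: psiC; rewrite mem_root_support ?csr //; apply: pos_cone.
  apply: step (simple_in _ cC) _ (allC _ cC) _; first by rewrite roots_in_pos.
  by rewrite dual_formC lt0r_neq0.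
have allJ psi : psi \in roots_in (C beta) -> e psi \in J.
  move=> pC; have [pP|nP] := boolP (psi \in P); first by apply: posJ; rewrite -roots_in_pos.
  rewrite -[psi]opprK; apply: stepN; first by rewrite roots_inN.
  have npP := pos_neg (roots_in_root pC) nP.
  by apply: posJ; rewrite -roots_in_pos // roots_inN.
apply/eqP; rewrite eqEsubv JI; apply/span_subvP => x; rewrite mem_cat => /orP[]/mapP[psi pC ->].
  exact: allJ.
have r := roots_in_root pC.
have nI : e (- psi) \in ideal_of beta by apply: eI; rewrite roots_inN.
by case: (ideal_root_closed IJ r r nI (eI _ pC) (allJ _ pC)).
Qed.

Lemma highest_component phi : pos_in T phi -> exists I beta,
  [/\ simple_component L I, highest_root P I beta, locally_high P beta,
      pos_in T beta & in_root_cone P (beta - phi) /\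
      forall alpha, alpha \in T -> 0 <= dual_form alpha beta].
Proof.
have [Tsr _ _ _] := LT; move=> /(highest_exists Tsr)[beta [bT bphi ge0 high]].
have /pos_inP[betaP bS] := bT.
(* [sub_lie (C beta)] and [ideal_of beta] contain the same root spaces; the first gives
   [locally_high], the second the component. *)
have hr M : spans_roots (C beta) M \/ M = ideal_of beta -> highest_root P M beta.
  have rb := pos_root betaP.
  have bC : beta \in roots_in (C beta) by rewrite roots_in_pos //; apply/pos_inP; split.
  move=> HM; have ME psi : is_root psi -> (rootspace psi <= M)%VS = (psi \in roots_in (C beta)).
    by move=> r; case: HM => [HM|->]; [apply: spans_rootsP|apply: ideal_of_root].
  split=> // [|psi r]; rewrite ME // mem_roots_in => /orP[/high //|/andP[nP _]].
  by apply: in_root_coneD; [apply: pos_cone|apply: pos_cone nP].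
exists (ideal_of beta), beta; split=> //.
- split; last exact: ideal_of_simple.
  apply: ideal_of_lie_ideal => // alpha gamma aT aC cC.
  exact: (support_orth Tsr bT ge0).
- by apply: hr; right.
- by apply: hr; left; apply: spans_sub_lie; apply: root_support_simple.
Qed.

End SimpleIdeal.

(** * The cascade *)

Lemma component_eq (L I I' : {vspace g}) : simple_component L I -> simple_component L I' ->
  I = I' \/ (I :&: I')%VS = 0%VS.
Proof.
move=> [[IL LI] [_ sI]] [[I'L LI'] [_ sI']].
have IdealI (J : {vspace g}) : (J <= L)%VS -> (lie_prod J (I :&: I') <= I :&: I')%VS.
  move=> JL; apply: lie_prod_sub => x y xJ /memv_capP[yI yI']; apply/memv_capP.
  split; [apply: (subvP LI)|apply: (subvP LI')]; apply: mem_lie_prod => //;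
    exact: (subvP JL).
have [||I0] := sI (I :&: I')%VS; first by split; [apply: capvSl|apply: IdealI].
  by right.
have [||I'0] := sI' (I :&: I')%VS; first by split; [apply: capvSr|apply: IdealI].
  by right.
by left; rewrite -I0 I'0.
Qed.

(** * Highest roots of arbitrary simple components *)

Section Components.
Variables (T : seq (hdual h)) (L : {vspace g}).
Hypothesis LT : spans_roots T L.

Lemma component_root_closed I psi chi : simple_component L I ->
  psi \in roots_in T -> chi \in roots_in T -> e psi \in I ->
  dual_form chi psi != 0 -> e chi \in I.
Proof.
have [_ TL _ _] := LT => -[[IL LI] _] pT xT pI.
have nL : e (- psi) \in L by apply: TL; rewrite roots_inN.
by case: (ideal_root_closed LI (roots_in_root pT) (roots_in_root xT) nL (TL _ xT) pI).
Qed.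

(** The components in the cascade are abstract simple ideals. The ideal property and connectedness
    put the simple root vectors of the support into [I]; if (alpha, beta) < 0, then [beta + alpha]
    would be a root of [I] above [beta]. *)
Lemma highest_root_facts I beta : simple_component L I -> highest_root P I beta ->
  [/\ pos_in T beta, {in root_support P beta, forall alpha, e alpha \in I}
    & {in root_support P beta, forall alpha, 0 <= dual_form alpha beta}].
Proof.
move=> sI; have [[IL LI] _] := sI => -[betaP bI high].
have rb := pos_root betaP; have betaC := pos_cone betaP.
have eI : e beta \in I by rewrite -rootspace_subE.
have bT : pos_in T beta.
  by rewrite -roots_in_pos // -(spans_rootsP LT) // (subv_trans bI).
have simple_in alpha : alpha \in root_support P beta -> alpha \in roots_in T.
  move=> aC; have asr := root_support_simple betaP aC.
  rewrite roots_in_pos ?simple_pos // pos_in_simple //.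
  by have /pos_inP[_] := bT; apply.
have bR : beta \in roots_in T by rewrite roots_in_pos.
have inI : {in root_support P beta, forall alpha, e alpha \in I}.
  have [x y xC yC xI yI|//|none] := @support_connected (fun gamma => e gamma \in I) beta betaP.
    apply/eqP; apply: contraNT yI => nf; apply: (component_root_closed sI (psi := x)) => //;
      try exact: simple_in.
    by rewrite dual_formC.
  have := dual_form_gt0 rb; rewrite {1}(coef_sum _ betaC) big_seq big1 ?ltxx // => alpha asr.
  have [->|c0] := posnP (coef beta alpha); first by rewrite mul0r.
  have aC : alpha \in root_support P beta by rewrite mem_root_support ?asr.
  have := none _ aC; have [->|nf] := eqVneq (dual_form alpha beta) 0; first by rewrite mulr0.
  by rewrite (component_root_closed sI bR (simple_in _ aC) eI nf).
split=> // alpha aC; have asr := root_support_simple betaP aC; have aP := simple_pos asr.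
rewrite real_leNgt ?real0 ?pos_form_real //; apply/negP => lt0.
have sP : beta + alpha \in P by apply: pos_add; rewrite // dual_formC.
have rs := pos_root sP.
have br : bracket (e beta) (e alpha) \in I.
  apply: (subvP LI); apply: mem_lie_prod; last exact: inI.
  exact: (subvP IL).
have nz := bracket_root_neq0 rb (pos_root aP) rs.
have [a E] := root_space_line rs (rootspace_bracket (root_vec rb) (root_vec (pos_root aP))).
have a0 : a != 0 by apply: contraNneq nz => a0; rewrite E a0 scale0r.
have sI' : e (beta + alpha) \in I.
  by move: br; rewrite E => /(memvZ a^-1); rewrite scalerA mulVf // scale1r.
have := high _ rs; rewrite rootspace_subE // opprD addrA subrr add0r => /(_ sI') nC.
by case: (pos_root aP) => /eqP; have := in_root_cone_anti (pos_cone aP) nC.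
Qed.

(** Two components coincide or meet in 0. In the first case the highest root is unique; in the
    second, nonorthogonal simple roots would force a common root vector. *)
Lemma highest_roots_orth I I' beta beta' : simple_component L I -> highest_root P I beta ->
  simple_component L I' -> highest_root P I' beta' -> beta = beta' \/
  forall alpha gamma, alpha \in root_support P beta -> gamma \in root_support P beta' ->
    dual_form alpha gamma = 0.
Proof.
move=> sI hI sI' hI'; have [bT bI _] := highest_root_facts sI hI.
have [bT' bI' _] := highest_root_facts sI' hI'.
have [II'|I0] := component_eq sI sI'; [left|right].
  rewrite -II' in hI'; have [bP bsub high] := hI; have [bP' bsub' high'] := hI'.
  apply/eqP; rewrite -subr_eq0; apply/eqP/in_root_cone_anti; first exact/high/bsub'/pos_root.
  by rewrite opprB; apply/high'/bsub/pos_root.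
move=> alpha gamma aC cC; apply/eqP; apply: contraT => nf.
have /pos_inP[bP bC] := bT; have /pos_inP[bP' bC'] := bT'.
have asr := root_support_simple bP aC; have csr := root_support_simple bP' cC.
have aT : alpha \in roots_in T.
  by rewrite roots_in_pos ?simple_pos // pos_in_simple // bC.
have cT : gamma \in roots_in T.
  by rewrite roots_in_pos ?simple_pos // pos_in_simple // bC'.
have cI : e gamma \in I.
  by apply: (component_root_closed sI aT cT) (bI _ aC) _; rewrite dual_formC.
have : e gamma \in (I :&: I')%VS by rewrite memv_cap cI bI'.
by rewrite I0 memv0 (negPf (e_neq0 (roots_in_root cT))).
Qed.
End Components.

(* Cascade chains read from the root of the cascade downwards, as needed for inductions that
   restrict to a smaller subalgebra; in_cascade extends a chain at its other end. *)
Inductive casc : {vspace g} -> hdual h -> Prop :=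
| casc_top (L I : {vspace g}) beta :
    simple_component L I -> highest_root P I beta -> casc L beta
| casc_step (L I : {vspace g}) beta phi :
    simple_component L I -> highest_root P I beta -> locally_high P beta ->
    casc (sub_lie (root_support_orth P beta)) phi -> casc L phi.

Lemma casc_offspring L beta beta' : casc L beta -> offspring P beta beta' -> casc L beta'.
Proof.
move=> cb [lh [J [sJ hJ]]];
elim: cb lh sJ => {L beta} [L I beta sI hI|L I beta phi sI hI lb _ IH] lh sJ.
  by apply: casc_step sI hI lh _; apply: casc_top sJ hJ.
by apply: casc_step sI hI lb _; apply: IH.
Qed.

Lemma casc_in_cascade beta : in_cascade P beta -> casc {:g} beta.
Proof.
elim=> {beta} [I beta sI hI|beta beta' _ cb off]; first exact: casc_top sI hI.
exact: casc_offspring cb off.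
Qed.

Lemma in_cascade_casc L phi : casc L phi ->
  (forall I beta, simple_component L I -> highest_root P I beta -> in_cascade P beta) ->
  in_cascade P phi.
Proof.
elim=> {L phi} [L I beta sI hI top|L I beta phi sI hI lb _ IH top]; first exact: top sI hI.
apply: IH => J psi sJ hJ; apply: (cascade_step (top _ _ sI hI)).
by split=> //; exists J.
Qed.

Lemma root_support_orth_sub beta : {subset root_support_orth P beta <= root_support P beta}.
Proof. by move=> alpha; rewrite mem_filter => /andP[]. Qed.

Lemma spans_orth beta : beta \in P ->
  spans_roots (root_support_orth P beta) (sub_lie (root_support_orth P beta)).
Proof.
move=> betaP; apply: spans_sub_lie => alpha /root_support_orth_sub.
exact: root_support_simple.
Qed.

Lemma casc_pos_in T L phi : spans_roots T L -> casc L phi -> pos_in T phi.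
Proof.
move=> LT cL; elim: cL T LT => {L phi} [L I beta sI hI|L I beta phi sI hI _ _ IH] T LT.
  by have [] := highest_root_facts LT sI hI.
have [bT _ _] := highest_root_facts LT sI hI; have /pos_inP[betaP bC] := bT.
have /pos_inP[phiP phiC] := IH _ (spans_orth betaP).
by apply/pos_inP; split=> // alpha /phiC/root_support_orth_sub/bC.
Qed.

Definition supp_orth phi psi := forall alpha gamma,
  alpha \in root_support P phi -> gamma \in root_support P psi -> dual_form alpha gamma = 0.

(** What is retained of [phi] lying strictly below [beta] in a cascade chain. *)
Definition descends beta phi := [/\ locally_high P beta, beta \in P
  & {subset root_support P phi <= root_support_orth P beta}].

(** Follow both chains from the top. At the first place where they choose different components the
    supports become orthogonal; otherwise one chain ends first, or both end at the same root. *)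
Lemma casc_dichotomy T L phi psi : spans_roots T L -> casc L phi -> casc L psi ->
  [\/ phi = psi, supp_orth phi psi, descends phi psi | descends psi phi].
Proof.
move=> LT cL; elim: cL T LT psi
    => {L phi} [L I beta sI hI|L I beta phi sI hI lb cphi IH] T LT psi cpsi.
  move: cpsi sI hI LT; case=> {L psi} [L J gamma sJ hJ|L J gamma psi sJ hJ lc cpsi] sI hI LT.
    by have [->|orth] := highest_roots_orth LT sI hI sJ hJ; [constructor 1|constructor 2].
  have [/pos_inP[gP _] _ _] := highest_root_facts LT sJ hJ.
  have /pos_inP[psiP psiC] := casc_pos_in (spans_orth gP) cpsi.
  have [->|orth] := highest_roots_orth LT sI hI sJ hJ; [constructor 3|constructor 2].
    by split.
  by move=> alpha a aS /psiC/root_support_orth_sub; apply: orth.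
have [/pos_inP[bP _] _ _] := highest_root_facts LT sI hI.
have /pos_inP[phiP phiC] := casc_pos_in (spans_orth bP) cphi.
move: cpsi sI hI LT; case=> {L psi} [L J gamma sJ hJ|L J gamma psi sJ hJ lc cpsi] sI hI LT.
  have [<-|orth] := highest_roots_orth LT sI hI sJ hJ; [constructor 4|constructor 2].
    by split.
  by move=> alpha a /phiC/root_support_orth_sub aS; apply: orth.
have [/pos_inP[gP _] _ _] := highest_root_facts LT sJ hJ.
have /pos_inP[psiP psiC] := casc_pos_in (spans_orth gP) cpsi.
have [E|orth] := highest_roots_orth LT sI hI sJ hJ.
  by apply: IH (spans_orth bP) _ _; rewrite E.
constructor 2 => alpha a /phiC/root_support_orth_sub aS /psiC/root_support_orth_sub.
exact: orth.
Qed.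

Lemma descends_orth beta phi : phi \in P -> descends beta phi -> dual_form phi beta = 0.
Proof.
move=> phiP [_ betaP sub]; rewrite (coef_sum _ (pos_cone phiP)) big_seq big1 // => alpha asr.
have [->|c0] := posnP (coef phi alpha); first by rewrite mul0r.
have : alpha \in root_support P phi by rewrite mem_root_support ?asr //; apply: pos_cone.
by move/sub; rewrite mem_filter => /andP[/eqP -> _]; rewrite mulr0.
Qed.

(** As [beta] and [phi] are orthogonal, [beta + phi] would be a root as well; it is supported in the
    support of [beta] and exceeds the highest root there. *)
Lemma descends_sub beta phi : phi \in P -> descends beta phi -> beta - phi \notin P.
Proof.
move=> phiP des; have f0 := descends_orth phiP des; have [lh betaP sub] := des.
apply/negP => dP.
have r : is_root (beta + phi).
  rewrite -[phi]opprK; apply: root_sub; first exact: pos_root.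
  - exact/is_rootN/pos_root.
  - by rewrite dual_formNr dual_formC f0 oppr0.
  exact: pos_root.
have sP : beta + phi \in P by case: PP => _ _ _; apply.
have [_ _ high] := lh.
have nC : in_root_cone P (beta - (beta + phi)).
  apply: high => //; rewrite (spans_rootsP (spans_sub_lie (root_support_simple betaP))) //.
  rewrite roots_in_pos //; apply/pos_inP; split=> // alpha.
  rewrite root_supportD; [|exact: pos_cone|exact: pos_cone] => /orP[//|/sub].
  exact: root_support_orth_sub.
rewrite opprD addrA subrr add0r in nC.
by case: (pos_root phiP) => /eqP; have := in_root_cone_anti (pos_cone phiP) nC.
Qed.

Lemma supp_orth_form phi psi : phi \in P -> psi \in P -> supp_orth phi psi ->
  dual_form phi psi = 0.
Proof. by move=> phiP psiP /(orth_support_not_root phiP psiP)[]. Qed.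

Lemma root_support_sub_pos phi psi : psi \in P -> phi - psi \in P ->
  {subset root_support P psi <= root_support P phi}.
Proof. by move=> /pos_cone psiC /pos_cone; apply: root_support_sub. Qed.

Lemma mem_cascade beta : (beta \in cascade P) <-> in_cascade P beta.
Proof.
rewrite mem_filter; split=> [/andP[/asboolP //]|cb]; apply/andP; split; first exact/asboolP.
by have /pos_inP[] := casc_pos_in spans_full (casc_in_cascade cb).
Qed.

Lemma cascade_pos beta : beta \in cascade P -> beta \in P.
Proof. by rewrite mem_filter => /andP[]. Qed.

Lemma cascade_dichotomy phi psi : phi \in cascade P -> psi \in cascade P ->
  [\/ phi = psi, supp_orth phi psi, descends phi psi | descends psi phi].
Proof.
move=> /mem_cascade/casc_in_cascade c1 /mem_cascade/casc_in_cascade c2.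
exact: casc_dichotomy spans_full c1 c2.
Qed.

Lemma cascade_orth phi psi : phi \in cascade P -> psi \in cascade P -> phi != psi ->
  dual_form phi psi = 0.
Proof.
move=> c1 c2 /eqP ne; have p1 := cascade_pos c1; have p2 := cascade_pos c2.
case: (cascade_dichotomy c1 c2) => // [o|d|d]; first exact: supp_orth_form.
  by rewrite dual_formC descends_orth.
exact: descends_orth.
Qed.

(** Both supports contain that of [phi], so they are not orthogonal. If one cascade root descends
    from the other, so does [phi], contrary to [descends_sub]. *)
Lemma cascade_sub_uniq phi beta beta' : phi \in P -> beta \in cascade P -> beta' \in cascade P ->
  beta - phi \in P -> beta' - phi \in P -> beta = beta'.
Proof.
move=> phiP c1 c2 d1 d2; have p1 := cascade_pos c1; have p2 := cascade_pos c2.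
have sub1 := root_support_sub_pos phiP d1; have sub2 := root_support_sub_pos phiP d2.
have [alpha aS] := root_support_neq0 phiP.
case: (cascade_dichotomy c1 c2) => [//|o|[? ? s]|[? ? s]].
- have := o _ _ (sub1 _ aS) (sub2 _ aS) => f0.
  have := dual_form_neq0 (pos_root (simple_pos (root_support_simple phiP aS))).
  by rewrite f0 eqxx.
- have d : descends beta phi by split=> // x /sub2/s.
  by have := descends_sub phiP d; rewrite d1.
have d : descends beta' phi by split=> // x /sub1/s.
by have := descends_sub phiP d; rewrite d2.
Qed.

(** Take the highest root [beta] of a component above [phi]. If (phi, beta) is nonzero it is
    positive, and [beta] works. Otherwise [phi] is supported in the simple roots orthogonal to
    [beta], a strictly smaller set, since (beta, beta) > 0 forces some simple root of the support to
    pair positively with [beta]. *)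
Lemma casc_exists T L phi : spans_roots T L -> pos_in T phi ->
  exists2 beta, casc L beta & beta = phi \/ beta - phi \in P.
Proof.
pose m (T : seq (hdual h)) := size [seq alpha <- sr | alpha \in T].
have [k] := ubnP (m T); elim: k T L => // k IH T L ltk LT phiT.
have [I [beta [sI hI lb bT [dC ge0]]]] := highest_component LT phiT.
have /pos_inP[betaP bS] := bT; have /pos_inP[phiP phiS] := phiT.
have sub := root_support_sub (pos_cone phiP) dC.
have phiB : pos_in (root_support P beta) phi by apply/pos_inP; split.
have [fge0 f0] := @coef_sum_ge0 _ phi beta phiB (fun alpha aS _ => ge0 _ (bS _ aS)).
have [fE|nf] := eqVneq (dual_form phi beta) 0; last first.
  exists beta; first exact: casc_top sI hI.
  have [E|ne] := eqVneq beta phi; [by left|right].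
  have r : is_root (beta - phi).
    apply: root_sub_pos => //; try exact: pos_root.
    by rewrite dual_formC lt_neqAle eq_sym nf.
  apply: contraT => nP; have := pos_cone (pos_neg r nP) => nC.
  by case/eqP: ne; apply/eqP; rewrite -subr_eq0; apply/eqP/in_root_cone_anti.
have phiO : pos_in (root_support_orth P beta) phi.
  apply/pos_inP; split=> // alpha aS; rewrite mem_filter sub // andbT.
  by rewrite (f0 fE).
have [|beta' cb bE] := IH _ _ _ (spans_orth betaP) phiO; last first.
  by exists beta' => //; apply: casc_step sI hI lb cb.
rewrite -ltnS; apply: leq_trans ltk; rewrite ltnS /m.
have [alpha [asr ca fa]] := pos_simple_form_gt0 betaP.
have aB : alpha \in root_support P beta by rewrite mem_root_support ?asr //; apply: pos_cone.
have : uniq (alpha :: [seq alpha <- sr | alpha \in root_support_orth P beta]).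
  rewrite /= filter_uniq ?simple_uniq // andbT mem_filter mem_filter.
  by rewrite (gt_eqF fa).
move/uniq_leq_size => /(_ [seq alpha <- sr | alpha \in T]); apply => gamma.
rewrite inE => /orP[/eqP ->|]; first by rewrite mem_filter asr bS.
rewrite mem_filter => /andP[/root_support_orth_sub gB gsr].
by rewrite mem_filter gsr bS.
Qed.

Lemma cascade_exists phi : phi \in P ->
  exists2 beta, beta \in cascade P & beta = phi \/ beta - phi \in P.
Proof.
move=> phiP; have phiT : pos_in sr phi.
  by apply/pos_inP; split=> //; apply: root_support_simple.
have [beta cb bE] := casc_exists spans_full phiT; exists beta => //.
apply/mem_cascade; apply: in_cascade_casc cb _ => I gamma sI hI.
exact: cascade_head sI hI.
Qed.

End Positive.

(** * Restriction of invariants to the cascade *)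

Section Invariants.
Local Notation N := (nplus P).
Local Notation vb := (vbasis (nplus P)).

Lemma nplus_comb (y : g) : y \in N -> exists c : hdual h -> K, y = \sum_(phi <- P) c phi *: e phi.
Proof.
have gen (s : seq (hdual h)) v : uniq s -> {subset s <= P} ->
    v \in (\sum_(phi <- s) rootspace phi)%VS ->
    exists c : hdual h -> K, v = \sum_(phi <- s) c phi *: e phi.
  elim: s v => [|phi s IH] v /=.
    by rewrite !big_nil memv0 => _ _ /eqP ->; exists (fun=> 0); rewrite big_nil.
  move=> /andP[nphi us] sP; rewrite big_cons.
  have sP' : {subset s <= P} by move=> psi ps; apply: sP; rewrite inE ps orbT.
  have rphi : is_root phi by apply/pos_root/sP; rewrite mem_head.
  move=> /memv_addP[_ /(root_space_line rphi)[a ->] [u /(IH _ us sP')[c ->] ->]].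
  exists (fun psi => if psi == phi then a else c psi); rewrite big_cons eqxx.
  congr (_ + _); rewrite !big_seq; apply: eq_bigr => psi ps.
  by case: eqP ps nphi => // -> ->.
by move=> yN; apply: gen yN => //; case: PP.
Qed.

Lemma e_nplus phi : phi \in P -> e phi \in N.
Proof.
move=> phiP; rewrite /nplus (big_rem phi) //=; apply: (subvP (addvSl _ _)).
exact/root_vec/pos_root.
Qed.

Lemma nplus_bracket phi (y : g) : phi \in P -> y \in N -> bracket (e phi) y \in N.
Proof.
move=> phiP /nplus_comb[c ->]; rewrite bracket_sumr big_seq memv_suml // => psi psiP.
rewrite bracketZr memvZ //; have r1 := pos_root phiP; have r2 := pos_root psiP.
have br := rootspace_bracket (root_vec r1) (root_vec r2).
have [r|nr] := pselect (is_root (phi + psi)); last first.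
  by rewrite (bracket_rootspace0 (root_vec r1) (root_vec r2)) ?mem0v ?pos_addr_neq0.
have [a ->] := root_space_line r br; rewrite memvZ // e_nplus //.
by case: PP => _ _ _; apply.
Qed.

Lemma killing_root_vec phi psi : phi \in P -> psi \in P ->
  killing (e phi) (e (- psi)) = (phi == psi)%:R.
Proof.
move=> phiP psiP; have r1 := pos_root phiP; have r2 := pos_root psiP.
have [->|ne] := eqVneq phi psi; first by have [] := eP r2.
by rewrite (killing_rootspace (root_vec r1) (root_vecN r2)) // subr_eq0.
Qed.

Lemma killing_comb (c : hdual h -> K) psi : psi \in P ->
  killing (\sum_(phi <- P) c phi *: e phi) (e (- psi)) = c psi.
Proof.
move=> psiP; rewrite killing_suml (bigD1_seq psi) //=; last by case: PP.
rewrite killingZl killing_root_vec // eqxx mulr1 big_seq_cond big1 ?addr0 // => phi.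
by move=> /andP[phiP ne]; rewrite killingZl killing_root_vec // (negPf ne) mulr0.
Qed.

(* At a point of r_-^x, the tangent space of the coadjoint N-orbit and r_- span n_-: in terms of
   the annihilator y, bracketing with e_(beta - phi) isolates the coordinate of y at phi. *)
Lemma transversality (a : hdual h -> K) (y : g) : y \in N ->
  (forall beta, beta \in cascade P -> a beta != 0) ->
  (forall beta, beta \in cascade P -> killing y (e (- beta)) = 0) ->
  (forall phi, phi \in P ->
     killing (bracket (e phi) y) (\sum_(beta <- cascade P) a beta *: e (- beta)) = 0) ->
  y = 0.
Proof.
move=> yN a0 yr yorb; have [c yE] := nplus_comb yN.
rewrite yE big_seq big1 // => phi phiP.
have [beta bc bE] := cascade_exists phiP; have bP := cascade_pos bc.
have [E|ne] := eqVneq beta phi.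
  by have := yr _ bc; rewrite yE killing_comb // E => ->; rewrite scale0r.
have {bE} dP : beta - phi \in P by case: bE => // E; rewrite E eqxx in ne.
have r1 := pos_root dP; have rphi := pos_root phiP.
have casc_uniq : uniq (cascade P) by rewrite filter_uniq //; case: PP.
have := yorb _ dP; rewrite yE bracket_sumr killing_suml (bigD1_seq phi) //=; last by case: PP.
(* A nonzero pairing requires beta - phi + psi = beta'. Then [beta] and [beta'] both exceed
   [beta - phi] by a positive root, so they agree by uniqueness. *)
have zero psi beta' : psi \in P -> beta' \in cascade P -> (psi != phi) || (beta' != beta) ->
    killing (bracket (e (beta - phi)) (e psi)) (e (- beta')) = 0.
  move=> psiP b'c ne'; have rpsi := pos_root psiP.
  rewrite (killing_rootspace (rootspace_bracket (root_vec r1) (root_vec rpsi))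
            (root_vecN (pos_root (cascade_pos b'c)))) //.
  rewrite subr_eq0; apply: contraTneq ne' => E; rewrite negb_or !negbK.
  have bb' : beta = beta'.
    apply: (cascade_sub_uniq dP bc b'c).
      by rewrite opprB addrCA subrr addr0.
    by rewrite -E addrAC subrr add0r.
  rewrite -bb' eqxx andbT; apply/eqP; apply: (addrI (beta - phi)).
  by rewrite E -bb' subrK.
rewrite [X in _ + X]big1_seq ?addr0 => [|psi /andP[ne' psiP]]; last first.
  rewrite bracketZr killingZl killing_sumr big_seq big1 ?mulr0 // => beta' b'c.
  by rewrite killingZr zero ?mulr0 // ne'.
rewrite bracketZr killingZl killing_sumr (bigD1_seq beta) //= [X in _ + X]big1_seq ?addr0.
  rewrite killingZr => /eqP; rewrite !mulf_eq0 (negPf (a0 _ bc)) /=.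
  have rs : is_root (beta - phi + phi) by rewrite subrK; apply: pos_root.
  have [k brE] := root_space_line rs (rootspace_bracket (root_vec r1) (root_vec rphi)).
  have nz := bracket_root_neq0 r1 rphi rs.
  have k0 : k != 0 by apply: contraNneq nz => k0; rewrite brE k0 scale0r.
  by rewrite brE killingZl subrK killing_root_vec // eqxx mulr1 (negPf k0) orbF
    => /eqP ->; rewrite scale0r.
by move=> beta' /andP[ne' b'c]; rewrite killingZr zero ?mulr0 // ne' orbT.
Qed.

Definition point v : 'I_(\dim N) -> K := fun i => killing vb`_i v.

Lemma meval_Sym_inj v (y : g) : y \in N -> meval (point v) (Sym_inj N y) = killing y v.
Proof.
move=> yN; rewrite /Sym_inj raddf_sum /= [in RHS](coord_vbasis yN) killing_suml.
by apply: eq_bigr => i _; rewrite mevalZ mevalXU killingZl.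
Qed.

Lemma mderiv_Sym_inj j (y : g) : mderiv j (Sym_inj N y) = mpolyC (\dim N) (coord vb j y).
Proof.
rewrite /Sym_inj raddf_sum /= (bigD1 j) //= big1 => [|i ne].
  rewrite mderivZ mderivX mnm1E eqxx scale1r.
  have -> : mnm_sub (mnm1 j) (mnm1 j) = mnm0 by apply/mnmP => k; rewrite mnmBE subnn mnmE.
  by rewrite mpolyX0 addr0 alg_mpolyC.
by rewrite mderivZ mderivX mnm1E (negPf ne) scale0r scaler0.
Qed.

Lemma Sym_inj_linear : linear (Sym_inj N).
Proof.
move=> a x y; rewrite /Sym_inj scaler_sumr -big_split; apply: eq_bigr => i _ /=.
by rewrite linearP scalerDl scalerA.
Qed.

(** The derivation of S(n) that extends [ad (e phi)], that is, the infinitesimal coadjoint action on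
    polynomial functions. *)
Definition n_field phi := vfield (fun i : 'I_(\dim N) => Sym_inj N (bracket (e phi) vb`_i)).

(** The gradient of a polynomial at a point of n_- is read as a vector [y] of n; its pairings with
    the [e (- beta)] and with the orbit directions are directional derivatives, and [transversality]
    makes it vanish. *)
Lemma n_field_vanish (f : Sym N) : (forall phi, phi \in P -> n_field phi f = 0) ->
  (forall v, r_minus_times P e v -> Sym_eval f v = 0) -> f = 0.
Proof.
move=> fN fr; pose X := {phi : hdual h | phi \in P}.
pose Z z := exists2 v, r_minus_times P e v & z = point v.
apply: (@vfield_vanish _ _ X (fun (t : X) i => Sym_inj N (bracket (e (val t)) vb`_i))
  (fun (t : X) j i => coord vb j (bracket (e (val t)) vb`_i)) Z f).
- by move=> phi i j; apply: mderiv_Sym_inj.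
- move=> q q0 qN j _ [v vr ->]; have [a [a0 vE]] := vr.
  pose y := \sum_i meval (point v) (mderiv i q) *: vb`_i.
  have yN : y \in N by rewrite memv_suml // => i _; rewrite memvZ //
      vbasis_mem // mem_nth ?size_tuple.
  suff y0 : y = 0.
    have := basis_free (vbasisP N) => /freeP/(_ _ y0); exact.
  apply: (transversality yN a0) => [beta bc|phi phiP].
    rewrite killing_suml; under eq_bigr do rewrite killingZl.
    apply: (@mderiv_line _ _ _ (point (e (- beta))) (- a beta)) => c ne.
    pose v' := v + c *: e (- beta).
    rewrite -[RHS](q0 (point v')); last first.
      exists v' => //; exists (fun psi => if psi == beta then a beta + c else a psi); split.
        move=> psi pc; case: (psi =P beta) => _; last exact: a0.
        by rewrite addrC addr_eq0.
      have casc_uniq : uniq (cascade P) by rewrite filter_uniq //; case: PP.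
      rewrite /v' vE (bigD1_seq beta) //= [RHS](bigD1_seq beta) //= eqxx scalerDl.
      rewrite addrAC; congr (_ + _).
      by apply: eq_bigr => psi /negPf ->.
    by apply: meval_eq => i; rewrite /point killingDr killingZr.
  rewrite -vE /y bracket_sumr killing_suml.
  have := qN (exist _ phi phiP) (point v) (ex_intro2 _ _ v vr erefl).
  rewrite /vfield raddf_sum /= => E; rewrite -[RHS]E; apply: eq_bigr => i _.
  rewrite mevalM meval_Sym_inj ?bracketZr ?killingZl //.
  by apply: nplus_bracket => //; rewrite vbasis_mem // mem_nth ?size_tuple.
- by move=> [phi phiP]; apply: fN.
- by move=> _ [v vr ->]; apply: fr.
exists (point (\sum_(beta <- cascade P) 1 *: e (- beta))).
exists (\sum_(beta <- cascade P) 1 *: e (- beta)) => //.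
by exists (fun=> 1); split=> // beta _; apply: oner_neq0.
Qed.

(** Each application of [ad (e phi)] shifts the weight by [phi]; the shifted weights are distinct,
    and at most [\dim {:g}] of them occur. *)
Lemma ad_root_nilpotent phi : is_root phi ->
  exists m, forall j (y : g), (m <= j)%N -> iter j (ad (e phi)) y = 0.
Proof.
move=> rphi; have nz : phi != 0 by case: rphi.
have [b [w [bP wP]]] := weight_basis hC.
have step i j : iter j (ad (e phi)) b`_(nat_of_ord i) \in rootspace (w i + phi *+ j).
  elim: j => [|j IH]; first by rewrite mulr0n addr0 (weight_vec wP).
  by rewrite /= adE mulrS addrCA rootspace_bracket // root_vec.
exists (\dim {:g}).+1 => j y lej.
have iter0 k : iter k (ad (e phi)) 0 = 0 by elim: k => [|k IH] //=; rewrite IH linear0.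
have iterL k : linear (iter k (ad (e phi))).
  by elim: k => [|k IH] a u v //=; rewrite IH linearP.
have lin (k : nat) : iter k (ad (e phi)) y = \sum_i coord b i y *: iter k (ad (e phi)) b`_i.
  rewrite [in LHS](coordE bP y); elim/big_rec2: _ => [|i u v _ <-]; first exact: iter0.
  by rewrite iterL.
rewrite lin big1 // => i _; suff -> : iter j (ad (e phi)) b`_i = 0 by rewrite scaler0.
have zero k v : v \in rootspace (w i + phi *+ k) ->
    ~ (exists l, w l = w i + phi *+ k) -> v = 0.
  move=> vr nex; rewrite [v](coordE bP) big1 // => l _.
  rewrite (coord_rootspace bP wP vr) ?scale0r //; apply/eqP => wl.
  by apply: nex; exists l.
have [k lek k0] : exists2 k, (k <= \dim {:g})%N & iter k (ad (e phi)) b`_i = 0.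
  apply: contrapT => nex.
  have wex (k : 'I_(\dim {:g}).+1) : exists l, w l = w i + phi *+ k.
    apply: contrapT => nl; apply: nex; exists k; first by rewrite -ltnS.
    exact: zero (step i k) nl.
  have [F FP] := choice wex.
  have : injective F.
    move=> k k' E; apply: val_inj; have := FP k; rewrite E FP => /addrI/esym.
    rewrite -!scaler_nat => /(scaler_root_inj nz)/eqP.
    by rewrite eqr_nat => /eqP.
  by move/leq_card; rewrite !card_ord ltnn.
have -> : j = (j - k + k)%N by rewrite subnK // (leq_trans lek) // ltnW.
by rewrite iterD k0 iter0.
Qed.

Lemma vlim_cvg (u : nat -> g) (l : g) :
  (forall i : 'I_(\dim {:g}), (fun k => coord (vbasis {:g}) i (u k) : K^o) @ \oo -->
     (coord (vbasis {:g}) i l : K^o))%classic ->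
  vlim u = l.
Proof.
move=> ul; rewrite [RHS](coord_vbasis (memvf l)); apply: eq_bigr => i _.
by congr (_ *: _); apply: (cvg_lim _ (ul i)); apply: norm_hausdorff.
Qed.

Lemma Ad_exp_nilpotent (x y : g) m : (forall j, (m <= j)%N -> iter j (ad x) y = 0) ->
  Ad_exp x y = \sum_(j < m) (j`!%:R)^-1 *: iter j (ad x) y.
Proof.
move=> nil; apply: vlim_cvg => i; apply: cvg_near_cst; exists m => // k /= lek.
rewrite -!(big_mkord xpredT (fun j => (j`!%:R)^-1 *: iter j (ad x) y)).
rewrite (big_cat_nat _ lek) //= [X in _ + X]big1_seq ?addr0 // => j.
by rewrite mem_index_iota => /andP[_ /andP[lemj _]]; rewrite nil // scaler0.
Qed.

Lemma Sym_inj_basis (i : 'I_(\dim N)) : Sym_inj N vb`_i = mpolyX K (mnm1 i).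
Proof.
rewrite /Sym_inj (bigD1 i) //= big1 => [|j ne].
  by rewrite coord_free ?(basis_free (vbasisP _)) // eqxx scale1r addr0.
by rewrite coord_free ?(basis_free (vbasisP _)) // eq_sym (negPf (ne : j != i :> 'I__)) scale0r.
Qed.

HB.instance Definition _ := GRing.isSemilinear.Build K g (Sym N) _ (Sym_inj N)
  (GRing.semilinear_linear Sym_inj_linear).

Lemma iter_adZ c (x y : g) j : iter j (ad (c *: x)) y = c ^+ j *: iter j (ad x) y.
Proof.
elim: j => [|j IH] /=; first by rewrite scale1r.
by rewrite IH !adE bracketZl bracketZr scalerA exprS.
Qed.

Lemma N_invariant_field f phi : phi \in P -> N_invariant f -> n_field phi f = 0.
Proof.
move=> phiP finv; have [m nil] := ad_root_nilpotent (pos_root phiP).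
(* The coefficient of c ^ j in the action of [Ad_exp (c *: e phi)] on the variable [i]; [A 1] is the
   field itself. *)
pose A j i := Sym_inj N ((j`!%:R)^-1 *: iter j (ad (e phi)) vb`_(nat_of_ord (i : 'I_(\dim N)))).
have -> : n_field phi f = vfield (A 1%N) f.
  by apply: eq_bigr => i _; rewrite /A /= adE invr1 scale1r.
apply: (@vfield_of_family _ _ m) => [i|c].
  by rewrite /A /= invr1 scale1r Sym_inj_basis.
have fc : Sym_act (Ad_exp (c *: e phi) \o id) f = f.
  by apply: finv; apply: Ad_groupM; [rewrite memvZ // e_nplus|apply: Ad_group1].
rewrite -[RHS]fc; congr comp_mpoly; apply: eq_from_tnth => i; rewrite !tnth_mktuple /=.
rewrite (@Ad_exp_nilpotent _ _ m.+2) => [|j lej].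
  rewrite linear_sum; apply: eq_bigr => j _ /=; rewrite /A iter_adZ.
  by rewrite !linearZ /= !scalerA mulrC.
by rewrite iter_adZ nil ?scaler0 // (leq_trans _ lej) // ltnW.
Qed.

Lemma cvg_sum_seq (I : eqType) (s : seq I) (u : I -> nat -> K^o) (l : I -> K^o) :
  (forall i, i \in s -> (u i @ \oo --> l i)%classic) ->
  ((fun k => \sum_(i <- s) u i k) @ \oo --> \sum_(i <- s) l i)%classic.
Proof.
elim: s => [|i s IH] us.
  rewrite big_nil; apply: cvg_near_cst; apply: nearW => k.
  by rewrite big_nil.
rewrite big_cons.
have ui : (u i @ \oo --> l i)%classic by apply: us; rewrite mem_head.
have us' j : j \in s -> (u j @ \oo --> l j)%classic.
  by move=> js; apply: us; rewrite inE js orbT.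
have -> : (fun k => \sum_(j <- i :: s) u j k) = (fun k => u i k + \sum_(j <- s) u j k).
  by apply/funext => k; rewrite big_cons.
exact: (cvgD ui (IH us')).
Qed.

Definition exp_sum (z : K) (k : nat) : K^o := \sum_(j < k) (j`!%:R)^-1 * z ^+ j.

(** * Torus action on the restrictions *)

Section Torus.
(** The properties of the exponential are kept as hypotheses here, over an abstract field, and are
    supplied for R[i] at the end. *)
Hypothesis cvg_cexp : forall z : K, z \is Num.real -> (exp_sum z @ \oo --> (cexp z : K^o))%classic.

Lemma Ad_exp_torus x (c : hdual h -> K) :
  (forall phi, phi \in P -> phi x \is Num.real) ->
  Ad_exp (vsval x) (\sum_(phi <- P) c phi *: e phi)
  = \sum_(phi <- P) (cexp (phi x) * c phi) *: e phi.
Proof.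
move=> xR; apply: vlim_cvg => i.
have iterE j : iter j (ad (vsval x)) (\sum_(phi <- P) c phi *: e phi)
    = \sum_(phi <- P) (phi x ^+ j * c phi) *: e phi.
  elim: j => [|j IH]; first by apply: eq_bigr => phi _; rewrite expr0 mul1r.
  rewrite /= IH adE bracket_sumr !big_seq; apply: eq_bigr => phi /pos_root rphi.
  have /rootspaceP := root_vec rphi; rewrite bracketZr => ->.
  by rewrite scalerA mulrAC -exprSr.
have -> : (fun k => coord (vbasis {:g}) i (\sum_(j < k) (j`!%:R)^-1 *:
      iter j (ad (vsval x)) (\sum_(phi <- P) c phi *: e phi)) : K^o)
    = (fun k => \sum_(phi <- P) exp_sum (phi x) k * (c phi * coord (vbasis {:g}) i (e phi))).
  apply/funext => k; under eq_bigr do rewrite iterE scaler_sumr.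
  rewrite exchange_big linear_sum /=; apply: eq_bigr => phi _.
  rewrite /exp_sum mulr_suml linear_sum /=; apply: eq_bigr => j _.
  by rewrite scalerA linearZ /= !mulrA.
rewrite linear_sum /=; apply: cvg_sum_seq => phi phiP.
rewrite linearZ /= -mulrA; apply: cvgMr_tmp.
exact/cvg_cexp/xR.
Qed.

Lemma Ad_exp_nplus x (y : g) : (forall phi, phi \in P -> phi x \is Num.real) ->
  y \in N -> Ad_exp (vsval x) y \in N.
Proof.
move=> xR /nplus_comb[c ->]; rewrite Ad_exp_torus // big_seq memv_suml // => phi phiP.
by rewrite memvZ // e_nplus.
Qed.

Lemma killing_Ad_exp x (y : g) beta : (forall phi, phi \in P -> phi x \is Num.real) ->
  y \in N -> beta \in P ->
  killing (Ad_exp (vsval x) y) (e (- beta)) = cexp (beta x) * killing y (e (- beta)).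
Proof.
move=> xR /nplus_comb[c ->] bP; rewrite Ad_exp_torus //.
by rewrite (killing_comb (fun phi => cexp (phi x) * c phi)) // killing_comb.
Qed.

Local Notation r := (size (cascade P)).
Local Notation cas k := (nth 0 (cascade P) (nat_of_ord k)).

Lemma cas_mem (k : 'I_r) : cas k \in cascade P.
Proof. exact: mem_nth. Qed.

(* Restriction of a polynomial function on n_- to r_-, in the coordinates e_beta. *)
Definition restr (f : Sym N) : mpoly r K :=
  comp_mpoly [tuple \sum_(k < r) killing vb`_i (e (- cas k)) *: mpolyX K (mnm1 k)
             | i < \dim N] f.

Lemma Sym_eval_restr f (a : hdual h -> K) :
  Sym_eval f (\sum_(beta <- cascade P) a beta *: e (- beta))
  = meval (fun k => a (cas k)) (restr f).
Proof.
rewrite /restr comp_mpoly_meval; apply: meval_eq => i; rewrite tnth_mktuple.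
rewrite [RHS]raddf_sum /= (big_nth 0) big_mkord killing_sumr; apply: eq_bigr => k _.
by rewrite mevalZ mevalXU killingZr mulrC.
Qed.

Lemma restr_Sym_inj (y : g) : y \in N ->
  restr (Sym_inj N y) = \sum_(k < r) killing y (e (- cas k)) *: mpolyX K (mnm1 k).
Proof.
move=> yN; rewrite /restr /Sym_inj raddf_sum /=.
under eq_bigr do rewrite comp_mpolyZ comp_mpolyXU -tnth_nth tnth_mktuple scaler_sumr.
rewrite exchange_big; apply: eq_bigr => k _ /=.
rewrite [in RHS](coord_vbasis yN) killing_suml scaler_suml; apply: eq_bigr => i _.
by rewrite killingZl scalerA.
Qed.

Lemma restr_Sym_act x f : (forall phi, phi \in P -> phi x \is Num.real) ->
  restr (Sym_act (Ad_exp (vsval x)) f)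
  = comp_mpoly [tuple cexp (cas k x) *: mpolyX K (mnm1 k) | k < r] (restr f).
Proof.
move=> xR; rewrite /restr /Sym_act !comp_mpolyA; congr comp_mpoly.
apply: eq_from_tnth => i; rewrite !tnth_mktuple -/(restr _).
have bN : vb`_i \in N by rewrite vbasis_mem // mem_nth ?size_tuple.
rewrite restr_Sym_inj ?Ad_exp_nplus // raddf_sum /=; apply: eq_bigr => k _.
rewrite comp_mpolyZ comp_mpolyXU nth_mktuple scalerA mulrC.
by rewrite killing_Ad_exp // (cascade_pos (cas_mem k)).
Qed.

Hypothesis cexp_nat : forall k : nat, cexp (k%:R : K) = cexp 1 ^+ k.
Hypothesis cexp_inj : injective (fun k : nat => cexp (1 : K) ^+ k).

Variables (nu : hdual h) (b : hdual h -> nat).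
Hypothesis nuE : nu = \sum_(beta <- cascade P) beta *+ b beta.

Lemma cascade_uniq : uniq (cascade P).
Proof. by rewrite filter_uniq //; case: PP. Qed.

Lemma restr_weight f :
  (forall x, Sym_act (Ad_exp (vsval x)) f = cexp (nu x) *: f) ->
  exists c, restr f = c *: mpolyX K (Multinom [tuple b (cas k) | k < r]).
Proof.
move=> fw; set mb := Multinom _; exists (mcoeff mb (restr f)); apply/mpolyP => m.
rewrite mcoeffZ mcoeffX; have [->|ne] := eqVneq mb m; first by rewrite mulr1.
rewrite mulr0; apply/eqP; apply: contraNT ne => fm; apply/eqP/mnmP => k0.
pose beta := cas k0; have bc : beta \in cascade P := cas_mem k0.
have rb := pos_root (cascade_pos bc).
(* Half the coroot of [beta]: it is real on roots, 1 at [beta] and 0 at the other cascade roots. The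
   torus weight thus compares [cexp 1] to the power [b beta] with [cexp 1] to the exponent of e_beta
   in [m]. *)
pose x := (dual_form beta beta)^-1 *: dual_vec beta.
have xE phi : phi x = dual_form phi beta / dual_form beta beta.
  by rewrite linearZ /= (dual_formE phi) [RHS]mulrC.
have xR phi : phi \in P -> phi x \is Num.real.
  by move=> /pos_root rphi; rewrite xE rpred_div ?dual_form_real.
have x1 k : cas k x = (k == k0)%:R.
  rewrite xE; have [->|nk] := eqVneq k k0; first by rewrite divff // dual_form_neq0.
  rewrite cascade_orth ?mul0r ?cas_mem // nth_uniq ?cascade_uniq //.
have nux : nu x = (b beta)%:R.
  rewrite nuE sum_lfunE (bigD1_seq beta) ?cascade_uniq //= [X in _ + X]big1_seq ?addr0.
    rewrite -scaler_nat scale_lfunE xE divff ?dual_form_neq0 //; exact: mulr1.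
  move=> psi /andP[ne pc]; rewrite -scaler_nat scale_lfunE xE cascade_orth //.
  by rewrite mul0r scaler0.
have := congr1 (mcoeff m) (restr_Sym_act f xR).
rewrite fw /restr comp_mpolyZ -/(restr f) mcoeffZ mcoeff_comp_scale mulrC.
move/(mulfI fm); rewrite nux cexp_nat (bigD1 k0) //= big1 ?mulr1 => [|k nk].
  rewrite x1 eqxx => /cexp_inj <-.
  by rewrite mnmE.
by rewrite x1 (negPf nk) (cexp_nat 0) expr0 expr1n.
Qed.

Lemma Sym_inj_homog (y : g) : Sym_inj N y \is ishomog1 1 mdeg.
Proof.
apply: rpred_sum => i _; apply: rpredZ.
by rewrite dhomogX; apply/eqP; exact: mdeg1.
Qed.

Lemma Sym_act_pihomog t d (f : Sym N) :
  Sym_act t (pihomog mdeg d f) = pihomog mdeg d (Sym_act t f).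
Proof.
by rewrite pihomog_comp // => i; rewrite tnth_mktuple Sym_inj_homog.
Qed.

Lemma restr_pihomog d f : restr (pihomog mdeg d f) = pihomog mdeg d (restr f).
Proof.
rewrite pihomog_comp // => i; rewrite tnth_mktuple; apply: rpred_sum => k _.
by apply: rpredZ; rewrite dhomogX; apply/eqP; exact: mdeg1.
Qed.

Lemma restr_eq0 f : N_invariant f -> restr f = 0 -> f = 0.
Proof.
move=> finv f0; apply: n_field_vanish => [phi phiP|v [a [_ ->]]].
  exact: N_invariant_field.
by rewrite Sym_eval_restr f0 meval0.
Qed.

Lemma invariant_weight_vector (f : Sym N) : N_invariant f -> weight_vector nu f ->
  [/\ in_Sym_deg (\sum_(beta <- cascade P) b beta)%N f,
      exists v, r_minus_times P e v /\ Sym_eval f v != 0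
    & exists c : K, c != 0 /\
        forall v, r_minus_times P e v ->
          Sym_eval f v = c * \prod_(beta <- cascade P) killing (e beta) v ^+ b beta].
Proof.
move=> finv [nz fw]; have [c cE] := restr_weight fw.
set mb := Multinom _ in cE.
have c0 : c != 0 by apply: contraNneq nz => c0; rewrite (restr_eq0 finv) // cE c0 scale0r.
have degE : mdeg mb = (\sum_(beta <- cascade P) b beta)%N.
  rewrite mdegE (big_nth 0) big_mkord; apply: eq_bigr => k _.
  by rewrite mnmE.
have evalE (a : hdual h -> K) :
    Sym_eval f (\sum_(beta <- cascade P) a beta *: e (- beta))
    = c * \prod_(beta <- cascade P) a beta ^+ b beta.
  rewrite Sym_eval_restr cE mevalZ mevalX [in RHS](big_nth 0) big_mkord.
  by congr (_ * _); apply: eq_bigr => k _; rewrite mnmE.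
split.
(* The group acts by linear substitutions, so every homogeneous component of [f] is invariant, and
   restriction preserves the degree. *)
- rewrite /in_Sym_deg {1}[f](pihomog_partitionE (mf := mdeg) (leqnn _)).
  apply: rpred_sum => d _.
  have [<-|ne] := eqVneq (nat_of_ord d) (\sum_(beta <- cascade P) b beta)%N.
    exact: pihomogP.
  rewrite (@restr_eq0 (pihomog mdeg d f)) ?rpred0 //.
    by move=> t tN; rewrite Sym_act_pihomog finv.
  rewrite restr_pihomog cE; apply: (@pihomog_ne0 _ _ mdeg (mdeg mb)).
    by rewrite degE eq_sym.
  by apply: rpredZ; rewrite dhomogX.
- exists (\sum_(beta <- cascade P) 1 *: e (- beta)); split.
    by exists (fun=> 1); split=> // beta _; apply: oner_neq0.
  by rewrite (evalE (fun=> 1)) big1 ?mulr1 // => beta _; rewrite expr1n.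
exists c; split=> // v [a [_ ->]]; rewrite evalE; congr (_ * _).
apply: eq_big_seq => beta bc; congr (_ ^+ _).
rewrite killing_sumr (bigD1_seq beta) ?cascade_uniq //= [X in _ + X]big1_seq ?addr0.
  by rewrite killingZr killing_root_vec ?cascade_pos // eqxx mulr1.
move=> psi /andP[ne pc]; rewrite killingZr killing_root_vec ?cascade_pos //.
by rewrite eq_sym (negPf ne) mulr0.
Qed.

End Torus.

End Invariants.

End RootTheory.

(** * The complex exponential *)

Section ComplexExponential.
Import numFieldNormedType.Exports.
Variable R : realType.
Local Open Scope complex_scope.
Local Notation C := R[i].

Lemma cvg_real_complex (u : nat -> R) (l : R) : (u @ \oo --> l)%classic ->
  ((fun k => (u k)%:C : C^o) @ \oo --> (l%:C : C^o))%classic.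
Proof.
move=> /cvgrPdist_lt ul; apply/cvgrPdist_lt => eps eps0.
have epsE : eps = (complex.Re eps)%:C by apply/esym/RRe_real/gtr0_real.
have e0 : 0 < complex.Re eps by move: eps0; rewrite {1}epsE ltcR.
have := ul _ e0; apply: filterS => k /= lt.
by rewrite -raddfB normc_def /= expr0n /= addr0 sqrtr_sqr epsE ltcR.
Qed.

Lemma exp_sum_real (x : R) k : exp_sum (x%:C : C) k = (series (exp_coeff x) k)%:C.
Proof.
rewrite /series /= big_mkord raddf_sum; apply: eq_bigr => j _ /=.
by rewrite /exp_coeff /= rmorphM fmorphV rmorphXn rmorph_nat mulrC.
Qed.

Lemma cvg_exp_sum_real (x : R) :
  (exp_sum (x%:C : C) @ \oo --> ((expR x)%:C : C^o))%classic.
Proof.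
have -> : exp_sum (x%:C : C) = (fun k => (series (exp_coeff x) k)%:C).
  by apply/funext => k; apply: exp_sum_real.
by apply: cvg_real_complex; apply: is_cvg_series_exp_coeff.
Qed.

Lemma cexp_real (x : R) : cexp (x%:C : C) = (expR x)%:C.
Proof. exact: (cvg_lim (@norm_hausdorff _ C^o) (@cvg_exp_sum_real x)). Qed.

Lemma cvg_cexp_real (z : C) : z \is Num.real ->
  (exp_sum z @ \oo --> (cexp z : C^o))%classic.
Proof.
by move=> /RRe_real <-; rewrite cexp_real; apply: cvg_exp_sum_real.
Qed.

Lemma cexp_natr k : cexp (k%:R : C) = cexp 1 ^+ k.
Proof.
have E (n : nat) : n%:R = (n%:R : R)%:C by rewrite rmorph_nat.
rewrite E cexp_real -[k%:R]mulr1 expRM_natl rmorphXn /=.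
by rewrite -cexp_real.
Qed.

Lemma cexp1_exp_inj : injective (fun k : nat => cexp (1 : C) ^+ k).
Proof.
move=> k m; rewrite -!cexp_natr.
have E (n : nat) : n%:R = (n%:R : R)%:C by rewrite rmorph_nat.
rewrite !E !cexp_real => -[/expR_inj/eqP].
by rewrite eqr_nat => /eqP.
Qed.
End ComplexExponential.

Local Open Scope complex_scope.

Theorem theorem8 (R : realType) (g : lieAlgType R[i]) (h : {vspace g})
    (P : seq (hdual h)) (e : hdual h -> g)
    (nu : hdual h) (xi : Sym (nplus P)) (b : hdual h -> nat) :
  semisimple_lie g ->
  cartan h ->
  positive_system P ->
  root_vectors e ->
  N_invariant xi ->
  weight_vector nu xi ->
  nu = \sum_(beta <- cascade P) beta *+ b beta ->
  [/\ in_Sym_deg (\sum_(beta <- cascade P) b beta)%N xi,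
      exists v, r_minus_times P e v /\ Sym_eval xi v != 0
    & exists c : R[i], c != 0 /\
        forall v, r_minus_times P e v ->
          Sym_eval xi v =
            c * \prod_(beta <- cascade P) killing (e beta) v ^+ b beta].
Proof.
move=> gS hC PP eP xiN xiw nuE.
exact: (invariant_weight_vector gS hC PP eP (@cvg_cexp_real R) (@cexp_natr R)
  (@cexp1_exp_inj R) nuE xiN xiw).
Qed.
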